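(* As $n\to\infty$, $$SPT^{+}(n)\sim SPT^{-}(n)\sim \frac{\sqrt{3}}{40}\,n\,e^{\pi\sqrt{2n/3}},$$ where $a_n\sim b_n$ means $a_n/b_n\to1$.
   Context: Notation: $(a;q)_n=\prod_{k=0}^{n-1}(1-aq^k)$, $(a;q)_\infty=\prod_{k\ge0}(1-aq^k)$. The sequences $SPT^{\pm}(n)$ are defined by $$\sum_{n\ge1}SPT^{-}(n)q^n=\sum_{n_1\ge1}\frac{q^{n_1}}{(1-q^{n_1})^2(q^{n_1+1};q)_{\infty}}\sum_{n_2\ge1}\frac{q^{n_1n_2+n_2}}{(1-q^{n_2})^2(q^{n_2+1};q)_{n_1}},$$ $$\sum_{n\ge1}SPT^{+}(n)q^n=\sum_{n_1\ge1}\frac{q^{n_1}}{(1-q^{n_1})^2(q^{n_1+1};q)_{\infty}}\sum_{n_2\ge1}\frac{q^{n_2}}{(1-q^{n_2})^2(q^{n_2+1};q)_{n_1}}.$$ *)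

(* Defs.v *)
From Stdlib Require Import Reals Lra Lia Arith.
From Coquelicot Require Import Coquelicot.

Open Scope R_scope.

(* A formal power series in q is its coefficient sequence [nat -> R], with
   Coquelicot's [PS_minus] and Cauchy product [PS_mult].  Infinite sums and
   products are coefficientwise limits; in all the instances below every
   coefficient is eventually constant, so these are limits in the q-adic sense
   and no question of analytic convergence arises. *)
Definition fps : Type := nat -> R.

(* The monomial q^m. *)
Definition fps_q (m : nat) : fps := fun n => if Nat.eqb n m then 1 else 0.

Definition fps_one : fps := fps_q 0.

Fixpoint fps_pow (a : fps) (k : nat) : fps :=
  match k with
  | O => fps_one
  | S k' => PS_mult (fps_pow a k') a
  end.

(* The multiplicative inverse is given by the recursion
   b_0 = 1 / a_0,  b_(n+1) = - (1 / a_0) * sum_(k <= n) a_(k+1) b_(n-k).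
   The first argument is fuel: any value >= n gives the n-th coefficient. *)
Fixpoint fps_inv_rec (a : fps) (fuel n : nat) : R :=
  match fuel, n with
  | S f, S m =>
      - / a O * sum_f_R0 (fun k => a (S k) * fps_inv_rec a f (m - k)) m
  | _, _ => / a O
  end.

Definition fps_inv (a : fps) : fps := fun n => fps_inv_rec a n n.

Definition fps_div (a b : fps) : fps := PS_mult a (fps_inv b).

Lemma fps_inv_rec_fuel (a : fps) (f f' n : nat) :
  (n <= f)%nat -> (n <= f')%nat -> fps_inv_rec a f n = fps_inv_rec a f' n.
Proof.
  revert f' n; induction f as [|f IH]; intros [|f'] [|n] H H';
    try lia; try reflexivity.
  simpl; f_equal; apply sum_eq; intros k Hk; f_equal; apply IH; lia.
Qed.

Lemma fps_mult_inv (a : fps) (n : nat) :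
  a O <> 0 -> PS_mult a (fps_inv a) n = fps_one n.
Proof.
  intros Ha; unfold PS_mult, fps_one, fps_q; destruct n as [|n].
  - simpl; unfold fps_inv; simpl; field; exact Ha.
  - rewrite decomp_sum by lia; simpl Nat.eqb; simpl pred.
    unfold fps_inv at 1; simpl fps_inv_rec.
    rewrite (sum_eq (fun k => a (S k) * fps_inv a (S n - S k)%nat)
                    (fun k => a (S k) * fps_inv_rec a n (n - k))).
    + field; exact Ha.
    + intros k Hk; simpl; f_equal; unfold fps_inv; apply fps_inv_rec_fuel; lia.
Qed.

(* sum_(k >= 1) f k *)
Definition fps_sum_ge1 (f : nat -> fps) : fps :=
  fun n => Series (fun k => f (S k) n).

(* (a;q)_n = prod_(0 <= k < n) (1 - a q^k) *)
Fixpoint qpoch (a : fps) (n : nat) : fps :=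
  match n with
  | O => fps_one
  | S k => PS_mult (qpoch a k) (PS_minus fps_one (PS_mult a (fps_q k)))
  end.

(* (a;q)_oo *)
Definition qpoch_inf (a : fps) : fps :=
  fun n => real (Lim_seq (fun N => qpoch a N n)).

(* (1 - q^m)^2 *)
Definition sq_one_minus_q (m : nat) : fps :=
  fps_pow (PS_minus fps_one (fps_q m)) 2.

Definition SPT_minus : nat -> R :=
  fps_sum_ge1 (fun n1 =>
    PS_mult
      (fps_div (fps_q n1)
         (PS_mult (sq_one_minus_q n1) (qpoch_inf (fps_q (n1 + 1)))))
      (fps_sum_ge1 (fun n2 =>
         fps_div (fps_q (n1 * n2 + n2))
           (PS_mult (sq_one_minus_q n2) (qpoch (fps_q (n2 + 1)) n1))))).

Definition SPT_plus : nat -> R :=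
  fps_sum_ge1 (fun n1 =>
    PS_mult
      (fps_div (fps_q n1)
         (PS_mult (sq_one_minus_q n1) (qpoch_inf (fps_q (n1 + 1)))))
      (fps_sum_ge1 (fun n2 =>
         fps_div (fps_q n2)
           (PS_mult (sq_one_minus_q n2) (qpoch (fps_q (n2 + 1)) n1))))).

Definition asymp_equiv (a b : nat -> R) : Prop :=
  is_lim_seq (fun n => a n / b n) 1.

(* Main.v *)
Require Import Defs.
From Stdlib Require Import Reals Lra Lia Arith FunctionalExtensionality.
From Coquelicot Require Import Coquelicot.
Open Scope R_scope.

(* The sum over n_1, n_2 is the partition generating function P(q) times a double sum
   of rational functions.  Put q = e^(-t), with t = pi / sqrt (6 n).  Multiplied by t^4,
   the (i,j) term tends to 1 / (i^2 j^2 binomial(i+j, i)), for both signs, and is at most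
   1 / (i^2 j^2).  Two telescoping steps turn the sum of the limits into
   sum_(i < k) 1 / (i^2 k^2) = (zeta(2)^2 - zeta(4)) / 2 = pi^4 / 120.

   The n-th coefficient is a Fourier integral over the circle |q| = e^(-t).  For
   |arg q| <= A t^(3/2) a Lindeberg comparison replaces P(q) / P(|q|) by a Gaussian.  On
   the rest of the circle a window of about 1/t consecutive factors 1 / (1 - q^k), present
   in every term with min(i,j) smaller than about 1/t, gives Gaussian decay; the remaining
   terms are exponentially small already on the real axis.

   This leaves the constant in P(e^(-t)) ~ c sqrt t exp (pi^2 / (6 t)).  Gauss's identity
   sum_s q^(s(s+1)/2) = prod (1 - q^(2k))^2 / (1 - q^k) expresses c through the Gaussian
   integral, so the latter cancels from the final asymptotics and is never evaluated. *)

(** The two series differ only in an exponent whose effect vanishes as q tends to 1, so one argument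
    with that exponent as a parameter serves both. P(q) / P(|q|) is the characteristic function of
    the size of a random partition in which the parts have independent geometric multiplicities. The
    mean size is pi^2 / (6 t^2) + O(1/t) and the variance is close to (pi^2 / 3) / t^3. Hence t = pi
    / sqrt (6 n) centres the mean at n up to an error small against the standard deviation, and the
    central arc has width of order t^(3/2). This is o(t), so there the rational factors behave as on
    the real axis. The obstacle is uniformity in i and j: the (i,j) term keeps only the factors 1 /
    (1 - q^k) with k > i and those with j < k <= i + j, whence the search for a window common to all
    terms. Products are cut at the part n, which leaves the coefficient of q^n unchanged and keeps
    every sum and product finite. In place of a modular transformation, the logarithm of P is
    controlled by a relation between t and 2t, which is enough for a limit. *)

(** * Finite sums *)

Fixpoint rsum (f : nat -> R) (n : nat) : R :=
  match n with O => 0 | S k => rsum f k + f k end.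

Lemma rsum_ext (f g : nat -> R) (n : nat) :
  (forall k, (k < n)%nat -> f k = g k) -> rsum f n = rsum g n.
Proof.
  induction n as [|n IH]; intros H; [reflexivity|].
  simpl; rewrite IH by (intros; apply H; lia); rewrite H by lia; reflexivity.
Qed.

Lemma rsum_le (f g : nat -> R) (n : nat) :
  (forall k, (k < n)%nat -> f k <= g k) -> rsum f n <= rsum g n.
Proof.
  induction n as [|n IH]; intros H; [apply Rle_refl|].
  simpl; apply Rplus_le_compat; [apply IH; intros; apply H; lia|apply H; lia].
Qed.

Lemma rsum_plus (f g : nat -> R) (n : nat) :
  rsum (fun k => f k + g k) n = rsum f n + rsum g n.
Proof. induction n as [|n IH]; simpl; [ring|rewrite IH; ring]. Qed.

Lemma rsum_minus (f g : nat -> R) (n : nat) :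
  rsum (fun k => f k - g k) n = rsum f n - rsum g n.
Proof. induction n as [|n IH]; simpl; [ring|rewrite IH; ring]. Qed.

Lemma rsum_scal (c : R) (f : nat -> R) (n : nat) :
  rsum (fun k => c * f k) n = c * rsum f n.
Proof. induction n as [|n IH]; simpl; [ring|rewrite IH; ring]. Qed.

Lemma rsum_const (c : R) (n : nat) : rsum (fun _ => c) n = INR n * c.
Proof.
  induction n as [|n IH]; [simpl; ring|].
  rewrite S_INR; simpl rsum; rewrite IH; ring.
Qed.

Lemma rsum_nonneg (f : nat -> R) (n : nat) :
  (forall k, (k < n)%nat -> 0 <= f k) -> 0 <= rsum f n.
Proof.
  intros H; rewrite <- (Rmult_0_r (INR n)), <- rsum_const; apply rsum_le; exact H.
Qed.

Lemma rsum_abs (f : nat -> R) (n : nat) :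
  Rabs (rsum f n) <= rsum (fun k => Rabs (f k)) n.
Proof.
  induction n as [|n IH]; simpl; [rewrite Rabs_R0; lra|].
  eapply Rle_trans; [apply Rabs_triang|lra].
Qed.

Lemma rsum_add (f : nat -> R) (m n : nat) :
  rsum f (m + n) = rsum f m + rsum (fun k => f (m + k)%nat) n.
Proof.
  induction n as [|n IH]; [rewrite Nat.add_0_r; simpl; ring|].
  rewrite Nat.add_succ_r; simpl; rewrite IH; ring.
Qed.

Lemma rsum_rev (f : nat -> R) (n : nat) :
  rsum f n = rsum (fun k => f (n - 1 - k)%nat) n.
Proof.
  induction n as [|n IH]; [reflexivity|].
  rewrite <- (Nat.add_1_l n) at 2; rewrite rsum_add; simpl rsum at 1 2.
  rewrite IH, Rplus_comm, Rplus_0_l; f_equal; [f_equal; lia|].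
  apply rsum_ext; intros k Hk; f_equal; lia.
Qed.

Lemma rsum_swap (f : nat -> nat -> R) (m n : nat) :
  rsum (fun i => rsum (f i) n) m = rsum (fun j => rsum (fun i => f i j) m) n.
Proof.
  induction m as [|m IH]; simpl.
  - rewrite rsum_const; ring.
  - rewrite IH, <- rsum_plus; reflexivity.
Qed.

Lemma rsum_mono (f : nat -> R) (m n : nat) :
  (forall k, 0 <= f k) -> (m <= n)%nat -> rsum f m <= rsum f n.
Proof.
  intros H Hmn; replace n with (m + (n - m))%nat by lia.
  rewrite rsum_add; pose proof (rsum_nonneg (fun k => f (m + k)%nat) (n - m)).
  assert (0 <= rsum (fun k => f (m + k)%nat) (n - m)) by (apply H0; intros; apply H).
  lra.
Qed.

Lemma rsum_telescope (f : nat -> R) (n : nat) :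
  rsum (fun k => f k - f (S k)) n = f O - f n.
Proof. induction n as [|n IH]; simpl; [ring|rewrite IH; ring]. Qed.

Lemma sum_n_rsum (f : nat -> R) (n : nat) : sum_n f n = rsum f (S n).
Proof.
  induction n as [|n IH]; [rewrite sum_O; simpl; ring|].
  rewrite sum_Sn, IH; reflexivity.
Qed.

Lemma is_series_rsum (f : nat -> R) (l : R) :
  is_series f l <-> is_lim_seq (rsum f) l.
Proof.
  split; intros H.
  - apply is_lim_seq_incr_1.
    apply is_lim_seq_ext with (sum_n f); [intros; apply sum_n_rsum|exact H].
  - change (is_lim_seq (sum_n f) l).
    apply (is_lim_seq_ext (fun n => rsum f (S n)));
      [intros; symmetry; apply sum_n_rsum|].
    apply (is_lim_seq_incr_1 (rsum f)); exact H.
Qed.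

Lemma is_lim_seq_le_const_l (u : nat -> R) (l c : R) :
  is_lim_seq u l -> (forall n, u n <= c) -> l <= c.
Proof.
  intros H1 H2.
  exact (is_lim_seq_le u (fun _ => c) l c H2 H1 (is_lim_seq_const c)).
Qed.

Lemma rsum_le_series (f : nat -> R) (l : R) (n : nat) :
  (forall k, 0 <= f k) -> is_series f l -> rsum f n <= l.
Proof.
  intros Hf Hl; apply is_series_rsum in Hl.
  apply is_lim_seq_incr_compare with (u := rsum f); [exact Hl|].
  intros k; simpl; specialize (Hf k); lra.
Qed.

(** * The values of zeta(2) and zeta(4) *)

Lemma rsum_fold_double (f : nat -> R) (m : nat) :
  rsum f (2 * m) = rsum (fun k => f k + f (2 * m - 1 - k)%nat) m.
Proof.
  rewrite rsum_plus; replace (2 * m)%nat with (m + m)%nat at 1 by lia.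
  rewrite rsum_add; f_equal; rewrite rsum_rev; apply rsum_ext.
  intros k Hk; f_equal; lia.
Qed.

(** Odd multiples only: the sums of inverse powers of these angles are sums over odd integers. The
    number of angles doubles with each level, which makes an induction on [N] possible. *)
Definition dyadic_angle (N k : nat) : R := (2 * INR k + 1) * PI / 2 ^ (N + 2).

Lemma dyadic_angle_bounds (N k : nat) :
  (k < 2 ^ N)%nat -> 0 < dyadic_angle N k < PI / 2.
Proof.
  intros H; unfold dyadic_angle; pose proof PI_RGT_0; pose proof (pos_INR k).
  assert (H2 : 0 < 2 ^ (N + 2)) by (apply pow_lt; lra).
  assert (H3 : INR k + 1 <= 2 ^ N).
  { rewrite <- S_INR; change 2 with (INR 2); rewrite <- pow_INR; apply le_INR; lia. }
  split.
  - apply Rdiv_lt_0_compat; [apply Rmult_lt_0_compat; lra|exact H2].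
  - apply Rmult_lt_reg_r with (2 ^ (N + 2)); [exact H2|].
    unfold Rdiv at 1; rewrite Rmult_assoc, Rinv_l, Rmult_1_r by lra.
    rewrite pow_add; nra.
Qed.

(** With s = sin (y/2) and c = cos (y/2), both identities follow from s^2 + c^2 = 1 and sin y = 2 s
    c. They are the induction step for the sums over dyadic angles. *)
Lemma inv_sq_sin_halving (y : R) :
  0 < y < PI / 2 ->
  (/ sin (y / 2)) ^ 2 + (/ sin (PI / 2 - y / 2)) ^ 2 = 4 * (/ sin y) ^ 2 /\
  (/ sin (y / 2)) ^ 4 + (/ sin (PI / 2 - y / 2)) ^ 4 =
    16 * (/ sin y) ^ 4 - 8 * (/ sin y) ^ 2.
Proof.
  intros H; rewrite sin_shift.
  assert (Hs : 0 < sin (y / 2)) by (apply sin_gt_0; lra).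
  assert (Hc : 0 < cos (y / 2)) by (apply cos_gt_0; lra).
  assert (E : sin y = 2 * sin (y / 2) * cos (y / 2))
    by (rewrite <- sin_2a; f_equal; field).
  pose proof (sin2_cos2 (y / 2)) as E1; unfold Rsqr in E1.
  rewrite E; set (s := sin (y / 2)) in *; set (c := cos (y / 2)) in *.
  assert (E2 : s ^ 2 + c ^ 2 = 1) by (rewrite <- E1; ring).
  split.
  - transitivity ((s ^ 2 + c ^ 2) / (s ^ 2 * c ^ 2)); [field; lra|].
    rewrite E2; field; lra.
  - transitivity (((s ^ 2 + c ^ 2) ^ 2 - 2 * s ^ 2 * c ^ 2) / (s ^ 4 * c ^ 4));
      [field; lra|].
    rewrite E2; field; lra.
Qed.

(** The lower half of the level [S N] consists of the halved angles of level [N]; the mirrored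
    indices give their complements to PI / 2. *)
Lemma dyadic_halving (f : R -> R) (N : nat) :
  rsum (fun k => f (dyadic_angle (S N) k)) (2 ^ S N) =
  rsum (fun k => f (dyadic_angle N k / 2) + f (PI / 2 - dyadic_angle N k / 2)) (2 ^ N).
Proof.
  replace (2 ^ S N)%nat with (2 * 2 ^ N)%nat by (simpl; lia).
  rewrite rsum_fold_double; apply rsum_ext; intros k Hk.
  assert (H2 : 2 ^ N <> 0) by (apply pow_nonzero; lra).
  unfold dyadic_angle; rewrite !pow_add; f_equal; f_equal.
  - simpl; field; exact H2.
  - rewrite !minus_INR by lia; rewrite mult_INR, pow_INR.
    change (INR 2) with 2; change (INR 1) with 1; simpl; field; exact H2.
Qed.

Lemma dyadic_sum_sq (N : nat) :
  rsum (fun k => (/ sin (dyadic_angle N k)) ^ 2) (2 ^ N) = 2 * 4 ^ N.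
Proof.
  induction N as [|N IH].
  - simpl; unfold dyadic_angle; replace ((2 * INR 0 + 1) * PI / 2 ^ (0 + 2)) with (PI / 4)
      by (simpl; field).
    rewrite sin_PI4, Rinv_div.
    pose proof (sqrt_sqrt 2 ltac:(lra)); simpl; field_simplify; lra.
  - rewrite (dyadic_halving (fun y => (/ sin y) ^ 2)).
    rewrite (rsum_ext _ (fun k => 4 * (/ sin (dyadic_angle N k)) ^ 2)).
    + rewrite rsum_scal, IH; simpl; ring.
    + intros k Hk; apply inv_sq_sin_halving, dyadic_angle_bounds, Hk.
Qed.

Lemma dyadic_sum_pow4 (N : nat) :
  rsum (fun k => (/ sin (dyadic_angle N k)) ^ 4) (2 ^ N) = 8 / 3 * 16 ^ N + 4 / 3 * 4 ^ N.
Proof.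
  induction N as [|N IH].
  - simpl; unfold dyadic_angle; replace ((2 * INR 0 + 1) * PI / 2 ^ (0 + 2)) with (PI / 4)
      by (simpl; field).
    rewrite sin_PI4, Rinv_div.
    pose proof (sqrt_sqrt 2 ltac:(lra)) as E.
    replace (sqrt 2 / 1) with (sqrt 2) by field.
    replace (sqrt 2 * (sqrt 2 * (sqrt 2 * (sqrt 2 * 1)))) with
      ((sqrt 2 * sqrt 2) * (sqrt 2 * sqrt 2)) by ring.
    rewrite E; field.
  - rewrite (dyadic_halving (fun y => (/ sin y) ^ 4)).
    rewrite (rsum_ext _ (fun k => 16 * (/ sin (dyadic_angle N k)) ^ 4
                               - 8 * (/ sin (dyadic_angle N k)) ^ 2)).
    + rewrite rsum_minus, !rsum_scal, IH, dyadic_sum_sq; simpl; field.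
    + intros k Hk; apply inv_sq_sin_halving, dyadic_angle_bounds, Hk.
Qed.

(** From sin y < y and y cos y <= sin y, the latter read as cot y <= 1/y in 1 / sin^2 = 1 +
    cot^2. *)
Lemma sin_lt_tan_bounds (y : R) :
  0 < y < PI / 2 -> (/ y) ^ 2 <= (/ sin y) ^ 2 <= (/ y) ^ 2 + 1.
Proof.
  intros H.
  assert (Hs : 0 < sin y) by (apply sin_gt_0; lra).
  assert (Hc : 0 < cos y) by (apply cos_gt_0; lra).
  assert (H1 : sin y < y) by (apply sin_lt_x; lra).
  assert (H2 : y * cos y <= sin y).
  { destruct (MVT_cor2 (fun x => sin x - x * cos x) (fun x => x * sin x) 0 y)
      as [c [E Hc']]; [lra| |].
    - intros c Hc'; apply is_derive_Reals; auto_derive; [trivial|ring].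
    - rewrite sin_0, Rmult_0_l in E.
      assert (0 < sin c) by (apply sin_gt_0; lra).
      assert (0 < c * sin c * (y - 0)) by (repeat apply Rmult_lt_0_compat; lra).
      lra. }
  assert (H3 : / y <= / sin y) by (apply Rinv_le_contravar; lra).
  assert (Hy : 0 < / y) by (apply Rinv_0_lt_compat; lra).
  split; [apply pow_incr; lra|].
  pose proof (sin2_cos2 y) as E; unfold Rsqr in E.
  replace ((/ sin y) ^ 2) with (1 + (cos y / sin y) ^ 2)
    by (transitivity ((sin y * sin y + cos y * cos y) / (sin y) ^ 2);
        [field; lra|rewrite E; field; lra]).
  assert (cos y / sin y <= / y).
  { apply Rmult_le_reg_r with (y * sin y); [apply Rmult_lt_0_compat; lra|].
    field_simplify; lra. }
  assert (0 < cos y / sin y) by (apply Rdiv_lt_0_compat; lra).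
  assert ((cos y / sin y) ^ 2 <= (/ y) ^ 2) by (apply pow_incr; lra).
  lra.
Qed.

Definition zsum (p n : nat) : R := rsum (fun k => / (INR k + 1) ^ p) n.

Lemma zsum_term_pos (p k : nat) : 0 < / (INR k + 1) ^ p.
Proof. apply Rinv_0_lt_compat, pow_lt; pose proof (pos_INR k); lra. Qed.

Lemma zsum_double (p n : nat) :
  zsum p (2 * n) = rsum (fun k => / (2 * INR k + 1) ^ p) n + / 2 ^ p * zsum p n.
Proof.
  unfold zsum; induction n as [|n IH]; [simpl; ring|].
  replace (2 * S n)%nat with (S (S (2 * n))) by lia.
  cbn [rsum]; rewrite IH, S_INR, mult_INR; change (INR 2) with 2.
  replace (2 * INR n + 1 + 1) with (2 * (INR n + 1)) by ring.
  rewrite Rpow_mult_distr, Rinv_mult; ring.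
Qed.

Lemma rsum_inv_sq_tail (M n : nat) :
  (1 <= M)%nat -> rsum (fun k => / (INR (M + k) + 1) ^ 2) n <= / INR M.
Proof.
  intros HM.
  assert (H : rsum (fun k => / (INR (M + k) + 1) ^ 2) n
              <= / INR M - / INR (M + n)).
  { pose proof (rsum_telescope (fun k => / INR (M + k)) n) as E.
    cbv beta in E; rewrite Nat.add_0_r in E; rewrite <- E; apply rsum_le; intros k _.
    rewrite Nat.add_succ_r, S_INR.
    assert (1 <= INR (M + k)) by (apply (le_INR 1); lia).
    set (x := INR (M + k)) in *.
    replace (/ x - / (x + 1)) with (/ (x * (x + 1))) by (field; lra).
    apply Rinv_le_contravar; nra. }
  assert (0 < / INR (M + n)) by (apply Rinv_0_lt_compat, lt_0_INR; lia).
  lra.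
Qed.

Lemma zsum2_le (n : nat) : zsum 2 n <= 2.
Proof.
  destruct n as [|n]; [unfold zsum; simpl; lra|].
  unfold zsum; change (S n) with (1 + n)%nat; rewrite rsum_add.
  pose proof (rsum_inv_sq_tail 1 n (le_n 1)).
  simpl INR in H; simpl rsum at 1; simpl INR; lra.
Qed.

Lemma zsum4_le (n : nat) : zsum 4 n <= 2.
Proof.
  eapply Rle_trans; [|apply (zsum2_le n)].
  apply rsum_le; intros k _; pose proof (pos_INR k).
  apply Rinv_le_contravar; [apply pow_lt; lra|apply Rle_pow; [lra|lia]].
Qed.

Lemma zsum_ex_lim (p : nat) :
  (forall n, zsum p n <= 2) -> exists l : R, is_lim_seq (zsum p) l.
Proof.
  intros H; destruct (ex_finite_lim_seq_incr (zsum p) 2) as [l Hl].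
  - intros n; unfold zsum; simpl rsum; pose proof (zsum_term_pos p n); lra.
  - exact H.
  - exists l; exact Hl.
Qed.

Lemma is_lim_seq_pow2 (u : nat -> R) (l : R) :
  is_lim_seq u l -> is_lim_seq (fun N => u (2 ^ N)%nat) l.
Proof.
  apply is_lim_seq_subseq; apply eventually_subseq; intros n.
  apply Nat.pow_lt_mono_r; lia.
Qed.

Lemma is_lim_seq_double (u : nat -> R) (l : R) :
  is_lim_seq u l -> is_lim_seq (fun n => u (2 * n)%nat) l.
Proof. apply is_lim_seq_subseq; apply eventually_subseq; intros n; lia. Qed.

Lemma is_lim_seq_inv_pow2 : is_lim_seq (fun N => (/ 2) ^ N) 0.
Proof. apply is_lim_seq_geom; rewrite Rabs_pos_eq; lra. Qed.

Lemma dyadic_inv (p N k : nat) :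
  (/ dyadic_angle N k) ^ p * (PI / 2 ^ (N + 2)) ^ p = / (2 * INR k + 1) ^ p.
Proof.
  rewrite <- Rpow_mult_distr, <- pow_inv; f_equal; unfold dyadic_angle.
  pose proof PI_RGT_0; pose proof (pos_INR k).
  assert (2 ^ (N + 2) <> 0) by (apply pow_nonzero; lra).
  field; repeat split; lra.
Qed.

(** The exact value 2 * 4^N of the trigonometric sum is rescaled by (PI / 2^(N+2))^2. Replacing 1 /
    sin^2 by the inverse square costs at most 1 for each of the 2^N angles, hence the error PI^2 /
    16 * 2^(-N). *)
Lemma odd_inv_sq_bounds (N : nat) :
  PI ^ 2 / 8 - PI ^ 2 / 16 * (/ 2) ^ N
    <= rsum (fun k => / (2 * INR k + 1) ^ 2) (2 ^ N) <= PI ^ 2 / 8.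
Proof.
  set (S0 := rsum (fun k => (/ dyadic_angle N k) ^ 2) (2 ^ N)).
  assert (E : rsum (fun k => / (2 * INR k + 1) ^ 2) (2 ^ N)
              = (PI / 2 ^ (N + 2)) ^ 2 * S0).
  { unfold S0; rewrite <- rsum_scal; apply rsum_ext; intros k _.
    rewrite <- (dyadic_inv 2 N k); apply Rmult_comm. }
  assert (H1 : S0 <= 2 * 4 ^ N).
  { rewrite <- dyadic_sum_sq; apply rsum_le; intros k Hk.
    apply sin_lt_tan_bounds, dyadic_angle_bounds, Hk. }
  assert (H2 : 2 * 4 ^ N <= S0 + 2 ^ N).
  { rewrite <- dyadic_sum_sq; unfold S0.
    replace (2 ^ N) with (rsum (fun _ => 1) (2 ^ N))
      by (rewrite rsum_const, pow_INR; change (INR 2) with 2; ring).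
    rewrite <- rsum_plus; apply rsum_le; intros k Hk.
    apply sin_lt_tan_bounds, dyadic_angle_bounds, Hk. }
  assert (H4 : 4 ^ N = 2 ^ N * 2 ^ N) by (rewrite <- Rpow_mult_distr; f_equal; ring).
  rewrite E, pow_inv, pow_add; rewrite H4 in H1, H2.
  assert (HN : 0 < 2 ^ N) by (apply pow_lt; lra).
  pose proof PI_RGT_0; set (x := 2 ^ N) in *.
  assert (Hc : 0 < (PI / (x * 2 ^ 2)) ^ 2)
    by (apply pow_lt, Rdiv_lt_0_compat; [lra|nra]).
  split.
  - apply Rle_trans with ((PI / (x * 2 ^ 2)) ^ 2 * (2 * (x * x) - x)).
    + right; field; lra.
    + apply Rmult_le_compat_l; lra.
  - apply Rle_trans with ((PI / (x * 2 ^ 2)) ^ 2 * (2 * (x * x))).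
    + apply Rmult_le_compat_l; lra.
    + right; field; lra.
Qed.

Lemma odd_inv_pow4_bounds (N : nat) :
  PI ^ 4 / 96 - PI ^ 4 / 16 * (/ 2) ^ N
    <= rsum (fun k => / (2 * INR k + 1) ^ 4) (2 ^ N) <= PI ^ 4 / 96 + PI ^ 4 / 192 * (/ 2) ^ N.
Proof.
  set (S0 := rsum (fun k => (/ dyadic_angle N k) ^ 4) (2 ^ N)).
  assert (E : rsum (fun k => / (2 * INR k + 1) ^ 4) (2 ^ N)
              = (PI / 2 ^ (N + 2)) ^ 4 * S0).
  { unfold S0; rewrite <- rsum_scal; apply rsum_ext; intros k _.
    rewrite <- (dyadic_inv 4 N k); apply Rmult_comm. }
  (* With a = 1 / y^2 and b = 1 / sin^2 y, a <= b <= a + 1 gives b^2 - a^2 <= a + b <= 2 b, and the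
     sum of the b is already known. *)
  assert (Hsq : forall y, 0 < y < PI / 2 ->
     (/ y) ^ 4 <= (/ sin y) ^ 4 <= (/ y) ^ 4 + 2 * (/ sin y) ^ 2).
  { intros y Hy; destruct (sin_lt_tan_bounds y Hy) as [B1 B2].
    replace ((/ y) ^ 4) with ((/ y) ^ 2 * (/ y) ^ 2) by ring.
    replace ((/ sin y) ^ 4) with ((/ sin y) ^ 2 * (/ sin y) ^ 2) by ring.
    assert (0 <= (/ y) ^ 2) by apply pow2_ge_0.
    set (a := (/ y) ^ 2) in *; set (b := (/ sin y) ^ 2) in *; nra. }
  assert (H1 : S0 <= 8 / 3 * 16 ^ N + 4 / 3 * 4 ^ N).
  { rewrite <- dyadic_sum_pow4; apply rsum_le; intros k Hk.
    apply Hsq, dyadic_angle_bounds, Hk. }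
  assert (H2 : 8 / 3 * 16 ^ N + 4 / 3 * 4 ^ N <= S0 + 2 * (2 * 4 ^ N)).
  { rewrite <- dyadic_sum_pow4, <- dyadic_sum_sq, <- rsum_scal; unfold S0.
    rewrite <- rsum_plus; apply rsum_le; intros k Hk.
    apply Hsq, dyadic_angle_bounds, Hk. }
  assert (H4 : 4 ^ N = 2 ^ N * 2 ^ N) by (rewrite <- Rpow_mult_distr; f_equal; ring).
  assert (H16 : 16 ^ N = 4 ^ N * 4 ^ N) by (rewrite <- Rpow_mult_distr; f_equal; ring).
  rewrite H16, H4 in H1, H2; rewrite E, pow_inv, pow_add.
  assert (HN : 1 <= 2 ^ N) by (apply pow_R1_Rle; lra).
  pose proof PI_RGT_0; set (x := 2 ^ N) in *.
  assert (Hc : 0 < (PI / (x * 2 ^ 2)) ^ 4)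
    by (apply pow_lt, Rdiv_lt_0_compat; [lra|nra]).
  assert (Hp : 0 < PI ^ 4) by (apply pow_lt; lra).
  assert (Hx1 : / x ^ 2 <= / x) by (apply Rinv_le_contravar; nra).
  assert (Hx0 : 0 < / x) by (apply Rinv_0_lt_compat; lra).
  split.
  - apply Rle_trans with ((PI / (x * 2 ^ 2)) ^ 4 *
      (8 / 3 * (x * x * (x * x)) - 8 / 3 * (x * x))).
    + replace ((PI / (x * 2 ^ 2)) ^ 4 * (8 / 3 * (x * x * (x * x)) - 8 / 3 * (x * x)))
        with (PI ^ 4 / 96 - PI ^ 4 / 96 * / x ^ 2) by (field; lra).
      nra.
    + apply Rmult_le_compat_l; lra.
  - apply Rle_trans with ((PI / (x * 2 ^ 2)) ^ 4 *
      (8 / 3 * (x * x * (x * x)) + 4 / 3 * (x * x))).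
    + apply Rmult_le_compat_l; lra.
    + replace ((PI / (x * 2 ^ 2)) ^ 4 * (8 / 3 * (x * x * (x * x)) + 4 / 3 * (x * x)))
        with (PI ^ 4 / 96 + PI ^ 4 / 192 * / x ^ 2) by (field; lra).
      nra.
Qed.

(** Removing the even terms multiplies the zeta value by 1 - 2^(-p), so the odd sums determine
    it. *)
Lemma zsum_lim_of_odd (p : nat) (c C : R) :
  (forall n, zsum p n <= 2) ->
  (forall N, c - C * (/ 2) ^ N <= rsum (fun k => / (2 * INR k + 1) ^ p) (2 ^ N)
             <= c + C * (/ 2) ^ N) ->
  exists l : R, is_lim_seq (zsum p) l /\ l - / 2 ^ p * l = c.
Proof.
  intros Hb H; destruct (zsum_ex_lim p Hb) as [l Hl]; exists l; split; [exact Hl|].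
  assert (H1 : is_lim_seq (fun N => zsum p (2 * 2 ^ N) - / 2 ^ p * zsum p (2 ^ N))
                 (l - / 2 ^ p * l)).
  { apply is_lim_seq_minus'.
    - apply (is_lim_seq_pow2 (fun n => zsum p (2 * n))), is_lim_seq_double, Hl.
    - apply (is_lim_seq_scal_l (fun N => zsum p (2 ^ N)) (/ 2 ^ p) l).
      apply is_lim_seq_pow2, Hl. }
  assert (H2 : is_lim_seq (fun N => zsum p (2 * 2 ^ N) - / 2 ^ p * zsum p (2 ^ N)) c).
  { apply is_lim_seq_le_le with (fun N => c - C * (/ 2) ^ N) (fun N => c + C * (/ 2) ^ N).
    - intros N; rewrite zsum_double; specialize (H N); lra.
    - replace (Finite c) with (Finite (c - C * 0)) by (f_equal; ring).
      apply is_lim_seq_minus'; [apply is_lim_seq_const|].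
      apply (is_lim_seq_scal_l _ C 0), is_lim_seq_inv_pow2.
    - replace (Finite c) with (Finite (c + C * 0)) by (f_equal; ring).
      apply is_lim_seq_plus'; [apply is_lim_seq_const|].
      apply (is_lim_seq_scal_l _ C 0), is_lim_seq_inv_pow2. }
  apply is_lim_seq_unique in H1; apply is_lim_seq_unique in H2.
  rewrite H1 in H2; injection H2; trivial.
Qed.

Lemma zeta2 : is_lim_seq (zsum 2) (PI ^ 2 / 6).
Proof.
  destruct (zsum_lim_of_odd 2 (PI ^ 2 / 8) (PI ^ 2 / 16) zsum2_le) as [l [Hl E]].
  - intros N; destruct (odd_inv_sq_bounds N) as [B1 B2]; split; [exact B1|].
    assert (0 <= PI ^ 2 / 16 * (/ 2) ^ N).
    { apply Rmult_le_pos; [pose proof (pow2_ge_0 PI); lra|apply pow_le; lra]. }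
    lra.
  - replace (PI ^ 2 / 6) with l; [exact Hl|]. simpl in E; simpl; lra.
Qed.

Lemma zeta4 : is_lim_seq (zsum 4) (PI ^ 4 / 90).
Proof.
  destruct (zsum_lim_of_odd 4 (PI ^ 4 / 96) (PI ^ 4 / 16) zsum4_le) as [l [Hl E]].
  - intros N; destruct (odd_inv_pow4_bounds N) as [B1 B2]; split; [exact B1|].
    assert (0 <= PI ^ 4 / 16 * (/ 2) ^ N).
    { apply Rmult_le_pos; [pose proof (pow_lt PI 4 PI_RGT_0); lra|apply pow_le; lra]. }
    lra.
  - replace (PI ^ 4 / 90) with l; [exact Hl|]. simpl in E; simpl; lra.
Qed.

(** * The constant sum of 1/(i^2 j^2 binomial(i+j,i)) *)

Fixpoint rprod (f : nat -> R) (n : nat) : R :=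
  match n with O => 1 | S k => rprod f k * f k end.

(* i! j! / (i+j)! *)
Definition inv_binom (i j : nat) : R :=
  rprod (fun k => (INR k + 1) / (INR j + INR k + 1)) i.

Lemma inv_binom_S (i j : nat) :
  inv_binom (S i) j = inv_binom i j * ((INR i + 1) / (INR j + INR i + 1)).
Proof. reflexivity. Qed.

Lemma inv_binom_fact (i j : nat) :
  inv_binom i j = INR (fact i) * INR (fact j) / INR (fact (i + j)).
Proof.
  induction i as [|i IH].
  - unfold inv_binom; simpl; field; apply INR_fact_neq_0.
  - rewrite inv_binom_S, IH; cbn [Nat.add]; rewrite !fact_simpl, !mult_INR, !S_INR, plus_INR.
    pose proof (pos_INR i); pose proof (pos_INR j).
    field; repeat split; try lra; apply INR_fact_neq_0.
Qed.

Lemma inv_binom_sym (i j : nat) : inv_binom i j = inv_binom j i.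
Proof. rewrite !inv_binom_fact, (Nat.add_comm j i); field; apply INR_fact_neq_0. Qed.

Lemma inv_binom_bounds (i j : nat) : 0 < inv_binom i j <= 1.
Proof.
  induction i as [|i IH]; [unfold inv_binom; simpl; lra|].
  rewrite inv_binom_S; pose proof (pos_INR i); pose proof (pos_INR j).
  assert (0 < (INR i + 1) / (INR j + INR i + 1)) by (apply Rdiv_lt_0_compat; lra).
  assert ((INR i + 1) / (INR j + INR i + 1) <= 1).
  { apply Rmult_le_reg_r with (INR j + INR i + 1); [lra|field_simplify; lra]. }
  split; [apply Rmult_lt_0_compat; lra|nra].
Qed.

(** Each summand is ([inv_binom i (S m)] - [inv_binom (S i) (S m)]) / (m + 1) with i = a + k, so the
    sum telescopes. This is the transport relation of the connected sum method for multiple zeta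
    values, with the inverse binomial as connector. *)
Lemma inv_binom_transport (a M m : nat) :
  (a <= M)%nat ->
  rsum (fun k => inv_binom (S (a + k)) (S m) / (INR (a + k) + 1)) (M - a)
  = (inv_binom a (S m) - inv_binom M (S m)) / (INR m + 1).
Proof.
  intros H.
  rewrite (rsum_ext _ (fun k => / (INR m + 1) *
     (inv_binom (a + k) (S m) - inv_binom (a + S k) (S m)))).
  - rewrite rsum_scal, (rsum_telescope (fun k => inv_binom (a + k) (S m))).
    replace (a + (M - a))%nat with M by lia; rewrite Nat.add_0_r; unfold Rdiv; ring.
  - intros k _; rewrite Nat.add_succ_r, inv_binom_S, S_INR.
    pose proof (pos_INR (a + k)); pose proof (pos_INR m); field; lra.
Qed.

Lemma inv_binom_le (i j : nat) : (1 <= j)%nat -> inv_binom i j <= / (INR i + 1).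
Proof.
  intros Hj; induction i as [|i IH]; [unfold inv_binom; simpl; lra|].
  rewrite inv_binom_S, S_INR; pose proof (pos_INR i).
  assert (1 <= INR j) by (apply (le_INR 1); exact Hj).
  apply Rle_trans with (/ (INR i + 1) * ((INR i + 1) / (INR j + INR i + 1))).
  - apply Rmult_le_compat_r; [|exact IH].
    apply Rlt_le, Rdiv_lt_0_compat; lra.
  - replace (/ (INR i + 1) * ((INR i + 1) / (INR j + INR i + 1)))
      with (/ (INR j + INR i + 1)) by (field; lra).
    apply Rinv_le_contravar; lra.
Qed.

Definition spt_coef (i j : nat) : R :=
  / (INR i + 1) ^ 2 * / (INR j + 1) ^ 2 * inv_binom (S i) (S j).

Lemma rsum_square_split (f : nat -> R) (M : nat) :
  rsum (fun i => rsum (fun k => f i * f (S i + k)%nat) (M - S i)) M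
  = ((rsum f M) ^ 2 - rsum (fun i => f i ^ 2) M) / 2.
Proof.
  induction M as [|M IH]; [simpl; field|].
  cbn [rsum].
  rewrite (rsum_ext _ (fun i => rsum (fun k => f i * f (S i + k)%nat) (M - S i) + f i * f M)).
  - rewrite rsum_plus, IH, Nat.sub_diag; simpl (rsum _ 0).
    rewrite (rsum_ext (fun k => f k * f M) (fun k => f M * f k)) by (intros; ring).
    rewrite rsum_scal; field.
  - intros i Hi; replace (S M - S i)%nat with (S (M - S i)) by lia.
    cbn [rsum]; do 3 f_equal; lia.
Qed.

(* Two applications of [inv_binom_transport], first in [i] and then in [j], turn the
   sum into the double zeta value sum_(i < k) 1/(i^2 k^2). *)
Lemma spt_coef_sum (M : nat) :
  Rabs (rsum (fun i => rsum (spt_coef i) M) M - (zsum 2 M ^ 2 - zsum 4 M) / 2)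
  <= 8 / (INR M + 1).
Proof.
  pose (x := fun i => / (INR i + 1)).
  (* Transport in the first index from [S i] up to the cutoff [M] trades one factor 1/(j+1) for a
     sum over a larger index; the second summand is the boundary term at [M]. *)
  assert (E1 : forall i j, (i < M)%nat -> spt_coef i j =
    rsum (fun k => x i ^ 2 * x (S i + k)%nat * (x j * inv_binom (S (S i + k)) (S j))) (M - S i)
    + x i ^ 2 * x j ^ 2 * inv_binom M (S j)).
  { intros i j Hi; unfold spt_coef.
    pose proof (inv_binom_transport (S i) M j ltac:(lia)) as E.
    rewrite (rsum_ext _ (fun k => (x i ^ 2 * x j) *
      (inv_binom (S (S i + k)) (S j) / (INR (S i + k) + 1))))
      by (intros; unfold x, Rdiv; ring).
    rewrite rsum_scal, E; unfold x, Rdiv; rewrite !pow_inv.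
    pose proof (pos_INR i); pose proof (pos_INR j); field; lra. }
  (* By symmetry the same relation runs in the other index, now from 0, where the connector equals
     1. *)
  assert (E2 : forall k, rsum (fun j => x j * inv_binom (S k) (S j)) M
                         = x k * (1 - inv_binom (S k) M)).
  { intros k; pose proof (inv_binom_transport 0 M k ltac:(lia)) as E.
    rewrite Nat.sub_0_r in E.
    rewrite (rsum_ext _ (fun j => inv_binom (S (0 + j)) (S k) / (INR (0 + j) + 1)))
      by (intros; unfold x, Rdiv; rewrite inv_binom_sym; simpl; ring).
    rewrite E, (inv_binom_sym M); unfold x, inv_binom at 1; simpl; field.
    pose proof (pos_INR k); lra. }
  assert (E3 : rsum (fun i => rsum (spt_coef i) M) M =
    rsum (fun i => rsum (fun k => x i ^ 2 * x (S i + k)%nat ^ 2) (M - S i)) M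
    - rsum (fun i => rsum (fun k => x i ^ 2 * x (S i + k)%nat ^ 2
                             * inv_binom (S (S i + k)) M) (M - S i)) M
    + rsum (fun i => rsum (fun j => x i ^ 2 * x j ^ 2 * inv_binom M (S j)) M) M).
  { rewrite <- rsum_minus, <- rsum_plus; apply rsum_ext; intros i Hi.
    rewrite (rsum_ext _ _ M (fun j _ => E1 i j Hi)), rsum_plus; f_equal.
    rewrite rsum_swap, <- rsum_minus; apply rsum_ext; intros k _.
    rewrite rsum_scal, E2; ring. }
  assert (Hx : forall i, 0 < x i) by
    (intros i; unfold x; apply Rinv_0_lt_compat; pose proof (pos_INR i); lra).
  assert (Hz : rsum (fun i => x i ^ 2) M = zsum 2 M)
    by (apply rsum_ext; intros; unfold x; apply pow_inv).
  assert (Hz0 : 0 <= zsum 2 M) by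
    (rewrite <- Hz; apply rsum_nonneg; intros; apply pow2_ge_0).
  pose proof (zsum2_le M) as Hz2.
  assert (E4 : rsum (fun i => rsum (fun k => x i ^ 2 * x (S i + k)%nat ^ 2) (M - S i)) M
               = (zsum 2 M ^ 2 - zsum 4 M) / 2).
  { rewrite (rsum_square_split (fun i => x i ^ 2)), Hz.
    do 2 f_equal; apply rsum_ext; intros; unfold x.
    rewrite <- pow_mult, pow_inv; reflexivity. }
  assert (HM : 0 < / (INR M + 1)) by (apply Rinv_0_lt_compat; pose proof (pos_INR M); lra).
  (* The boundary terms of both transports carry a connector with an index [M], which is at most 1 /
     (M + 1); the remaining double sums are at most 2 * 2. *)
  assert (B1 : 0 <= rsum (fun i => rsum (fun j => x i ^ 2 * x j ^ 2 * inv_binom M (S j)) M) M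
               <= 4 * / (INR M + 1)).
  { split.
    - apply rsum_nonneg; intros i _; apply rsum_nonneg; intros j _.
      pose proof (inv_binom_bounds M (S j)); pose proof (Hx i); pose proof (Hx j).
      apply Rmult_le_pos; [apply Rmult_le_pos; apply pow2_ge_0|lra].
    - apply Rle_trans with (rsum (fun i => rsum (fun j => / (INR M + 1) * x i ^ 2 * x j ^ 2) M) M).
      + apply rsum_le; intros i _; apply rsum_le; intros j _.
        pose proof (inv_binom_le M (S j) ltac:(lia)).
        rewrite (Rmult_assoc (/ _)), Rmult_comm; apply Rmult_le_compat_r; [|assumption].
        apply Rmult_le_pos; apply pow2_ge_0.
      + rewrite (rsum_ext _ (fun i => (/ (INR M + 1) * zsum 2 M) * x i ^ 2)).
        * rewrite rsum_scal, Hz.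
          rewrite Rmult_assoc, Rmult_comm; apply Rmult_le_compat_r; nra.
        * intros i _; rewrite rsum_scal, Hz; ring. }
  assert (B2 : 0 <= rsum (fun i => rsum (fun k => x i ^ 2 * x (S i + k)%nat ^ 2
                             * inv_binom (S (S i + k)) M) (M - S i)) M
               <= 4 * / (INR M + 1)).
  { destruct M as [|M']; [simpl; lra|set (M := S M') in *].
    split.
    - apply rsum_nonneg; intros i _; apply rsum_nonneg; intros j _.
      pose proof (inv_binom_bounds (S (S i + j)) M).
      apply Rmult_le_pos; [apply Rmult_le_pos; apply pow2_ge_0|lra].
    - apply Rle_trans with (rsum (fun i => rsum (fun k => / (INR M + 1) *
                        (x i ^ 2 * x (S i + k)%nat ^ 2)) (M - S i)) M).
      + apply rsum_le; intros i _; apply rsum_le; intros j _.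
        rewrite (inv_binom_sym _ M).
        pose proof (inv_binom_le M (S (S i + j)) ltac:(lia)).
        rewrite Rmult_comm; apply Rmult_le_compat_r; [|assumption].
        apply Rmult_le_pos; apply pow2_ge_0.
      + rewrite (rsum_ext _ (fun i => / (INR M + 1) *
           rsum (fun k => x i ^ 2 * x (S i + k)%nat ^ 2) (M - S i)))
          by (intros; apply rsum_scal).
        rewrite rsum_scal, E4, Rmult_comm; apply Rmult_le_compat_r; [lra|].
        assert (0 <= zsum 4 M) by
          (apply rsum_nonneg; intros; apply Rlt_le, zsum_term_pos).
        nra. }
  rewrite E3, E4; unfold Rdiv at 3; apply Rabs_le; lra.
Qed.

Lemma is_lim_seq_inv_INR : is_lim_seq (fun n => / (INR n + 1)) 0.
Proof.
  apply is_lim_seq_ext with (fun n => / INR (S n)); [intros n; rewrite S_INR; reflexivity|].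
  apply (is_lim_seq_incr_1 (fun n => / INR n)).
  replace (Finite 0) with (Rbar_inv p_infty) by reflexivity.
  apply is_lim_seq_inv; [apply is_lim_seq_INR|discriminate].
Qed.

Lemma spt_coef_lim : is_lim_seq (fun M => rsum (fun i => rsum (spt_coef i) M) M) (PI ^ 4 / 120).
Proof.
  assert (H : is_lim_seq (fun M => (zsum 2 M * zsum 2 M - zsum 4 M) / 2) (PI ^ 4 / 120)).
  { replace (PI ^ 4 / 120) with ((PI ^ 2 / 6 * (PI ^ 2 / 6) - PI ^ 4 / 90) * / 2) by field.
    apply (is_lim_seq_scal_r _ (/ 2) (Finite _)).
    apply is_lim_seq_minus'; [|apply zeta4].
    apply is_lim_seq_mult'; apply zeta2. }
  assert (H8 : is_lim_seq (fun M => 8 / (INR M + 1)) 0).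
  { replace (Finite 0) with (Finite (8 * 0)) by (f_equal; ring).
    apply (is_lim_seq_scal_l _ 8 0), is_lim_seq_inv_INR. }
  apply is_lim_seq_le_le with
    (fun M => (zsum 2 M * zsum 2 M - zsum 4 M) / 2 - 8 / (INR M + 1))
    (fun M => (zsum 2 M * zsum 2 M - zsum 4 M) / 2 + 8 / (INR M + 1)).
  - intros M; pose proof (spt_coef_sum M) as B; apply Rabs_le_between in B.
    simpl pow in B; rewrite Rmult_1_r in B; lra.
  - rewrite <- (Rminus_0_r (PI ^ 4 / 120)); apply is_lim_seq_minus'; assumption.
  - rewrite <- (Rplus_0_r (PI ^ 4 / 120)); apply is_lim_seq_plus'; assumption.
Qed.

(** * Formal power series *)

Lemma PS_mult_S (a b : fps) (n : nat) :
  PS_mult a b (S n) = a O * b (S n) + PS_mult (fun k => a (S k)) b n.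
Proof. unfold PS_mult; rewrite decomp_sum by lia; reflexivity. Qed.

Lemma PS_mult_S' (a b : fps) (n : nat) :
  PS_mult a b (S n) = PS_mult a (fun k => b (S k)) n + a (S n) * b O.
Proof.
  unfold PS_mult; rewrite tech5, Nat.sub_diag; f_equal.
  apply sum_eq; intros k Hk; rewrite Nat.sub_succ_l by exact Hk; reflexivity.
Qed.

Lemma PS_mult_plus_l (a b c : fps) :
  PS_mult (fun k => a k + b k) c = fun n => PS_mult a c n + PS_mult b c n.
Proof.
  extensionality n; unfold PS_mult; rewrite <- sum_plus.
  apply sum_eq; intros; ring.
Qed.

Lemma PS_mult_minus_l (a b c : fps) :
  PS_mult (fun k => a k - b k) c = fun n => PS_mult a c n - PS_mult b c n.
Proof.
  extensionality n; unfold PS_mult; rewrite <- minus_sum.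
  apply sum_eq; intros; ring.
Qed.

Lemma PS_mult_scal_l (x : R) (a b : fps) (n : nat) :
  PS_mult (fun k => x * a k) b n = x * PS_mult a b n.
Proof.
  unfold PS_mult; rewrite scal_sum; apply sum_eq; intros; ring.
Qed.

Lemma PS_mult_zero_l (a b : fps) (n : nat) :
  (forall k, (k <= n)%nat -> a k = 0) -> PS_mult a b n = 0.
Proof.
  intros H; unfold PS_mult; rewrite (sum_eq _ (fun _ => 0)).
  - rewrite sum_cte; ring.
  - intros k Hk; rewrite H by exact Hk; ring.
Qed.

(** The Cauchy product can be peeled at either end. Peeling at opposite ends on the two sides
    reduces the coefficient [S n] to the coefficient [n] of a shifted pair. *)
Lemma PS_mult_comm (a b : fps) : PS_mult a b = PS_mult b a.
Proof.
  extensionality n; revert a b; induction n as [|n IH]; intros a b.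
  - unfold PS_mult; simpl; ring.
  - rewrite PS_mult_S, PS_mult_S', IH; ring.
Qed.

Lemma PS_mult_assoc (a b c : fps) :
  PS_mult (PS_mult a b) c = PS_mult a (PS_mult b c).
Proof.
  extensionality n; revert a b c; induction n as [|n IH]; intros a b c.
  - unfold PS_mult; simpl; ring.
  - rewrite !PS_mult_S.
    replace (fun k => PS_mult a b (S k))
      with (fun k => (a O * b (S k)) + PS_mult (fun k => a (S k)) b k)
      by (extensionality k; rewrite PS_mult_S; reflexivity).
    rewrite (PS_mult_plus_l (fun k => a O * b (S k))), PS_mult_scal_l, IH.
    unfold PS_mult at 1; simpl; ring.
Qed.

Lemma PS_mult_q_l (m : nat) (a : fps) (n : nat) :
  PS_mult (fps_q m) a n = if (m <=? n)%nat then a (n - m)%nat else 0.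
Proof.
  revert m; induction n as [|n IH]; intros m.
  - unfold PS_mult, fps_q; destruct m; simpl; ring.
  - rewrite PS_mult_S; destruct m as [|m].
    + rewrite PS_mult_zero_l; [unfold fps_q; simpl; ring|reflexivity].
    + change (fun k => fps_q (S m) (S k)) with (fps_q m); rewrite IH.
      unfold fps_q; simpl; ring.
Qed.

Lemma PS_mult_one_l (a : fps) : PS_mult fps_one a = a.
Proof.
  extensionality n; unfold fps_one; rewrite PS_mult_q_l; simpl; f_equal; lia.
Qed.

Lemma PS_mult_q_q (m k : nat) : PS_mult (fps_q m) (fps_q k) = fps_q (m + k).
Proof.
  extensionality n; rewrite PS_mult_q_l; unfold fps_q.
  destruct (Nat.leb_spec m n), (Nat.eqb_spec n (m + k)), (Nat.eqb_spec (n - m) k);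
    reflexivity || lia.
Qed.

Lemma fps_inv_unique (a b : fps) :
  a O <> 0 -> PS_mult a b = fps_one -> b = fps_inv a.
Proof.
  intros H E; rewrite <- (PS_mult_one_l b).
  replace fps_one with (PS_mult (fps_inv a) a).
  - rewrite PS_mult_assoc, E, PS_mult_comm; apply PS_mult_one_l.
  - rewrite PS_mult_comm; extensionality n; apply fps_mult_inv, H.
Qed.

Lemma fps_mult_inv_fun (a : fps) : a O <> 0 -> PS_mult a (fps_inv a) = fps_one.
Proof. intros H; extensionality n; apply fps_mult_inv, H. Qed.

Lemma fps_inv_mult (a b : fps) :
  a O <> 0 -> b O <> 0 -> fps_inv (PS_mult a b) = PS_mult (fps_inv a) (fps_inv b).
Proof.
  intros Ha Hb; symmetry; apply fps_inv_unique.
  - unfold PS_mult; simpl; apply Rmult_integral_contrapositive; tauto.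
  - rewrite (PS_mult_comm (fps_inv a)), PS_mult_assoc, <- (PS_mult_assoc b).
    rewrite fps_mult_inv_fun, PS_mult_one_l by exact Hb.
    apply fps_mult_inv_fun, Ha.
Qed.

Definition one_minus_q (m : nat) : fps := PS_minus fps_one (fps_q m).

Definition geom_fps (m : nat) : fps := fun k => if (k mod m =? 0)%nat then 1 else 0.

Lemma fps_inv_one_minus_q (m : nat) :
  (1 <= m)%nat -> fps_inv (one_minus_q m) = geom_fps m.
Proof.
  intros Hm; symmetry; apply fps_inv_unique.
  - unfold one_minus_q, PS_minus, PS_plus, PS_opp, fps_one, fps_q; simpl.
    destruct m; [lia|]; unfold opp, plus; simpl; lra.
  - change (one_minus_q m) with (fun k => fps_one k - fps_q m k).
    rewrite PS_mult_minus_l; extensionality n; rewrite PS_mult_one_l, PS_mult_q_l.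
    unfold geom_fps, fps_one, fps_q.
    destruct (Nat.leb_spec m n) as [H|H].
    + destruct (Nat.eqb_spec n 0); [lia|].
      replace (n mod m)%nat with ((n - m) mod m)%nat; [ring|].
      replace n with ((n - m) + 1 * m)%nat at 2 by lia.
      rewrite Nat.Div0.mod_add; reflexivity.
    + rewrite Nat.mod_small by exact H; ring.
Qed.

(** Congruence modulo q^(n+1). Products and inverses respect it, which permits cutting the infinite
    product under an inverse. *)
Definition agree (n : nat) (a b : fps) : Prop := forall k, (k <= n)%nat -> a k = b k.

Lemma agree_mult (n : nat) (a a' b b' : fps) :
  agree n a a' -> agree n b b' -> agree n (PS_mult a b) (PS_mult a' b').
Proof.
  intros Ha Hb k Hk; unfold PS_mult; apply sum_eq; intros i Hi.
  rewrite Ha, Hb by lia; reflexivity.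
Qed.

Lemma agree_inv (n : nat) (a b : fps) : agree n a b -> agree n (fps_inv a) (fps_inv b).
Proof.
  intros H; assert (G : forall f k, (k <= n)%nat -> fps_inv_rec a f k = fps_inv_rec b f k).
  { induction f as [|f IH]; intros [|k] Hk; simpl; rewrite ?(H O) by lia; try reflexivity.
    f_equal; apply sum_eq; intros i Hi; rewrite H, IH by lia; reflexivity. }
  intros k Hk; apply G, Hk.
Qed.

Lemma agree_refl (n : nat) (a : fps) : agree n a a.
Proof. intros k _; reflexivity. Qed.

Lemma qpoch_q_S (m n : nat) :
  qpoch (fps_q m) (S n) = PS_mult (qpoch (fps_q m) n) (one_minus_q (m + n)).
Proof. simpl; rewrite PS_mult_q_q; reflexivity. Qed.

(** Every factor beyond the first [n - i] is 1 - q^m with m > n, so the coefficients up to [n] are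
    constant from there on, and their limit is the value already reached. *)
Lemma agree_qpoch_inf (n i : nat) :
  agree n (qpoch_inf (fps_q (i + 1))) (qpoch (fps_q (i + 1)) (n - i)).
Proof.
  intros k Hk; unfold qpoch_inf.
  assert (H : forall d, qpoch (fps_q (i + 1)) (n - i + d) k = qpoch (fps_q (i + 1)) (n - i) k).
  { induction d as [|d IH]; [rewrite Nat.add_0_r; reflexivity|].
    rewrite (Nat.add_succ_r (n - i) d), qpoch_q_S, <- IH, PS_mult_comm.
    transitivity (PS_mult fps_one (qpoch (fps_q (i + 1)) (n - i + d)) k);
      [|rewrite PS_mult_one_l; reflexivity].
    apply (agree_mult n); [|apply agree_refl|exact Hk].
    intros l Hl; change (one_minus_q (i + 1 + (n - i + d)) l)
      with (fps_one l - fps_q (i + 1 + (n - i + d)) l).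
    unfold fps_q; destruct (Nat.eqb_spec l (i + 1 + (n - i + d))); [lia|ring]. }
  rewrite (Lim_seq_ext_loc _ (fun _ => qpoch (fps_q (i + 1)) (n - i) k)).
  - rewrite Lim_seq_const; reflexivity.
  - exists (n - i)%nat; intros N HN; rewrite <- (H (N - (n - i))%nat); do 2 f_equal; lia.
Qed.

Lemma is_series_finite (f : nat -> R) (N : nat) :
  (forall k, (N <= k)%nat -> f k = 0) -> is_series f (rsum f N).
Proof.
  intros H; apply is_series_rsum.
  apply (is_lim_seq_ext_loc (fun _ => rsum f N)); [|apply is_lim_seq_const].
  exists N; intros M HM; replace M with (N + (M - N))%nat by lia.
  rewrite rsum_add, (rsum_ext (fun k => f (N + k)%nat) (fun _ => 0)).
  - rewrite rsum_const; ring.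
  - intros k _; apply H; lia.
Qed.

Lemma fps_sum_ge1_finite (f : nat -> fps) (N n : nat) :
  (forall k, (N < k)%nat -> f k n = 0) -> fps_sum_ge1 f n = rsum (fun k => f (S k) n) N.
Proof.
  intros H; apply is_series_unique, is_series_finite.
  intros k Hk; apply H; lia.
Qed.

Lemma PS_mult_rsum_r (a : fps) (f : nat -> fps) (N n : nat) :
  PS_mult a (fun k => rsum (fun j => f j k) N) n = rsum (fun j => PS_mult a (f j) n) N.
Proof.
  rewrite PS_mult_comm; induction N as [|N IH].
  - apply PS_mult_zero_l; reflexivity.
  - cbn [rsum]; rewrite (PS_mult_plus_l (fun k => rsum (fun j => f j k) N)), IH.
    f_equal; rewrite PS_mult_comm; reflexivity.
Qed.

(** The exponent in the inner numerator is left open: [n2] yields [SPT_plus] and [n1 * n2 + n2]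
    yields [SPT_minus]. The asymptotic analysis uses only [j <= e i j]. *)
Definition spt_gen (e : nat -> nat -> nat) : nat -> R :=
  fps_sum_ge1 (fun n1 =>
    PS_mult
      (fps_div (fps_q n1)
         (PS_mult (sq_one_minus_q n1) (qpoch_inf (fps_q (n1 + 1)))))
      (fps_sum_ge1 (fun n2 =>
         fps_div (fps_q (e n1 n2))
           (PS_mult (sq_one_minus_q n2) (qpoch (fps_q (n2 + 1)) n1))))).

(* The infinite product is cut at the part [n], which does not affect the
   coefficients up to [q^n]. *)
Definition spt_term (e : nat -> nat -> nat) (n i j : nat) : fps :=
  PS_mult
    (fps_div (fps_q i) (PS_mult (sq_one_minus_q i) (qpoch (fps_q (i + 1)) (n - i))))
    (fps_div (fps_q (e i j)) (PS_mult (sq_one_minus_q j) (qpoch (fps_q (j + 1)) i))).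

Lemma fps_div_q_low (m n : nat) (b : fps) : (n < m)%nat -> fps_div (fps_q m) b n = 0.
Proof.
  intros H; unfold fps_div; rewrite PS_mult_q_l.
  destruct (Nat.leb_spec m n); [lia|reflexivity].
Qed.

(** The numerators q^i and q^(e i j) with e i j >= j contribute nothing to the coefficient of q^n
    once i > n or j > n. *)
Lemma spt_gen_truncate (e : nat -> nat -> nat) (n : nat) :
  (forall i j, (j <= e i j)%nat) ->
  spt_gen e n = rsum (fun i => rsum (fun j => spt_term e n (S i) (S j) n) n) n.
Proof.
  intros He; unfold spt_gen; rewrite (fps_sum_ge1_finite _ n).
  - apply rsum_ext; intros i _; unfold spt_term.
    rewrite <- (PS_mult_rsum_r _ (fun j => fps_div (fps_q (e (S i) (S j)))
      (PS_mult (sq_one_minus_q (S j)) (qpoch (fps_q (S j + 1)) (S i))))).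
    apply (agree_mult n); [| |lia].
    + apply agree_mult; [apply agree_refl|].
      apply agree_inv, agree_mult; [apply agree_refl|apply agree_qpoch_inf].
    + intros k Hk; apply fps_sum_ge1_finite.
      intros j Hj; apply fps_div_q_low; specialize (He (S i) j); lia.
  - intros k Hk; apply PS_mult_zero_l; intros l Hl; apply fps_div_q_low; lia.
Qed.

(** * Evaluation in the complex disc *)

(** The power q^k for q = r e^(i th). Writing out the angle [k * th] makes the real and imaginary
    parts of a power series Fourier series in [th]. *)
Definition qpw (r th : R) (k : nat) : C :=
  (r ^ k * cos (INR k * th), r ^ k * sin (INR k * th)).

(** Absolute convergence on the circle of radius [r] is part of the relation, because the Cauchy
    product theorem needs it and passes it on to the product. *)
Definition fps_eval (a : fps) (r th : R) (z : C) : Prop :=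
  ex_series (fun k => Rabs (a k * r ^ k)) /\
  is_series (fun k => a k * fst (qpw r th k)) (fst z) /\
  is_series (fun k => a k * snd (qpw r th k)) (snd z).

Lemma qpw_add (r th : R) (j k : nat) : qpw r th (j + k) = (qpw r th j * qpw r th k)%C.
Proof.
  unfold qpw, Cmult; simpl; rewrite plus_INR, Rmult_plus_distr_r, cos_plus, sin_plus, pow_add.
  f_equal; ring.
Qed.

Lemma qpw_fst_abs (r th : R) (k : nat) : 0 <= r -> Rabs (fst (qpw r th k)) <= r ^ k.
Proof.
  intros Hr; simpl; rewrite Rabs_mult, (Rabs_pos_eq (r ^ k)) by (apply pow_le; lra).
  rewrite <- (Rmult_1_r (r ^ k)) at 2; apply Rmult_le_compat_l; [apply pow_le; lra|].
  apply Rabs_le, COS_bound.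
Qed.

Lemma qpw_snd_abs (r th : R) (k : nat) : 0 <= r -> Rabs (snd (qpw r th k)) <= r ^ k.
Proof.
  intros Hr; simpl; rewrite Rabs_mult, (Rabs_pos_eq (r ^ k)) by (apply pow_le; lra).
  rewrite <- (Rmult_1_r (r ^ k)) at 2; apply Rmult_le_compat_l; [apply pow_le; lra|].
  apply Rabs_le, SIN_bound.
Qed.

Lemma ex_series_weight (a w : nat -> R) (r : R) :
  0 <= r -> (forall k, Rabs (w k) <= r ^ k) -> ex_series (fun k => Rabs (a k * r ^ k)) ->
  ex_series (fun k => Rabs (a k * w k)).
Proof.
  intros Hr Hw Ha; apply (ex_series_le (V := R_CompleteNormedModule)) with (2 := Ha).
  intros k; change (norm (Rabs (a k * w k))) with (Rabs (Rabs (a k * w k))).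
  rewrite Rabs_Rabsolu, !Rabs_mult, (Rabs_pos_eq (r ^ k)) by (apply pow_le; lra).
  apply Rmult_le_compat_l; [apply Rabs_pos|apply Hw].
Qed.

Lemma fps_eval_exists (a : fps) (r th : R) :
  0 <= r -> ex_series (fun k => Rabs (a k * r ^ k)) -> exists z, fps_eval a r th z.
Proof.
  intros Hr Ha.
  destruct (ex_series_Rabs _ (ex_series_weight a (fun k => fst (qpw r th k)) r Hr
              (fun k => qpw_fst_abs r th k Hr) Ha)) as [x Hx].
  destruct (ex_series_Rabs _ (ex_series_weight a (fun k => snd (qpw r th k)) r Hr
              (fun k => qpw_snd_abs r th k Hr) Ha)) as [y Hy].
  exists (x, y); repeat split; assumption.
Qed.

Lemma fps_eval_unique (a : fps) (r th : R) (z z' : C) :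
  fps_eval a r th z -> fps_eval a r th z' -> z = z'.
Proof.
  intros [_ [H1 H2]] [_ [H1' H2']]; destruct z as [x y], z' as [x' y']; simpl in *.
  apply is_series_unique in H1, H2, H1', H2'; f_equal; congruence.
Qed.

Lemma is_series_eq (a b : nat -> R) (l l' : R) :
  (forall n, a n = b n) -> l = l' -> is_series a l -> is_series b l'.
Proof. intros H <-; apply is_series_ext, H. Qed.

Lemma fps_eval_plus (a b : fps) (r th : R) (z w : C) :
  fps_eval a r th z -> fps_eval b r th w -> fps_eval (fun k => a k + b k) r th (z + w)%C.
Proof.
  intros [A1 [A2 A3]] [B1 [B2 B3]]; split; [|split].
  - apply (ex_series_le (V := R_CompleteNormedModule)) with
      (b := fun k => Rabs (a k * r ^ k) + Rabs (b k * r ^ k)).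
    + intros k; change (norm ?x) with (Rabs x); rewrite Rabs_Rabsolu, Rmult_plus_distr_r.
      apply Rabs_triang.
    + apply (ex_series_plus (V := R_NormedModule)); assumption.
  - eapply is_series_eq; [| |exact (is_series_plus _ _ _ _ A2 B2)]; [|reflexivity].
    intros k; unfold plus; simpl; ring.
  - eapply is_series_eq; [| |exact (is_series_plus _ _ _ _ A3 B3)]; [|reflexivity].
    intros k; unfold plus; simpl; ring.
Qed.

Lemma fps_eval_opp (a : fps) (r th : R) (z : C) :
  fps_eval a r th z -> fps_eval (fun k => - a k) r th (- z)%C.
Proof.
  intros [A1 [A2 A3]]; split; [|split].
  - eapply ex_series_ext; [|exact A1]; intros k; cbv beta.
    rewrite <- Ropp_mult_distr_l, Rabs_Ropp; reflexivity.
  - eapply is_series_eq; [| |exact (is_series_opp _ _ A2)]; [|reflexivity].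
    intros k; unfold opp; simpl; ring.
  - eapply is_series_eq; [| |exact (is_series_opp _ _ A3)]; [|reflexivity].
    intros k; unfold opp; simpl; ring.
Qed.

Lemma fps_eval_mult (a b : fps) (r th : R) (z w : C) :
  0 <= r -> fps_eval a r th z -> fps_eval b r th w ->
  fps_eval (PS_mult a b) r th (z * w)%C.
Proof.
  intros Hr [A1 [A2 A3]] [B1 [B2 B3]].
  pose proof (ex_series_weight a _ r Hr (fun k => qpw_fst_abs r th k Hr) A1) as AF.
  pose proof (ex_series_weight a _ r Hr (fun k => qpw_snd_abs r th k Hr) A1) as AS.
  pose proof (ex_series_weight b _ r Hr (fun k => qpw_fst_abs r th k Hr) B1) as BF.
  pose proof (ex_series_weight b _ r Hr (fun k => qpw_snd_abs r th k Hr) B1) as BS.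
  split; [|split].
  - destruct A1 as [la Hla], B1 as [lb Hlb].
    assert (G : forall f : nat -> R, ex_series (fun k => Rabs (f k)) ->
                 ex_series (fun k => Rabs (Rabs (f k)))).
    { intros f; apply ex_series_ext; intros k; rewrite Rabs_Rabsolu; reflexivity. }
    pose proof (is_series_mult _ _ _ _ Hla Hlb (G _ (ex_intro _ _ Hla))
                  (G _ (ex_intro _ _ Hlb))) as E.
    apply (ex_series_le (V := R_CompleteNormedModule)) with (2 := ex_intro _ _ E).
    intros n; change (norm ?x) with (Rabs x); rewrite Rabs_Rabsolu.
    unfold PS_mult; rewrite Rmult_comm, scal_sum.
    eapply Rle_trans; [apply Rsum_abs|]; right; apply sum_eq; intros i Hi.
    rewrite <- Rabs_mult; f_equal.
    replace (r ^ n) with (r ^ i * r ^ (n - i)); [ring|].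
    rewrite <- pow_add; f_equal; lia.
  - pose proof (is_series_mult _ _ _ _ A2 B2 AF BF) as E1.
    pose proof (is_series_mult _ _ _ _ A3 B3 AS BS) as E2.
    (* The complex Cauchy product is split into real ones: here real-real minus imaginary-imaginary,
       below the two mixed products. *)
    assert (E : forall n, PS_mult a b n * fst (qpw r th n) =
      sum_f_R0 (fun k => a k * fst (qpw r th k) * (b (n - k)%nat * fst (qpw r th (n - k)))) n -
      sum_f_R0 (fun k => a k * snd (qpw r th k) * (b (n - k)%nat * snd (qpw r th (n - k)))) n).
    { intros n; unfold PS_mult.
      rewrite <- minus_sum, Rmult_comm, scal_sum; apply sum_eq; intros i Hi.
      replace (qpw r th n) with (qpw r th i * qpw r th (n - i))%C
        by (rewrite <- qpw_add; f_equal; lia).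
      unfold Cmult; cbn [fst snd]; ring. }
    eapply is_series_eq; [| |exact (is_series_minus _ _ _ _ E1 E2)]; [|reflexivity].
    intros n; symmetry; apply E.
  - pose proof (is_series_mult _ _ _ _ A2 B3 AF BS) as E1.
    pose proof (is_series_mult _ _ _ _ A3 B2 AS BF) as E2.
    assert (E : forall n, PS_mult a b n * snd (qpw r th n) =
      sum_f_R0 (fun k => a k * fst (qpw r th k) * (b (n - k)%nat * snd (qpw r th (n - k)))) n +
      sum_f_R0 (fun k => a k * snd (qpw r th k) * (b (n - k)%nat * fst (qpw r th (n - k)))) n).
    { intros n; unfold PS_mult.
      rewrite <- sum_plus, Rmult_comm, scal_sum; apply sum_eq; intros i Hi.
      replace (qpw r th n) with (qpw r th i * qpw r th (n - i))%C
        by (rewrite <- qpw_add; f_equal; lia).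
      unfold Cmult; cbn [fst snd]; ring. }
    eapply is_series_eq; [| |exact (is_series_plus _ _ _ _ E1 E2)]; [|reflexivity].
    intros n; symmetry; apply E.
Qed.

Lemma rsum_fps_q (m : nat) (w : nat -> R) : rsum (fun k => fps_q m k * w k) (S m) = w m.
Proof.
  cbn [rsum]; rewrite (rsum_ext _ (fun _ => 0)).
  - unfold fps_q; rewrite Nat.eqb_refl, rsum_const; ring.
  - intros k Hk; unfold fps_q; destruct (Nat.eqb_spec k m); [lia|ring].
Qed.

Lemma fps_eval_q (m : nat) (r th : R) : fps_eval (fps_q m) r th (qpw r th m).
Proof.
  assert (Z : forall k, (S m <= k)%nat -> fps_q m k = 0).
  { intros k Hk; unfold fps_q; destruct (Nat.eqb_spec k m); [lia|reflexivity]. }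
  split; [|split].
  - exists (rsum (fun k => Rabs (fps_q m k * r ^ k)) (S m)); apply is_series_finite.
    intros k Hk; rewrite Z by exact Hk; rewrite Rmult_0_l; apply Rabs_R0.
  - eapply is_series_eq; [reflexivity|apply (rsum_fps_q m (fun k => fst (qpw r th k)))|].
    apply is_series_finite; intros k Hk; rewrite Z by exact Hk; ring.
  - eapply is_series_eq; [reflexivity|apply (rsum_fps_q m (fun k => snd (qpw r th k)))|].
    apply is_series_finite; intros k Hk; rewrite Z by exact Hk; ring.
Qed.

Lemma fps_eval_one (r th : R) : fps_eval fps_one r th 1.
Proof.
  replace (RtoC 1) with (qpw r th 0); [apply fps_eval_q|].
  unfold qpw, RtoC; simpl; rewrite Rmult_0_l, cos_0, sin_0; f_equal; ring.
Qed.

Lemma fps_eval_zero (r th : R) : fps_eval (fun _ => 0) r th 0.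
Proof.
  assert (Z : is_series (fun _ : nat => 0) 0)
    by (apply (is_series_finite (fun _ => 0) 0); reflexivity).
  split; [|split].
  - exists 0; eapply is_series_ext; [|exact Z]; intros; simpl.
    rewrite Rmult_0_l, Rabs_R0; reflexivity.
  - eapply is_series_ext; [|exact Z]; intros; simpl; ring.
  - eapply is_series_ext; [|exact Z]; intros; simpl; ring.
Qed.

Fixpoint csum (f : nat -> C) (n : nat) : C :=
  match n with O => 0%C | S k => (csum f k + f k)%C end.

Fixpoint cprod (f : nat -> C) (n : nat) : C :=
  match n with O => 1%C | S k => (cprod f k * f k)%C end.

Lemma fps_eval_rsum (a : nat -> fps) (r th : R) (z : nat -> C) (n : nat) :
  (forall j, (j < n)%nat -> fps_eval (a j) r th (z j)) ->
  fps_eval (fun k => rsum (fun j => a j k) n) r th (csum z n).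
Proof.
  induction n as [|n IH]; intros H; [apply fps_eval_zero|].
  apply (fps_eval_plus (fun k => rsum (fun j => a j k) n)); [apply IH|]; auto.
Qed.

(** Convergence of a series does not give convergence of its inverse on the same circle, so the
    latter is carried along. It holds for 1 - q^m, whose inverse is geometric, and is stable under
    products. *)
Definition fps_unit_eval (a : fps) (r th : R) (z : C) : Prop :=
  a O <> 0 /\ fps_eval a r th z /\ ex_series (fun k => Rabs (fps_inv a k * r ^ k)).

(** Evaluating the formal identity between a series, its inverse and 1 shows at once that the value
    is nonzero and that the inverse series takes the reciprocal value. *)
Lemma fps_unit_eval_inv (a : fps) (r th : R) (z : C) :
  0 <= r -> fps_unit_eval a r th z -> z <> 0 /\ fps_eval (fps_inv a) r th (/ z)%C.
Proof.
  intros Hr [H0 [H1 H2]].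
  destruct (fps_eval_exists (fps_inv a) r th Hr H2) as [w Hw].
  pose proof (fps_eval_mult _ _ _ _ _ _ Hr H1 Hw) as E.
  rewrite fps_mult_inv_fun in E by exact H0.
  pose proof (fps_eval_unique _ _ _ _ _ E (fps_eval_one r th)) as E1.
  assert (Hz : z <> 0).
  { intros ->; rewrite Cmult_0_l in E1; injection E1; lra. }
  split; [exact Hz|]; replace (/ z)%C with w; [exact Hw|].
  rewrite <- (Cmult_1_l w), <- (Cinv_l z Hz), <- Cmult_assoc, E1; ring.
Qed.

Lemma fps_unit_eval_mult (a b : fps) (r th : R) (z w : C) :
  0 <= r -> fps_unit_eval a r th z -> fps_unit_eval b r th w ->
  fps_unit_eval (PS_mult a b) r th (z * w)%C.
Proof.
  intros Hr Ha Hb.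
  destruct (fps_unit_eval_inv _ _ _ _ Hr Ha) as [_ Ia].
  destruct (fps_unit_eval_inv _ _ _ _ Hr Hb) as [_ Ib].
  destruct Ha as [A0 [A1 _]], Hb as [B0 [B1 _]].
  split; [|split].
  - unfold PS_mult; simpl; apply Rmult_integral_contrapositive; tauto.
  - apply fps_eval_mult; assumption.
  - rewrite fps_inv_mult by assumption.
    apply (fps_eval_mult _ _ _ _ _ _ Hr Ia Ib).
Qed.

Lemma one_minus_q_unit (m : nat) (r th : R) :
  (1 <= m)%nat -> 0 <= r < 1 -> fps_unit_eval (one_minus_q m) r th (1 - qpw r th m)%C.
Proof.
  intros Hm Hr; split; [|split].
  - unfold one_minus_q, PS_minus, PS_plus, PS_opp, fps_one, fps_q; simpl.
    destruct m; [lia|]; unfold opp, plus; simpl; lra.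
  - apply (fps_eval_plus fps_one (fun k => - fps_q m k)); [apply fps_eval_one|].
    apply fps_eval_opp, fps_eval_q.
  - rewrite fps_inv_one_minus_q by exact Hm.
    apply (ex_series_le (V := R_CompleteNormedModule)) with (b := fun k => r ^ k);
      [|apply ex_series_geom; rewrite Rabs_pos_eq; lra].
    intros k; change (norm ?x) with (Rabs x); rewrite Rabs_Rabsolu, Rabs_mult.
    pose proof (pow_le r k ltac:(lra)); rewrite (Rabs_pos_eq (r ^ k)) by assumption.
    unfold geom_fps; destruct (_ =? _)%nat; rewrite ?Rabs_R1, ?Rabs_R0; lra.
Qed.

Lemma fps_one_unit (r th : R) : 0 <= r < 1 -> fps_unit_eval fps_one r th 1.
Proof.
  intros Hr; assert (E : fps_inv fps_one = fps_one).
  { symmetry; apply fps_inv_unique; [unfold fps_one, fps_q; simpl; lra|].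
    apply PS_mult_one_l. }
  split; [unfold fps_one, fps_q; simpl; lra|]; rewrite E.
  split; [apply fps_eval_one|]; apply (fps_eval_one r 0).
Qed.

Lemma sq_one_minus_q_unit (m : nat) (r th : R) :
  (1 <= m)%nat -> 0 <= r < 1 ->
  fps_unit_eval (sq_one_minus_q m) r th ((1 - qpw r th m) * (1 - qpw r th m))%C.
Proof.
  intros Hm Hr; unfold sq_one_minus_q; simpl; rewrite PS_mult_one_l.
  apply fps_unit_eval_mult; [lra| |]; apply one_minus_q_unit; assumption.
Qed.

Lemma qpoch_unit (m n : nat) (r th : R) :
  (1 <= m)%nat -> 0 <= r < 1 ->
  fps_unit_eval (qpoch (fps_q m) n) r th (cprod (fun k => (1 - qpw r th (m + k))%C) n).
Proof.
  intros Hm Hr; induction n as [|n IH]; [apply fps_one_unit, Hr|].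
  rewrite qpoch_q_S; apply fps_unit_eval_mult; [lra|exact IH|].
  apply one_minus_q_unit; [lia|exact Hr].
Qed.

Definition spt_value (e : nat -> nat -> nat) (n i j : nat) (r th : R) : C :=
  let Q := qpw r th in
  (Q i * / ((1 - Q i) * (1 - Q i) * cprod (fun k => 1 - Q (i + 1 + k)%nat) (n - i)) *
   (Q (e i j) * / ((1 - Q j) * (1 - Q j) * cprod (fun k => 1 - Q (j + 1 + k)%nat) i)))%C.

Lemma spt_term_eval (e : nat -> nat -> nat) (n i j : nat) (r th : R) :
  (1 <= i)%nat -> (1 <= j)%nat -> 0 <= r < 1 ->
  fps_eval (spt_term e n i j) r th (spt_value e n i j r th).
Proof.
  intros Hi Hj Hr; unfold spt_term, spt_value, fps_div.
  assert (H0 : 0 <= r) by lra.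
  repeat apply (fps_eval_mult _ _ _ _ _ _ H0); try apply fps_eval_q;
    apply fps_unit_eval_inv, fps_unit_eval_mult; try exact H0;
    try (apply sq_one_minus_q_unit; assumption); apply qpoch_unit; lia || assumption.
Qed.

(** * Extraction of coefficients *)

Lemma sin_INR_PI (k : nat) : sin (INR k * PI) = 0.
Proof.
  induction k as [|k IH]; [rewrite Rmult_0_l; apply sin_0|].
  rewrite S_INR, Rmult_plus_distr_r, Rmult_1_l, neg_sin, IH; ring.
Qed.

Lemma is_RInt_eq (f : R -> R) (a b l l' : R) :
  l = l' -> is_RInt f a b l -> is_RInt f a b l'.
Proof. intros <-; trivial. Qed.

Lemma is_RInt_cos_diff (k n : nat) :
  is_RInt (fun th => cos ((INR k - INR n) * th)) 0 PI (if (k =? n)%nat then PI else 0).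
Proof.
  destruct (Nat.eqb_spec k n) as [->|H].
  - apply (is_RInt_ext (fun _ => 1)).
    + intros x _; rewrite Rminus_diag, Rmult_0_l, cos_0; reflexivity.
    + refine (is_RInt_eq _ _ _ _ _ _ (is_RInt_const (V := R_NormedModule) 0 PI 1)).
      unfold scal; simpl; unfold mult; simpl; ring.
  - set (m := INR k - INR n).
    assert (Hm : m <> 0) by (intros E; apply H, INR_eq; unfold m in E; lra).
    replace 0 with (minus (sin (m * PI) / m) (sin (m * 0) / m)) at 2.
    + apply (is_RInt_derive (fun x => sin (m * x) / m)).
      * intros x _; auto_derive; [trivial|field; exact Hm].
      * intros x _; apply (ex_derive_continuous (fun x => cos (m * x))).
        auto_derive; trivial.
    + unfold minus, plus, opp; simpl; rewrite Rmult_0_r, sin_0; unfold m.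
      rewrite Rmult_minus_distr_r, sin_minus, !sin_INR_PI; field; exact Hm.
Qed.

Lemma is_RInt_rsum (f : nat -> R -> R) (l : nat -> R) (a b : R) (N : nat) :
  (forall k, is_RInt (f k) a b (l k)) ->
  is_RInt (fun x => rsum (fun k => f k x) N) a b (rsum l N).
Proof.
  intros H; induction N as [|N IH]; simpl.
  - refine (is_RInt_eq _ _ _ _ _ _ (is_RInt_const (V := R_NormedModule) a b 0)).
    unfold scal; simpl; unfold mult; simpl; ring.
  - apply (is_RInt_plus (V := R_NormedModule)); [exact IH|apply H].
Qed.

(** The quantitative form of the Weierstrass test: the bound depends on the majorant alone, so it is
    uniform in any parameter on which [f] depends. *)
Lemma rsum_tail_bound (f g : nat -> R) (lf lg : R) (N : nat) :
  (forall k, Rabs (f k) <= g k) -> is_series f lf -> is_series g lg ->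
  Rabs (rsum f N - lf) <= lg - rsum g N.
Proof.
  intros H Hf Hg; apply is_series_rsum in Hf, Hg.
  assert (F : is_lim_seq (fun M => Rabs (rsum f N - rsum f (N + M))) (Rabs (rsum f N - lf))).
  { apply (is_lim_seq_abs _ (Finite _)), is_lim_seq_minus'; [apply is_lim_seq_const|].
    apply (is_lim_seq_ext (fun M => rsum f (M + N))); [intros; f_equal; lia|].
    apply is_lim_seq_incr_n with (N := N) (u := rsum f), Hf. }
  assert (G : is_lim_seq (fun M => rsum g (N + M) - rsum g N) (lg - rsum g N)).
  { apply is_lim_seq_minus'; [|apply is_lim_seq_const].
    apply (is_lim_seq_ext (fun M => rsum g (M + N))); [intros; f_equal; lia|].
    apply is_lim_seq_incr_n with (N := N) (u := rsum g), Hg. }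
  refine (is_lim_seq_le _ _ _ _ _ F G); intros M.
  rewrite !rsum_add.
  replace (rsum f N - (rsum f N + rsum (fun k => f (N + k)%nat) M))
    with (- rsum (fun k => f (N + k)%nat) M) by ring.
  rewrite Rabs_Ropp; eapply Rle_trans; [apply rsum_abs|].
  replace (rsum g N + rsum (fun k => g (N + k)%nat) M - rsum g N)
    with (rsum (fun k => g (N + k)%nat) M) by ring.
  apply rsum_le; intros; apply H.
Qed.

(** The integrand is the real part of z e^(-i n th), that is, the sum of b_k r^k cos ((k - n) th).
    It converges uniformly in [th], and termwise integration leaves only k = n. Since the
    coefficients are real, the half circle suffices. *)
Lemma fourier_coefficient (b : fps) (r : R) (z : R -> C) (n : nat) :
  0 <= r -> (forall th, fps_eval b r th (z th)) ->
  is_RInt (fun th => fst (z th) * cos (INR n * th) + snd (z th) * sin (INR n * th))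
    0 PI (PI * (b n * r ^ n)).
Proof.
  intros Hr Hz.
  pose (c := fun k => b k * r ^ k).
  pose (f := fun (N : nat) (th : R) => rsum (fun k => c k * cos ((INR k - INR n) * th)) N).
  pose (h := fun N => rsum (fun k => c k * (if (k =? n)%nat then PI else 0)) N).
  pose (g := fun th => fst (z th) * cos (INR n * th) + snd (z th) * sin (INR n * th)).
  assert (S : forall th, is_series (fun k => c k * cos ((INR k - INR n) * th)) (g th)).
  { intros th; destruct (Hz th) as [_ [H1 H2]].
    apply (is_series_scal (cos (INR n * th))) in H1.
    apply (is_series_scal (sin (INR n * th))) in H2.
    eapply is_series_eq; [| |exact (is_series_plus _ _ _ _ H1 H2)].
    - intros k; unfold plus, scal; simpl; unfold mult, c; simpl.
      rewrite Rmult_minus_distr_r, cos_minus; ring.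
    - unfold plus, scal, g; simpl; unfold mult; simpl; ring. }
  destruct (Hz 0) as [[L HL] _].
  destruct (filterlim_RInt (V := R_CompleteNormedModule) f 0 PI eventually
              (eventually_filter) g h) as [I [HI HR]].
  - intros N; unfold f, h; apply is_RInt_rsum; intros k.
    apply (is_RInt_scal (V := R_NormedModule)), is_RInt_cos_diff.
  - apply filterlim_locally; intros eps.
    pose proof HL as HL'; apply is_series_rsum in HL'.
    apply is_lim_seq_spec in HL'; destruct (HL' eps) as [N0 HN0].
    exists N0; intros N HN th; unfold ball; simpl; unfold AbsRing_ball, abs, minus, plus, opp; simpl.
    eapply Rle_lt_trans; [apply (rsum_tail_bound _ (fun k => Rabs (c k)) _ L)|].
    + intros k; rewrite Rabs_mult, <- (Rmult_1_r (Rabs (c k))) at 1.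
      rewrite Rmult_assoc, Rmult_1_l; rewrite <- (Rmult_1_r (Rabs (c k))) at 2.
      apply Rmult_le_compat_l; [apply Rabs_pos|apply Rabs_le, COS_bound].
    + apply S.
    + exact HL.
    + specialize (HN0 N HN); apply Rabs_lt_between in HN0; unfold c; lra.
  - replace (PI * (b n * r ^ n)) with I; [exact HR|].
    assert (HI' : is_lim_seq h (PI * (b n * r ^ n))).
    { apply (is_lim_seq_ext_loc (fun _ => PI * (b n * r ^ n))); [|apply is_lim_seq_const].
      exists (Datatypes.S n); intros N HN; unfold h.
      replace N with (Datatypes.S n + (N - Datatypes.S n))%nat by lia.
      rewrite rsum_add, (rsum_ext (fun k => c (Datatypes.S n + k)%nat * _) (fun _ => 0)).
      - cbn [rsum]; rewrite (rsum_ext _ (fun _ => 0)), !rsum_const, Nat.eqb_refl;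
          [unfold c; ring|].
        intros k Hk; destruct (Nat.eqb_spec k n); [lia|ring].
      - intros k _; destruct (Nat.eqb_spec (Datatypes.S n + k) n); [lia|ring]. }
    apply is_lim_seq_unique in HI'.
    assert (HI2 : is_lim_seq h I) by exact HI.
    apply is_lim_seq_unique in HI2; rewrite HI2 in HI'; injection HI'; trivial.
Qed.

(** * The partition generating function near q = 1 *)

Lemma exp_le_compat (x y : R) : x <= y -> exp x <= exp y.
Proof. intros [H|H]; [left; apply exp_increasing, H|right; f_equal; exact H]. Qed.

Lemma exp_neg_lt_1 (x : R) : 0 < x -> 0 < exp (- x) < 1.
Proof.
  intros H; split; [apply exp_pos|]; rewrite <- exp_0; apply exp_increasing; lra.
Qed.

Lemma exp_ge_1_plus (x : R) : 1 + x <= exp x.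
Proof.
  destruct (Req_dec x 0) as [->|H]; [rewrite exp_0; lra|].
  left; apply exp_ineq1, H.
Qed.

Lemma exp_neg_pow (x : R) (n : nat) : exp (- x) ^ n = exp (- (INR n * x)).
Proof.
  induction n as [|n IH]; [simpl; rewrite Rmult_0_l, Ropp_0, exp_0; reflexivity|].
  rewrite S_INR; simpl; rewrite IH, <- exp_plus; f_equal; ring.
Qed.

(** * Logarithms of partition products as Lambert series *)

Lemma rsum_geom (x : R) (n : nat) : (1 - x) * rsum (fun k => x ^ k) n = 1 - x ^ n.
Proof.
  induction n as [|n IH]; simpl; [ring|].
  rewrite Rmult_plus_distr_l, IH; ring.
Qed.

(** The remainder after [N] terms vanishes at 0 and has derivative y^N / (1 - y), so the mean value
    theorem bounds it by x^N / (1 - x). *)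
Lemma is_series_ln (x : R) :
  0 <= x < 1 -> is_series (fun j => x ^ S j / (INR j + 1)) (- ln (1 - x)).
Proof.
  intros Hx; apply is_series_rsum.
  assert (D : forall N y, 0 <= y < 1 ->
     is_derive (fun y => - ln (1 - y) - rsum (fun j => y ^ S j / (INR j + 1)) N) y
               (y ^ N / (1 - y))).
  { intros N y Hy; induction N as [|N IH].
    - simpl; auto_derive; [lra|field; lra].
    - apply (is_derive_ext (fun y => (- ln (1 - y) - rsum (fun j => y ^ S j / (INR j + 1)) N)
               - y ^ S N / (INR N + 1))); [intros u; cbn [rsum]; unfold Rminus; rewrite Ropp_plus_distr; apply Rplus_assoc|].
      replace (y ^ S N / (1 - y)) with (y ^ N / (1 - y) - y ^ N) by (simpl; field; lra).
      apply (is_derive_minus (V := R_NormedModule)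
        (fun y => - ln (1 - y) - rsum (fun j => y ^ S j / (INR j + 1)) N)); [exact IH|].
      pose proof (pos_INR N).
      auto_derive; [trivial|].
      change (match N with O => 1 | S _ => INR N + 1 end) with (INR (S N)).
      rewrite S_INR; simpl; field; lra. }
  assert (B : forall N, 0 <= - ln (1 - x) - rsum (fun j => x ^ S j / (INR j + 1)) N
                        <= x ^ N * / (1 - x)).
  { intros N; destruct (Req_dec x 0) as [->|Hx0].
    - rewrite (rsum_ext _ (fun _ => 0)), rsum_const, Rminus_0_r, ln_1
        by (intros; simpl; unfold Rdiv; ring).
      split; [lra|]; rewrite Rinv_1, Rmult_0_r, Ropp_0, Rminus_0_r, Rmult_1_r.
      apply pow_le; lra.
    - destruct (MVT_gen (fun y => - ln (1 - y) - rsum (fun j => y ^ S j / (INR j + 1)) N)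
         0 x (fun y => y ^ N / (1 - y))) as [c [Hc E]].
      + intros y Hy; rewrite Rmin_left, Rmax_right in Hy by lra; apply D; lra.
      + intros y Hy; rewrite Rmin_left, Rmax_right in Hy by lra.
        apply continuity_pt_filterlim, (ex_derive_continuous (V := R_NormedModule)
          (fun y => - ln (1 - y) - rsum (fun j => y ^ S j / (INR j + 1)) N)).
        exists (y ^ N / (1 - y)); apply (D N); lra.
      + rewrite Rmin_left, Rmax_right in Hc by lra.
        rewrite Rminus_0_r, ln_1 in E.
        rewrite (rsum_ext (fun j => 0 ^ S j / (INR j + 1)) (fun _ => 0)), rsum_const in E
          by (intros; simpl; unfold Rdiv; ring).
        assert (Hpos : 0 <= c ^ N) by (apply pow_le; lra).
        assert (Hle : c ^ N <= x ^ N) by (apply pow_incr; lra).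
        assert (Hi : 0 < / (1 - c) <= / (1 - x))
          by (split; [apply Rinv_0_lt_compat; lra|apply Rinv_le_contravar; lra]).
        assert (0 <= c ^ N / (1 - c) <= x ^ N * / (1 - x))
          by (split; [apply Rmult_le_pos; lra|apply Rmult_le_compat; lra]).
        replace (- ln (1 - x) - rsum (fun j => x ^ S j / (INR j + 1)) N)
          with (c ^ N / (1 - c) * (x - 0)) by lra.
        split; [apply Rmult_le_pos; lra|].
        rewrite <- (Rmult_1_r (x ^ N * / (1 - x))); apply Rmult_le_compat; lra. }
  apply is_lim_seq_le_le with (fun N => - ln (1 - x) - x ^ N * / (1 - x)) (fun _ => - ln (1 - x)).
  - intros N; specialize (B N); lra.
  - replace (Finite (- ln (1 - x))) with (Finite (- ln (1 - x) - 0 * / (1 - x)))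
      by (f_equal; ring).
    apply is_lim_seq_minus'; [apply is_lim_seq_const|].
    apply (is_lim_seq_scal_r _ (/ (1 - x)) (Finite 0)).
    apply is_lim_seq_geom; rewrite Rabs_pos_eq; lra.
  - apply is_lim_seq_const.
Qed.

Lemma is_series_rsum_fam (a : nat -> nat -> R) (l : nat -> R) (N : nat) :
  (forall k, (k < N)%nat -> is_series (a k) (l k)) ->
  is_series (fun j => rsum (fun k => a k j) N) (rsum l N).
Proof.
  induction N as [|N IH]; intros H.
  - apply is_series_rsum, (is_lim_seq_ext (fun _ => 0)); [|apply is_lim_seq_const].
    intros n; simpl; rewrite rsum_const; ring.
  - apply (is_series_plus (V := R_NormedModule) (fun j => rsum (fun k => a k j) N));
      [apply IH; intros|]; apply H; lia.
Qed.

Lemma inv_exp_minus_1_bounds (x : R) :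
  0 < x -> / x - 1 <= / (exp x - 1) <= / x /\ 0 < / (exp x - 1).
Proof.
  intros Hx; pose proof (exp_ge_1_plus x); pose proof (exp_ge_1_plus (- x)) as H1.
  rewrite exp_Ropp in H1; pose proof (exp_pos x).
  assert (H2 : (1 - x) * exp x <= 1).
  { apply (Rmult_le_compat_r (exp x)) in H1; [|lra].
    rewrite Rinv_l in H1; lra. }
  split; [split|].
  - replace (/ x - 1) with ((1 - x) * / x) by (field; lra).
    apply Rmult_le_reg_r with (x * (exp x - 1)); [nra|].
    replace ((1 - x) * / x * (x * (exp x - 1))) with ((1 - x) * exp x - (1 - x)) by (field; lra).
    replace (/ (exp x - 1) * (x * (exp x - 1))) with x by (field; lra). lra.
  - apply Rinv_le_contravar; lra.
  - apply Rinv_0_lt_compat; lra.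
Qed.

(** Expanding the logarithms in ln P(e^(-t)) and summing over the parts first gives the sum over j
    >= 1 of 1 / (j (e^(j t) - 1)); indices here start at 0. *)
Definition lambert_term (t : R) (j : nat) : R :=
  / ((INR j + 1) * (exp ((INR j + 1) * t) - 1)).

Definition log_partition_inf (t : R) : R := Series (lambert_term t).

Definition log_partition (N : nat) (t : R) : R :=
  rsum (fun k => - ln (1 - exp (- ((INR k + 1) * t)))) N.

Lemma INR1_pos (k : nat) : 0 < INR k + 1.
Proof. pose proof (pos_INR k); lra. Qed.

Lemma lambert_term_bounds (t : R) (j : nat) :
  0 < t -> 0 < lambert_term t j /\
  / t * / (INR j + 1) ^ 2 - 1 <= lambert_term t j <= / t * / (INR j + 1) ^ 2.
Proof.
  intros Ht; pose proof (INR1_pos j) as Hj.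
  assert (1 <= INR j + 1) by (pose proof (pos_INR j); lra).
  destruct (inv_exp_minus_1_bounds ((INR j + 1) * t)) as [[B1 B2] B3]; [nra|].
  unfold lambert_term; rewrite Rinv_mult.
  assert (Hi : 0 < / (INR j + 1) <= 1).
  { split; [apply Rinv_0_lt_compat; lra|].
    rewrite <- Rinv_1; apply Rinv_le_contravar; lra. }
  replace (/ t * / (INR j + 1) ^ 2) with (/ (INR j + 1) * / ((INR j + 1) * t)) by (field; lra).
  split; [apply Rmult_lt_0_compat; lra|nra].
Qed.

Lemma zeta2_series : is_series (fun j => / (INR j + 1) ^ 2) (PI ^ 2 / 6).
Proof. apply is_series_rsum, zeta2. Qed.

Lemma lambert_series (t : R) : 0 < t -> is_series (lambert_term t) (log_partition_inf t).
Proof.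
  intros Ht; apply Series_correct.
  apply (ex_series_le (V := R_CompleteNormedModule)) with (b := fun j => / t * / (INR j + 1) ^ 2).
  - intros j; change (norm ?x) with (Rabs x); destruct (lambert_term_bounds t j Ht).
    rewrite Rabs_pos_eq; lra.
  - exists (scal (/ t) (PI ^ 2 / 6)).
    apply (is_series_scal (V := R_NormedModule)), zeta2_series.
Qed.

Lemma is_series_le (a b : nat -> R) (la lb : R) :
  (forall n, a n <= b n) -> is_series a la -> is_series b lb -> la <= lb.
Proof.
  intros H Ha Hb; apply is_series_rsum in Ha, Hb.
  refine (is_lim_seq_le _ _ _ _ _ Ha Hb); intros n; apply rsum_le; auto.
Qed.

Lemma log_partition_inf_upper (t : R) :
  0 < t -> 0 <= log_partition_inf t <= PI ^ 2 / (6 * t).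
Proof.
  intros Ht; pose proof (lambert_series t Ht) as S; split.
  - apply Rle_trans with (rsum (lambert_term t) 0); [simpl; lra|].
    apply rsum_le_series; [|exact S]; intros k.
    destruct (lambert_term_bounds t k Ht); lra.
  - replace (PI ^ 2 / (6 * t)) with (/ t * (PI ^ 2 / 6)) by (field; lra).
    refine (is_series_le _ _ _ _ _ S (is_series_scal (V := R_NormedModule) (/ t) _ _ zeta2_series)).
    intros j; change (lambert_term t j <= / t * / (INR j + 1) ^ 2).
    apply lambert_term_bounds, Ht.
Qed.

(** The first [J] terms alone, each losing at most 1, already show that t ln P(e^(-t)) tends to
    zeta(2). *)
Lemma log_partition_inf_lower (t : R) (J : nat) :
  0 < t -> / t * zsum 2 J - INR J <= log_partition_inf t.
Proof.
  intros Ht; pose proof (lambert_series t Ht) as S.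
  eapply Rle_trans; [|apply (rsum_le_series (lambert_term t) _ J); [|exact S]].
  - unfold zsum; rewrite <- rsum_scal, <- (Rmult_1_r (INR J)), <- rsum_const, <- rsum_minus.
    apply rsum_le; intros j _; apply lambert_term_bounds, Ht.
  - intros j; destruct (lambert_term_bounds t j Ht); lra.
Qed.

(** Cutting the product at the part [N] turns the geometric series over the parts into a finite one,
    which multiplies each Lambert term by 1 - e^(-N j t). *)
Lemma log_partition_series (N : nat) (t : R) :
  0 < t -> is_series (fun j => lambert_term t j * (1 - exp (- (INR N * (INR j + 1) * t))))
                     (log_partition N t).
Proof.
  intros Ht.
  eapply is_series_ext; [|unfold log_partition; apply is_series_rsum_fam; intros k _;
    apply (is_series_ln (exp (- ((INR k + 1) * t))))].
  - intros j; cbv beta; pose proof (INR1_pos j) as Hj.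
    assert (0 < (INR j + 1) * t) by nra.
    set (x := exp (- ((INR j + 1) * t))).
    assert (Hx : 0 < x < 1) by (apply exp_neg_lt_1; assumption).
    rewrite (rsum_ext _ (fun k => x / (INR j + 1) * x ^ k)).
    + rewrite rsum_scal.
      replace (rsum (pow x) N) with ((1 - x ^ N) / (1 - x))
        by (rewrite <- (rsum_geom x N); change (fun k => x ^ k) with (pow x); field; lra).
      unfold lambert_term; replace (exp ((INR j + 1) * t)) with (/ x)
        by (unfold x; rewrite <- exp_Ropp; f_equal; ring).
      replace (exp (- (INR N * (INR j + 1) * t))) with (x ^ N)
        by (unfold x; rewrite exp_neg_pow; f_equal; ring).
      match goal with |- ?a = ?b => change (@eq R a b) end.
      field; repeat split; lra.
    + intros k _; replace (exp (- ((INR k + 1) * t)) ^ S j) with (x * x ^ k)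
        by (unfold x; rewrite !exp_neg_pow, S_INR, <- exp_plus; f_equal; ring).
      unfold Rdiv; ring.
  - pose proof (INR1_pos k); pose proof (exp_neg_lt_1 ((INR k + 1) * t) ltac:(nra)); lra.
Qed.

Lemma log_partition_bounds (N : nat) (t : R) :
  0 < t -> (1 - exp (- (INR N * t))) * log_partition_inf t <= log_partition N t
           <= log_partition_inf t.
Proof.
  intros Ht; pose proof (log_partition_series N t Ht) as S.
  pose proof (lambert_series t Ht) as SL; split.
  - refine (is_series_le _ _ _ _ _ (is_series_scal (V := R_NormedModule)
      (1 - exp (- (INR N * t))) _ _ SL) S).
    intros j; unfold scal; simpl; unfold mult; simpl.
    destruct (lambert_term_bounds t j Ht) as [B _].
    assert (exp (- (INR N * (INR j + 1) * t)) <= exp (- (INR N * t))).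
    { apply exp_le_compat; pose proof (pos_INR N); pose proof (pos_INR j).
      assert (0 <= INR N * INR j * t) by (repeat apply Rmult_le_pos; lra). lra. }
    nra.
  - refine (is_series_le _ _ _ _ _ S SL).
    intros j; destruct (lambert_term_bounds t j Ht) as [B _].
    pose proof (exp_pos (- (INR N * (INR j + 1) * t))); nra.
Qed.

Lemma log_partition_lim (t : R) (f : nat -> nat) :
  0 < t -> (forall N, (N <= f N)%nat) ->
  is_lim_seq (fun N => log_partition (f N) t) (log_partition_inf t).
Proof.
  intros Ht Hf.
  pose proof (log_partition_inf_upper t Ht) as [L0 _].
  apply is_lim_seq_le_le with
    (fun N => log_partition_inf t - exp (- t) ^ N * log_partition_inf t)
    (fun _ => log_partition_inf t).
  - intros N; destruct (log_partition_bounds (f N) t Ht); split; [|lra].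
    rewrite exp_neg_pow.
    assert (exp (- (INR (f N) * t)) <= exp (- (INR N * t))).
    { apply exp_le_compat; apply Ropp_le_contravar, Rmult_le_compat_r; [lra|].
      apply le_INR, Hf. }
    nra.
  - replace (Finite (log_partition_inf t))
      with (Finite (log_partition_inf t - 0 * log_partition_inf t)) at 1 by (f_equal; ring).
    apply is_lim_seq_minus'; [apply is_lim_seq_const|].
    apply (is_lim_seq_scal_r _ (log_partition_inf t) (Finite 0)), is_lim_seq_geom.
    pose proof (exp_neg_lt_1 t Ht); rewrite Rabs_pos_eq; lra.
  - apply is_lim_seq_const.
Qed.

(** ** Gauss's triangular number identity *)

(** The power q^x for q = e^(-t), with a real exponent so that s (s + 1) / 2 is ordinary
    division. *)
Definition qe (t x : R) : R := exp (- (x * t)).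

Lemma qe_add (t x y : R) : qe t (x + y) = qe t x * qe t y.
Proof. unfold qe; rewrite <- exp_plus; f_equal; ring. Qed.

Lemma qe_lt_1 (t x : R) : 0 < t -> 0 < x -> 0 < qe t x < 1.
Proof. intros; apply exp_neg_lt_1, Rmult_lt_0_compat; assumption. Qed.

(** Multiplying numerator and denominator by the even factors turns this into the product side of
    Gauss's identity: the product of (1 - q^(2k))^2 for k <= n over that of 1 - q^k for k <= 2n. *)
Definition gauss_prod (t : R) (n : nat) : R :=
  rprod (fun k => (1 - qe t (2 * INR k + 2)) / (1 - qe t (2 * INR k + 1))) n.

Lemma gauss_factor_ge_1 (t : R) (k : nat) :
  0 < t -> 1 <= (1 - qe t (2 * INR k + 2)) / (1 - qe t (2 * INR k + 1)).
Proof.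
  intros Ht; pose proof (pos_INR k).
  pose proof (qe_lt_1 t (2 * INR k + 1) Ht ltac:(lra)) as H1.
  assert (qe t (2 * INR k + 2) <= qe t (2 * INR k + 1))
    by (apply exp_le_compat; nra).
  apply Rmult_le_reg_r with (1 - qe t (2 * INR k + 1)); [lra|].
  unfold Rdiv; rewrite Rmult_assoc, Rinv_l; lra.
Qed.

Lemma gauss_prod_ge_1 (t : R) (n : nat) : 0 < t -> 1 <= gauss_prod t n.
Proof.
  intros Ht; induction n as [|n IH]; [unfold gauss_prod; simpl; lra|].
  unfold gauss_prod; simpl rprod; fold (gauss_prod t n).
  pose proof (gauss_factor_ge_1 t n Ht); nra.
Qed.

Definition shanks_term (t : R) (n s : nat) : R :=
  gauss_prod t n / gauss_prod t s * qe t (INR s * (2 * INR n + 1)).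

(* Shanks's proof: the difference of consecutive left-hand sides telescopes in [s]. *)
Lemma shanks_identity (t : R) (n : nat) :
  0 < t ->
  rsum (shanks_term t n) n = rsum (fun s => qe t (INR s * (INR s + 1) / 2)) (2 * n).
Proof.
  intros Ht; induction n as [|n IH]; [reflexivity|].
  replace (2 * S n)%nat with (S (S (2 * n))) by lia; cbn [rsum].
  rewrite <- IH; set (w := shanks_term t n).
  (* The right side gains two terms. One is the new top index s = n of the old summand, the other is
     what survives of the telescoping sum. *)
  assert (Hw : w n = qe t (INR (2 * n) * (INR (2 * n) + 1) / 2)).
  { unfold w, shanks_term; pose proof (gauss_prod_ge_1 t n Ht).
    unfold Rdiv at 1; rewrite Rinv_r, Rmult_1_l by lra.
    f_equal; rewrite mult_INR; change (INR 2) with 2; field. }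
  set (a := qe t (2 * INR n + 1)).
  assert (Ha : 0 < a < 1) by (apply qe_lt_1; [|pose proof (pos_INR n)]; lra).
  assert (Hlast : qe t (INR (S (2 * n)) * (INR (S (2 * n)) + 1) / 2) = w n * a).
  { rewrite Hw; unfold a; rewrite <- qe_add; f_equal.
    rewrite S_INR, mult_INR; change (INR 2) with 2; field. }
  (* The telescoping certificate; the factor 1 - q^(2s) makes it vanish at s = 0. *)
  pose (v := fun s : nat => - (w s * (1 - qe t (2 * INR s))) / (1 - a)).
  assert (E : forall s, (s < S n)%nat ->
     shanks_term t (S n) s = w s + (v s - v (S s))).
  { intros s Hs; pose proof (pos_INR s).
    pose proof (qe_lt_1 t (2 * INR s + 1) Ht ltac:(lra)) as H1.
    pose proof (qe_lt_1 t (2 * INR s + 2) Ht ltac:(lra)) as H2.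
    pose proof (gauss_prod_ge_1 t n Ht) as Gn.
    pose proof (gauss_prod_ge_1 t s Ht) as Gs.
    unfold v, w, shanks_term.
    replace (gauss_prod t (S s)) with (gauss_prod t s *
      ((1 - qe t (2 * INR s + 2)) / (1 - qe t (2 * INR s + 1)))) by reflexivity.
    replace (gauss_prod t (S n)) with (gauss_prod t n *
      ((1 - qe t (2 * INR n + 2)) / (1 - qe t (2 * INR n + 1)))) by reflexivity.
    rewrite !S_INR; fold a.
    replace (2 * INR n + 2) with (2 * INR n + 1 + 1) by ring.
    replace (2 * (INR s + 1)) with (2 * INR s + 2) by ring.
    replace ((INR s + 1) * (2 * INR n + 1)) with (INR s * (2 * INR n + 1) + (2 * INR n + 1)) by ring.
    replace (INR s * (2 * (INR n + 1) + 1)) with (INR s * (2 * INR n + 1) + 2 * INR s) by ring.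
    replace (2 * INR s + 2) with (2 * INR s + (1 + 1)) in * by ring.
    set (m := 2 * INR n + 1) in *.
    rewrite !qe_add; rewrite qe_add in H1; rewrite qe_add, (qe_add t 1 1) in H2; fold a.
    set (b := qe t (2 * INR s)) in *; set (c := qe t 1) in *.
    field; repeat split; lra. }
  change (rsum (shanks_term t (S n)) (S n) =
    rsum w n + qe t (INR (2 * n) * (INR (2 * n) + 1) / 2)
      + qe t (INR (S (2 * n)) * (INR (S (2 * n)) + 1) / 2)).
  rewrite (rsum_ext _ _ _ E), rsum_plus, rsum_telescope, Hlast, <- Hw; cbn [rsum].
  assert (V : v O - v (S n) = w n * a); [|lra].
  unfold v; rewrite S_INR; simpl (INR 0).
  replace (qe t (2 * 0)) with 1 by (unfold qe; rewrite Rmult_0_r, Rmult_0_l, Ropp_0, exp_0; ring).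
  unfold w, shanks_term; rewrite S_INR.
  replace (gauss_prod t (S n)) with (gauss_prod t n *
      ((1 - qe t (2 * INR n + 2)) / (1 - qe t (2 * INR n + 1)))) by reflexivity.
  fold a; pose proof (pos_INR n).
  pose proof (qe_lt_1 t (2 * INR n + 2) Ht ltac:(lra)) as H2.
  pose proof (gauss_prod_ge_1 t n Ht) as Gn.
  pose proof (gauss_prod_ge_1 t 0 Ht) as G0.
  replace ((INR n + 1) * (2 * INR n + 1)) with (INR n * (2 * INR n + 1) + (2 * INR n + 1)) by ring.
  replace (2 * (INR n + 1)) with (2 * INR n + 2) by ring.
  rewrite (qe_add t (INR n * (2 * INR n + 1))); fold a; field; repeat split; lra.
Qed.

Lemma gauss_prod_exp (t : R) (n : nat) :
  0 < t -> gauss_prod t n = exp (log_partition (2 * n) t - 2 * log_partition n (2 * t)).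
Proof.
  intros Ht; induction n as [|n IH].
  - unfold gauss_prod, log_partition; simpl; rewrite Rmult_0_r, Rminus_0_r, exp_0; reflexivity.
  - unfold gauss_prod; simpl rprod; fold (gauss_prod t n).
    replace (2 * S n)%nat with (S (S (2 * n))) by lia.
    unfold log_partition; cbn [rsum].
    fold (log_partition (2 * n) t) (log_partition n (2 * t)).
    rewrite S_INR, mult_INR; change (INR 2) with 2; pose proof (pos_INR n).
    pose proof (qe_lt_1 t (2 * INR n + 1) Ht ltac:(lra)) as H1.
    pose proof (qe_lt_1 t (2 * INR n + 2) Ht ltac:(lra)) as H2.
    replace (exp (- ((2 * INR n + 1) * t))) with (qe t (2 * INR n + 1)) by reflexivity.
    replace (exp (- ((2 * INR n + 1 + 1) * t))) with (qe t (2 * INR n + 2))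
      by (unfold qe; f_equal; ring).
    replace (exp (- ((INR n + 1) * (2 * t)))) with (qe t (2 * INR n + 2))
      by (unfold qe; f_equal; ring).
    set (x := qe t (2 * INR n + 1)) in *; set (y := qe t (2 * INR n + 2)) in *.
    replace (log_partition (2 * n) t + - ln (1 - x) + - ln (1 - y)
             - 2 * (log_partition n (2 * t) + - ln (1 - y)))
      with ((log_partition (2 * n) t - 2 * log_partition n (2 * t))
            + (ln (1 - y) + - ln (1 - x))) by ring.
    rewrite exp_plus, <- IH, exp_plus, exp_Ropp, !exp_ln by lra; reflexivity.
Qed.

(** In the finite identity the term s = 0 is the whole product, and the others sum to O(q^n).
    Letting n grow gives the series, with the product expressed through ln P at t and 2t. *)
Lemma gauss_triangular (t : R) :
  0 < t -> is_series (fun s => qe t (INR s * (INR s + 1) / 2))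
             (exp (log_partition_inf t - 2 * log_partition_inf (2 * t))).
Proof.
  intros Ht; set (G := exp (log_partition_inf t - 2 * log_partition_inf (2 * t))).
  set (f := fun s => qe t (INR s * (INR s + 1) / 2)).
  assert (HG : is_lim_seq (gauss_prod t) G).
  { apply is_lim_seq_ext with (fun n => exp (log_partition (2 * n) t - 2 * log_partition n (2 * t)));
      [intros; symmetry; apply gauss_prod_exp, Ht|].
    unfold G; apply is_lim_seq_continuous;
      [apply derivable_continuous_pt, derivable_pt_exp|].
    apply is_lim_seq_minus'; [apply (log_partition_lim t (fun N => 2 * N)%nat); [lra|intros; lia]|].
    apply (is_lim_seq_scal_l _ 2 (Finite _)), (log_partition_lim (2 * t) (fun N => N)); [lra|lia]. }
  assert (H2 : is_lim_seq (fun n => rsum f (2 * n)) G).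
  { pose proof (qe_lt_1 t 1 Ht ltac:(lra)) as Hq; set (q := qe t 1) in *.
    apply is_lim_seq_le_le_loc with (gauss_prod t)
      (fun n => gauss_prod t n + gauss_prod t n * (q ^ n * / (1 - q))).
    - exists 1%nat; intros n Hn.
      pose proof (shanks_identity t n Ht) as E; fold f in E; rewrite <- E; clear E.
      assert (E : rsum (shanks_term t n) n = rsum (shanks_term t n) (1 + (n - 1)))
        by (f_equal; lia).
      rewrite E, rsum_add; clear E.
      assert (E0 : rsum (shanks_term t n) 1 = gauss_prod t n).
      { simpl; unfold shanks_term, qe; simpl (INR 0).
        rewrite !Rmult_0_l, Ropp_0, exp_0; unfold gauss_prod at 2; simpl; field. }
      rewrite E0.
      assert (B : forall k, 0 <= shanks_term t n (1 + k) <= gauss_prod t n * (q ^ n * q ^ k)).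
      { intros k; unfold shanks_term; set (s := (1 + k)%nat).
        pose proof (gauss_prod_ge_1 t n Ht); pose proof (gauss_prod_ge_1 t s Ht).
        assert (Hi : 0 < / gauss_prod t s <= 1).
        { split; [apply Rinv_0_lt_compat; lra|].
          rewrite <- Rinv_1; apply Rinv_le_contravar; lra. }
        assert (Hq2 : 0 < qe t (INR s * (2 * INR n + 1)) <= q ^ n * q ^ k).
        { split; [apply exp_pos|]; unfold q, qe; rewrite !exp_neg_pow, <- exp_plus.
          apply exp_le_compat; unfold s; rewrite S_INR.
          pose proof (pos_INR n); pose proof (pos_INR k).
          assert (0 <= INR n * INR k) by (apply Rmult_le_pos; lra).
          assert (INR n + INR k <= (INR k + 1) * (2 * INR n + 1)) by nra.
          nra. }
        split.
        - unfold Rdiv; apply Rmult_le_pos; [apply Rmult_le_pos; lra|lra].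
        - apply Rmult_le_compat; [unfold Rdiv; apply Rmult_le_pos; lra|lra| |lra].
          unfold Rdiv; rewrite <- (Rmult_1_r (gauss_prod t n)) at 2.
          apply Rmult_le_compat_l; lra. }
      split.
      + pose proof (rsum_nonneg (fun k => shanks_term t n (1 + k)) (n - 1)
          (fun k _ => proj1 (B k))); lra.
      + apply Rplus_le_compat_l.
        eapply Rle_trans; [apply rsum_le; intros k _; apply B|].
        rewrite rsum_scal, rsum_scal.
        pose proof (gauss_prod_ge_1 t n Ht).
        apply Rmult_le_compat_l; [lra|apply Rmult_le_compat_l; [apply pow_le; lra|]].
        apply Rmult_le_reg_l with (1 - q); [lra|].
        rewrite rsum_geom, Rinv_r by lra; pose proof (pow_le q (n - 1) ltac:(lra)); lra.
    - exact HG.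
    - replace (Finite G) with (Finite (G + G * (0 * / (1 - q)))) by (f_equal; ring).
      apply is_lim_seq_plus'; [exact HG|apply is_lim_seq_mult'; [exact HG|]].
      apply (is_lim_seq_scal_r _ (/ (1 - q)) (Finite 0)), is_lim_seq_geom.
      rewrite Rabs_pos_eq; lra. }
  (* Only partial sums of even length are controlled so far; positivity of the terms extends the
     limit to all lengths. *)
  assert (Hf : forall k, 0 <= f k) by (intros; left; apply exp_pos).
  destruct (ex_finite_lim_seq_incr (rsum f) G) as [l Hl].
  - intros n; cbn [rsum]; specialize (Hf n); lra.
  - intros n; apply Rle_trans with (rsum f (2 * n)); [apply rsum_mono; [exact Hf|lia]|].
    apply (is_lim_seq_incr_compare (fun n => rsum f (2 * n))); [exact H2|].
    intros k; apply rsum_mono; [exact Hf|lia].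
  - apply is_series_rsum; replace G with l; [exact Hl|].
    pose proof (is_lim_seq_double _ _ Hl) as H3.
    apply is_lim_seq_unique in H2, H3; congruence.
Qed.

(** ** The Gaussian integral *)

(** Its square PI^2 / 3 is the limit of t^3 times the variance of the partition size. *)
Definition gauss_sigma : R := PI / sqrt 3.

Lemma gauss_sigma_sq : gauss_sigma ^ 2 = PI ^ 2 / 3.
Proof.
  unfold gauss_sigma; pose proof (sqrt_lt_R0 3 ltac:(lra)).
  unfold Rdiv; rewrite Rpow_mult_distr, pow_inv, pow2_sqrt by lra; reflexivity.
Qed.

Lemma gauss_sigma_pos : 0 < gauss_sigma.
Proof. apply Rdiv_lt_0_compat; [apply PI_RGT_0|apply sqrt_lt_R0; lra]. Qed.

Definition gaussian (u : R) : R := exp (- (gauss_sigma ^ 2 * u ^ 2 / 2)).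

Definition gauss_int (A : R) : R := RInt gaussian 0 A.

Lemma gaussian_continuous (u : R) : continuous gaussian u.
Proof.
  apply (ex_derive_continuous (V := R_NormedModule)); unfold gaussian; auto_derive; trivial.
Qed.

Lemma gaussian_int_ex (a b : R) : ex_RInt gaussian a b.
Proof. apply (ex_RInt_continuous (V := R_CompleteNormedModule)); intros; apply gaussian_continuous. Qed.

Lemma gaussian_decr (u v : R) : 0 <= u <= v -> gaussian v <= gaussian u.
Proof.
  intros H; apply exp_le_compat.
  assert (u ^ 2 <= v ^ 2) by (apply pow_incr; exact H).
  pose proof (pow2_ge_0 gauss_sigma); nra.
Qed.

Lemma gaussian_bounds (u : R) : 0 < gaussian u <= 1.
Proof.
  split; [apply exp_pos|]; rewrite <- exp_0; apply exp_le_compat.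
  pose proof (pow2_ge_0 gauss_sigma); pose proof (pow2_ge_0 u); nra.
Qed.

Lemma gauss_int_Chasles (a b : R) : gauss_int b = gauss_int a + RInt gaussian a b.
Proof.
  unfold gauss_int; symmetry; apply (RInt_Chasles gaussian 0 a b); apply gaussian_int_ex.
Qed.

Lemma RInt_gaussian_bounds (a b : R) :
  0 <= a <= b -> (b - a) * gaussian b <= RInt gaussian a b <= (b - a) * gaussian a.
Proof.
  intros H; split.
  - replace ((b - a) * gaussian b) with (RInt (fun _ => gaussian b) a b)
      by (rewrite RInt_const; reflexivity).
    apply RInt_le; [lra|apply ex_RInt_const|apply gaussian_int_ex|].
    intros x Hx; apply gaussian_decr; lra.
  - replace ((b - a) * gaussian a) with (RInt (fun _ => gaussian a) a b)
      by (rewrite RInt_const; reflexivity).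
    apply RInt_le; [lra|apply gaussian_int_ex|apply ex_RInt_const|].
    intros x Hx; apply gaussian_decr; lra.
Qed.

Lemma gauss_int_mono (a b : R) : 0 <= a <= b -> gauss_int a <= gauss_int b.
Proof.
  intros H; rewrite (gauss_int_Chasles a b).
  pose proof (RInt_gaussian_bounds a b H); pose proof (gaussian_bounds b); nra.
Qed.

(** The Gaussian lies below 1 / (1 + u^2), by e^x >= 1 + x and [gauss_sigma]^2 > 2, so the
    arctangent bounds the integral. Only finiteness matters. *)
Lemma gauss_int_le (a : R) : 0 <= a -> gauss_int a <= PI / 2.
Proof.
  intros Ha; apply Rle_trans with (atan a); [|left; apply atan_bound].
  assert (HI : is_RInt (fun u => / (1 + u ^ 2)) 0 a (atan a)).
  { replace (atan a) with (minus (atan a) (atan 0))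
      by (rewrite atan_0; unfold minus, plus, opp; simpl; ring).
    apply (is_RInt_derive atan).
    - intros x _; apply is_derive_Reals, derivable_pt_lim_atan.
    - intros x _; apply (ex_derive_continuous (V := R_NormedModule)).
      auto_derive; pose proof (pow2_ge_0 x); simpl in *; lra. }
  rewrite <- (is_RInt_unique _ _ _ _ HI).
  apply RInt_le; [exact Ha|apply gaussian_int_ex|eexists; exact HI|].
  intros x _; unfold gaussian; rewrite exp_Ropp.
  pose proof (pow2_ge_0 x).
  apply Rinv_le_contravar; [lra|].
  eapply Rle_trans; [|apply exp_ge_1_plus].
  rewrite gauss_sigma_sq.
  assert (3 < PI) by (pose proof PI2_3_2; unfold PI2 in *; lra).
  assert (9 < PI ^ 2) by nra.
  nra.
Qed.

Lemma gauss_int_lim :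
  exists J, 0 < J /\ (forall A, 0 <= A -> gauss_int A <= J) /\
    forall eps, 0 < eps -> exists A0, 0 <= A0 /\ forall A, A0 <= A -> J - eps < gauss_int A.
Proof.
  destruct (ex_finite_lim_seq_incr (fun n => gauss_int (INR n)) (PI / 2)) as [J HJ].
  - intros n; apply gauss_int_mono; rewrite S_INR; pose proof (pos_INR n); lra.
  - intros n; apply gauss_int_le, pos_INR.
  - assert (HA : forall A, 0 <= A -> gauss_int A <= J).
    { intros A HA; destruct (nfloor_ex A HA) as [n Hn].
      apply Rle_trans with (gauss_int (INR (S n))); [apply gauss_int_mono; rewrite S_INR; lra|].
      apply (is_lim_seq_incr_compare (fun n => gauss_int (INR n))); [exact HJ|].
      intros k; apply gauss_int_mono; rewrite S_INR; pose proof (pos_INR k); lra. }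
    exists J; split; [|split; [exact HA|]].
    + apply Rlt_le_trans with (gauss_int 1); [|apply HA; lra].
      unfold gauss_int; pose proof (RInt_gaussian_bounds 0 1 ltac:(lra)).
      pose proof (gaussian_bounds 1); lra.
    + intros eps Heps; apply is_lim_seq_spec in HJ.
      destruct (HJ (mkposreal eps Heps)) as [N HN]; simpl in HN.
      exists (INR N); split; [apply pos_INR|]; intros A HNA.
      specialize (HN N (le_n N)); apply Rabs_lt_between in HN.
      pose proof (gauss_int_mono (INR N) A ltac:(pose proof (pos_INR N); lra)); lra.
Qed.

(** The series is a Riemann sum: with step h = sqrt t / [gauss_sigma], the Gaussian at h x is
    q^(x^2/2). The exponent s (s + 1) / 2 lies between s^2 / 2 and (s + 1)^2 / 2, so comparison with
    the monotone integrand on cells of length h loses one cell on either side, and [gauss_sigma] * h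
    = sqrt t. *)
Lemma triangular_sum_bounds (t J T : R) :
  0 < t -> (forall A, 0 <= A -> gauss_int A <= J) ->
  (forall eps, 0 < eps -> exists A0, 0 <= A0 /\ forall A, A0 <= A -> J - eps < gauss_int A) ->
  is_series (fun s => qe t (INR s * (INR s + 1) / 2)) T ->
  gauss_sigma * J - sqrt t <= sqrt t * T <= exp (t / 8) * (gauss_sigma * J + sqrt t).
Proof.
  intros Ht HJ HJ' HS; set (h := sqrt t / gauss_sigma).
  pose proof gauss_sigma_pos as Hs; pose proof (sqrt_lt_R0 t Ht) as Hst.
  assert (Hh : 0 < h) by (apply Rdiv_lt_0_compat; assumption).
  assert (E : forall x, gaussian (h * x) = exp (- (t * x ^ 2 / 2))).
  { intros x; unfold gaussian, h; do 3 f_equal.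
    replace (gauss_sigma ^ 2 * (sqrt t / gauss_sigma * x) ^ 2) with ((sqrt t) ^ 2 * x ^ 2) by (field; lra).
    rewrite pow2_sqrt by lra; reflexivity. }
  set (f := fun s => qe t (INR s * (INR s + 1) / 2)) in *.
  assert (Hsig : sqrt t = gauss_sigma * h) by (unfold h; field; lra).
  split.
  - apply Rle_trans with (gauss_sigma * (J - h)); [lra|].
    rewrite Hsig, Rmult_assoc; apply Rmult_le_compat_l; [lra|].
    assert (B : forall N, gauss_int (h * (INR N + 1)) <= h + h * rsum f N).
    { induction N as [|N IH].
      - simpl; rewrite Rplus_0_l, Rmult_1_r, Rmult_0_r, Rplus_0_r; unfold gauss_int.
        pose proof (RInt_gaussian_bounds 0 h ltac:(lra)); pose proof (gaussian_bounds 0); nra.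
      - rewrite (gauss_int_Chasles (h * (INR N + 1))), S_INR; cbn [rsum].
        pose proof (pos_INR N).
        assert (Hle : 0 <= h * (INR N + 1)) by (apply Rmult_le_pos; lra).
        pose proof (RInt_gaussian_bounds (h * (INR N + 1)) (h * (INR N + 1 + 1))
          ltac:(lra)) as [_ B].
        assert (G : gaussian (h * (INR N + 1)) <= f N).
        { rewrite E; unfold f, qe; apply exp_le_compat; nra. }
        nra. }
    apply Rle_plus_epsilon; intros eps Heps.
    destruct (HJ' eps Heps) as [A0 [HA0 HA]].
    destruct (nfloor_ex (A0 / h)) as [N HN]; [apply Rdiv_le_0_compat; lra|].
    specialize (HA (h * (INR N + 1))).
    assert (A0 <= h * (INR N + 1)).
    { apply Rmult_le_reg_r with (/ h); [apply Rinv_0_lt_compat; lra|].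
      replace (h * (INR N + 1) * / h) with (INR N + 1) by (field; lra).
      unfold Rdiv in HN; lra. }
    specialize (HA H); specialize (B N).
    assert (rsum f N <= T).
    { apply rsum_le_series; [|exact HS]; intros; left; apply exp_pos. }
    nra.
  - rewrite Hsig.
    replace (exp (t / 8) * (gauss_sigma * J + gauss_sigma * h)) with (gauss_sigma * (exp (t / 8) * (J + h))) by ring.
    rewrite Rmult_assoc; apply Rmult_le_compat_l; [lra|].
    assert (B : forall N, h * rsum f (1 + N) <= exp (t / 8) * (h + gauss_int (h * INR N))).
    { assert (Fb : forall N, f N <= exp (t / 8) * gaussian (h * INR N)).
      { intros N; rewrite E; unfold f, qe; rewrite <- exp_plus; apply exp_le_compat.
        pose proof (pos_INR N); nra. }
      pose proof (exp_pos (t / 8)) as He.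
      induction N as [|N IH].
      - simpl rsum; specialize (Fb O); simpl (INR 0) in *; rewrite Rmult_0_r in *.
        pose proof (gaussian_bounds 0).
        unfold gauss_int; rewrite RInt_point; unfold zero; simpl.
        assert (f O <= exp (t / 8)) by nra. nra.
      - replace (1 + S N)%nat with (S (1 + N)) by lia.
        rewrite (gauss_int_Chasles (h * INR N)); cbn [rsum].
        pose proof (pos_INR N); specialize (Fb (S N)); change (1 + N)%nat with (S N) in *.
        rewrite S_INR in *.
        assert (Hle : 0 <= h * INR N) by (apply Rmult_le_pos; lra).
        pose proof (RInt_gaussian_bounds (h * INR N) (h * (INR N + 1)) ltac:(lra)) as [B _].
        replace (h * (INR N + 1) - h * INR N) with h in B by ring.
        assert (h * f (S N) <= exp (t / 8) * (h * gaussian (h * (INR N + 1)))) by nra.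
        nra. }
    assert (L : is_lim_seq (fun N => h * rsum f (1 + N)) (h * T)).
    { apply (is_lim_seq_scal_l _ h (Finite T)).
      apply (is_lim_seq_incr_1 (rsum f)), is_series_rsum, HS. }
    apply (is_lim_seq_le_const_l _ _ _ L); intros N.
    eapply Rle_trans; [apply B|]; apply Rmult_le_compat_l; [left; apply exp_pos|].
    pose proof (HJ (h * INR N) ltac:(apply Rmult_le_pos; [lra|apply pos_INR])); lra.
Qed.

(** * The constant in the asymptotics of P *)

Definition right_lim0 (f : R -> R) (l : R) : Prop :=
  forall eps, 0 < eps -> exists t0, 0 < t0 /\ forall t, 0 < t < t0 -> Rabs (f t - l) < eps.

(** The quantity whose limit is the logarithm of the constant c in P(e^(-t)) ~ c sqrt t exp (pi^2 /
    (6 t)). *)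
Definition log_partition_defect (t : R) : R :=
  log_partition_inf t - PI ^ 2 / (6 * t) - ln t / 2.

(** Gauss's identity involves ln P(t) - 2 ln P(2t), in which the poles pi^2 / (6 t) cancel. The
    logarithmic terms leave ln 2 + ln (sqrt t), and sqrt t times the triangular series tends to
    [gauss_sigma] * J. *)
Lemma log_partition_defect_doubling (J : R) :
  0 < J -> (forall A, 0 <= A -> gauss_int A <= J) ->
  (forall eps, 0 < eps -> exists A0, 0 <= A0 /\ forall A, A0 <= A -> J - eps < gauss_int A) ->
  right_lim0 (fun t => 2 * log_partition_defect (2 * t) - log_partition_defect t)
    (- ln (2 * (gauss_sigma * J))).
Proof.
  intros J0 HJ HJ'; pose proof gauss_sigma_pos as Hs.
  assert (HsJ : 0 < gauss_sigma * J) by (apply Rmult_lt_0_compat; assumption).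
  set (S := fun t => exp (log_partition_inf t - 2 * log_partition_inf (2 * t))).
  assert (E : forall t, 0 < t -> 2 * log_partition_defect (2 * t) - log_partition_defect t
                                 = - ln 2 - ln (sqrt t * S t)).
  { intros t Ht; pose proof (sqrt_lt_R0 t Ht).
    rewrite ln_mult by (try apply exp_pos; lra); unfold S; rewrite ln_exp.
    replace (ln (sqrt t)) with (ln t / 2).
    - unfold log_partition_defect; rewrite ln_mult by lra; field; lra.
    - rewrite <- (sqrt_sqrt t) at 1 by lra; rewrite ln_mult by lra; field. }

  set (lo := fun t => gauss_sigma * J - sqrt t).
  set (hi := fun t => exp (t / 8) * (gauss_sigma * J + sqrt t)).
  (* Composing with [Rabs] makes the bounds two-sided, so that their limits from the right follow
     from continuity at 0. *)
  assert (Clo : continuity_pt (fun t => ln (lo (Rabs t))) 0).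
  { unfold lo; apply continuity_pt_filterlim.
    apply (continuous_comp (fun t => gauss_sigma * J - sqrt (Rabs t)) ln).
    - apply (continuous_minus (V := R_NormedModule)); [apply continuous_const|].
      apply (continuous_comp Rabs sqrt); [apply continuous_Rabs|apply continuous_sqrt].
    - rewrite Rabs_R0, sqrt_0, Rminus_0_r; apply continuous_ln, HsJ. }
  assert (Chi : continuity_pt (fun t => ln (hi (Rabs t))) 0).
  { unfold hi; apply continuity_pt_filterlim.
    apply (continuous_comp (fun t => exp (Rabs t / 8) * (gauss_sigma * J + sqrt (Rabs t))) ln).
    - apply (continuous_mult (K := R_AbsRing)).
      + apply (continuous_comp (fun t => Rabs t / 8) exp); [|apply continuous_exp].
        apply (continuous_mult (K := R_AbsRing)); [apply continuous_Rabs|apply continuous_const].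
      + apply (continuous_plus (V := R_NormedModule)); [apply continuous_const|].
        apply (continuous_comp Rabs sqrt); [apply continuous_Rabs|apply continuous_sqrt].
    - rewrite Rabs_R0, sqrt_0, Rplus_0_r; unfold Rdiv; rewrite Rmult_0_l, exp_0, Rmult_1_l.
      apply continuous_ln, HsJ. }
  intros eps Heps.
  destruct (Clo eps Heps) as [d1 [Hd1 D1]]; destruct (Chi eps Heps) as [d2 [Hd2 D2]].
  (* The last bound keeps sqrt t below [gauss_sigma * J], so that [lo t] is positive and its
     logarithm meaningful. *)
  exists (Rmin (Rmin d1 d2) ((gauss_sigma * J) ^ 2)).
  split; [repeat apply Rmin_pos; try assumption; apply pow_lt, HsJ|].
  intros t [Ht Ht'].
  pose proof (Rmin_l (Rmin d1 d2) ((gauss_sigma * J) ^ 2)).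
  pose proof (Rmin_r (Rmin d1 d2) ((gauss_sigma * J) ^ 2)).
  pose proof (Rmin_l d1 d2); pose proof (Rmin_r d1 d2).
  assert (Dt : forall d, t < d -> D_x no_cond 0 t /\ R_dist t 0 < d).
  { intros d Hd; unfold D_x, no_cond, R_dist; rewrite Rminus_0_r, Rabs_pos_eq by lra.
    repeat split; lra. }
  specialize (D1 t (Dt d1 ltac:(lra))); specialize (D2 t (Dt d2 ltac:(lra))).
  simpl in D1, D2; unfold R_dist in D1, D2.
  rewrite (Rabs_pos_eq t), Rabs_R0 in D1, D2 by lra.
  assert (Lo0 : lo 0 = gauss_sigma * J) by (unfold lo; rewrite sqrt_0; ring).
  assert (Hi0 : hi 0 = gauss_sigma * J)
    by (unfold hi; rewrite sqrt_0; unfold Rdiv; rewrite Rmult_0_l, exp_0; ring).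
  rewrite Lo0 in D1; rewrite Hi0 in D2.
  destruct (triangular_sum_bounds t J (S t) Ht HJ HJ' (gauss_triangular t Ht)) as [B1 B2].
  fold (lo t) in B1; fold (hi t) in B2.
  assert (Lp : 0 < lo t).
  { unfold lo; assert (sqrt t < gauss_sigma * J); [|lra].
    rewrite <- (sqrt_pow2 (gauss_sigma * J)) by lra; apply sqrt_lt_1; lra. }
  assert (ln (lo t) <= ln (sqrt t * S t)) by (apply ln_le; lra).
  assert (ln (sqrt t * S t) <= ln (hi t)) by (apply ln_le; lra).
  rewrite E, (ln_mult 2) by lra; apply Rabs_lt_between in D1, D2; apply Rabs_lt_between; lra.
Qed.

(* The doubling relation determines the limit: it halves the distance to the limit
   each time [t] is doubled, while the defect is only [o(1/t)]. *)
Lemma log_partition_defect_lim (J : R) :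
  0 < J -> (forall A, 0 <= A -> gauss_int A <= J) ->
  (forall eps, 0 < eps -> exists A0, 0 <= A0 /\ forall A, A0 <= A -> J - eps < gauss_int A) ->
  right_lim0 log_partition_defect (- ln (2 * (gauss_sigma * J))).
Proof.
  intros J0 HJ HJ' eps Heps; set (c := - ln (2 * (gauss_sigma * J))).
  destruct (log_partition_defect_doubling J J0 HJ HJ' (eps / 2) ltac:(lra)) as [t0 [Ht0 D]].
  fold c in D; exists t0; split; [exact Ht0|]; intros t Ht.
  set (s := fun k => t * (/ 2) ^ k).
  assert (Hs : forall k, 0 < s k <= t).
  { intros k; unfold s; pose proof (pow_lt (/ 2) k ltac:(lra)).
    pose proof (pow_incr (/ 2) 1 k ltac:(lra)) as H1; rewrite pow1 in H1.
    split; [apply Rmult_lt_0_compat; lra|nra]. }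
  (* With x and y the defects at [s k] and [s (S k)], x - c = (y - c) / 2 + (2 x - y - c) / 2;
     iterating sums a geometric series of errors with total at most eps / 2. *)
  assert (I : forall k, Rabs (log_partition_defect t - c)
     <= (/ 2) ^ k * Rabs (log_partition_defect (s k) - c) + eps / 2 * (1 - (/ 2) ^ k)).
  { induction k as [|k IH].
    - unfold s; simpl; rewrite !Rmult_1_r, Rmult_1_l; lra.
    - specialize (D (s (S k)) ltac:(pose proof (Hs (S k)); lra)).
      assert (E : 2 * s (S k) = s k) by (unfold s; simpl; field).
      rewrite E in D; set (x := log_partition_defect (s k)) in *.
      set (y := log_partition_defect (s (S k))) in *.
      assert (Hx : Rabs (x - c) <= / 2 * Rabs (y - c) + eps / 4).
      { replace (x - c) with (/ 2 * (y - c) + / 2 * (2 * x - y - c)) by field.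
        eapply Rle_trans; [apply Rabs_triang|]; rewrite !Rabs_mult, (Rabs_pos_eq (/ 2)) by lra.
        lra. }
      pose proof (pow_lt (/ 2) k ltac:(lra)) as Hk.
      eapply Rle_trans; [exact IH|]; simpl; nra. }
  (* Since 2^(-k) = s_k / t, this says that s times the defect at s tends to 0. It follows from s ln
     P(e^(-s)) tending to zeta(2) and s ln s tending to 0. *)
  assert (Z : is_lim_seq (fun k => (/ 2) ^ k * Rabs (log_partition_defect (s k) - c)) 0).
  { assert (L : is_lim_seq (fun k => s k * log_partition_inf (s k)) (PI ^ 2 / 6)).
    { apply is_lim_seq_spec; intros e.
      pose proof zeta2 as Z2; apply is_lim_seq_spec in Z2.
      destruct (Z2 (pos_div_2 e)) as [M HM]; specialize (HM M (le_n M)); simpl in HM.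
      apply Rabs_lt_between in HM.
      assert (Hs0 : is_lim_seq (fun k => INR M * s k) 0).
      { replace (Finite 0) with (Finite (INR M * (t * 0))) by (f_equal; ring).
        apply (is_lim_seq_scal_l _ (INR M) (Finite _)), (is_lim_seq_scal_l _ t (Finite 0)).
        apply is_lim_seq_inv_pow2. }
      apply is_lim_seq_spec in Hs0; destruct (Hs0 (pos_div_2 e)) as [K HK].
      exists K; intros k Hk; specialize (HK k Hk); simpl in HK.
      rewrite Rminus_0_r in HK; apply Rabs_lt_between in HK.
      destruct (Hs k) as [P0 _].
      destruct (log_partition_inf_upper (s k) P0) as [_ U].
      pose proof (log_partition_inf_lower (s k) M P0) as Lw.
      assert (s k * log_partition_inf (s k) <= PI ^ 2 / 6).
      { apply Rle_trans with (s k * (PI ^ 2 / (6 * s k))).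
        - apply Rmult_le_compat_l; lra.
        - right; field; lra. }
      assert (zsum 2 M - INR M * s k <= s k * log_partition_inf (s k)).
      { apply Rle_trans with (s k * (/ s k * zsum 2 M - INR M)).
        - right; field; lra.
        - apply Rmult_le_compat_l; lra. }
      pose proof (cond_pos e); apply Rabs_lt_between; lra. }
    assert (LL : is_lim_seq (fun k => (/ 2) ^ k * (ln t - INR k * ln 2)) 0).
    { assert (K1 : is_lim_seq (fun k => (/ 2) ^ k * INR k) 0).
      { apply is_lim_seq_le_le with (fun _ => 0) (fun k => 4 * / (INR k + 1)).
        - intros k; pose proof (pos_INR k) as Pk; pose proof (pow_lt (/ 2) k ltac:(lra)).
          split; [apply Rmult_le_pos; lra|].
          assert (Q : (INR k + 1) * INR k <= 4 * 2 ^ k).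
          { clear; induction k as [|k IH]; [simpl; lra|].
            destruct k as [|[|k]]; [simpl; lra|simpl; lra|].
            rewrite S_INR; change (2 ^ S (S (S k))) with (2 * 2 ^ S (S k)).
            set (x := INR (S (S k))) in *.
            assert (2 <= x) by (unfold x; rewrite !S_INR; pose proof (pos_INR k); lra).
            nra. }
          apply Rmult_le_reg_r with ((INR k + 1) * 2 ^ k);
            [apply Rmult_lt_0_compat; [lra|apply pow_lt; lra]|].
          rewrite pow_inv; assert (2 ^ k <> 0) by (apply pow_nonzero; lra).
          field_simplify; lra.
        - apply is_lim_seq_const.
        - replace (Finite 0) with (Finite (4 * 0)) by (f_equal; ring).
          apply (is_lim_seq_scal_l _ 4 (Finite 0)), is_lim_seq_inv_INR. }
      apply is_lim_seq_ext with (fun k => (/ 2) ^ k * ln t - (/ 2) ^ k * INR k * ln 2);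
        [intros; ring|].
      replace (Finite 0) with (Finite (0 * ln t - 0 * ln 2)) by (f_equal; ring).
      apply is_lim_seq_minus'; [apply (is_lim_seq_scal_r _ (ln t) (Finite 0)), is_lim_seq_inv_pow2|].
      apply (is_lim_seq_scal_r _ (ln 2) (Finite 0)), K1. }
    apply is_lim_seq_ext with
      (fun k => Rabs ((s k * log_partition_inf (s k) - PI ^ 2 / 6) * / t
                      - (/ 2) ^ k * (ln t - INR k * ln 2) * / 2 - (/ 2) ^ k * c)).
    - intros k; pose proof (pow_lt (/ 2) k ltac:(lra)) as Hk.
      rewrite <- (Rabs_pos_eq ((/ 2) ^ k)) at 3 by lra; rewrite <- Rabs_mult; f_equal.
      unfold log_partition_defect.
      replace (ln (s k)) with (ln t - INR k * ln 2).
      + unfold s; field; split; lra.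
      + unfold s; rewrite ln_mult by lra; rewrite ln_pow by lra; rewrite ln_Rinv by lra; ring.
    - replace (Finite 0) with (Rbar_abs (Finite ((PI ^ 2 / 6 - PI ^ 2 / 6) * / t - 0 * / 2 - 0 * c))).
      + apply is_lim_seq_abs, is_lim_seq_minus'; [apply is_lim_seq_minus'|].
        * apply (is_lim_seq_scal_r _ (/ t) (Finite _)), is_lim_seq_minus';
            [exact L|apply is_lim_seq_const].
        * apply (is_lim_seq_scal_r _ (/ 2) (Finite 0)), LL.
        * apply (is_lim_seq_scal_r _ c (Finite 0)), is_lim_seq_inv_pow2.
      + cbn [Rbar_abs]; f_equal; rewrite Rminus_diag, !Rmult_0_l, !Rminus_0_r; apply Rabs_R0. }
  apply is_lim_seq_spec in Z; destruct (Z (mkposreal (eps / 4) ltac:(lra))) as [K HK].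
  specialize (HK K (le_n K)); simpl in HK; rewrite Rminus_0_r in HK.
  apply Rabs_lt_between in HK; specialize (I K).
  pose proof (pow_lt (/ 2) K ltac:(lra)); nra.
Qed.

(** * The generating function near the positive real axis *)

Lemma nonneg_of_deriv (f df : R -> R) (a : R) :
  0 <= a -> (forall x, is_derive f x (df x)) -> (forall x, 0 <= x <= a -> 0 <= df x) ->
  f 0 <= f a.
Proof.
  intros Ha Hd Hp; destruct (Req_dec a 0) as [->|Hne]; [lra|].
  destruct (MVT_cor2 f df 0 a) as [c [E Hc]]; [lra| |].
  - intros c _; apply is_derive_Reals, Hd.
  - specialize (Hp c ltac:(lra)); nra.
Qed.

Lemma sin_abs_le (a : R) : Rabs (sin a) <= Rabs a.
Proof.
  assert (P : forall x, 0 <= x -> Rabs (sin x) <= x).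
  { intros x Hx; apply Rabs_le; split.
    - pose proof (nonneg_of_deriv (fun x => sin x + x) (fun x => cos x + 1) x Hx) as H.
      cbv beta in H; rewrite sin_0 in H; assert (0 + 0 <= sin x + x); [|lra].
      apply H; [intros; auto_derive; [trivial|ring]|].
      intros y _; pose proof (COS_bound y); lra.
    - pose proof (nonneg_of_deriv (fun x => x - sin x) (fun x => 1 - cos x) x Hx) as H.
      cbv beta in H; rewrite sin_0 in H; assert (0 - 0 <= x - sin x); [|lra].
      apply H; [intros; auto_derive; [trivial|ring]|].
      intros y _; pose proof (COS_bound y); lra. }
  destruct (Rle_dec 0 a) as [H|H].
  - rewrite (Rabs_pos_eq a) by exact H; apply P, H.
  - rewrite <- (Rabs_Ropp a), <- (Rabs_Ropp (sin a)), <- sin_neg, (Rabs_pos_eq (- a)) by lra.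
    apply P; lra.
Qed.

Lemma one_minus_cos_half (a : R) : 1 - cos a = 2 * (sin (a / 2)) ^ 2.
Proof.
  replace (cos a) with (cos (2 * (a / 2))) by (f_equal; field).
  rewrite cos_2a_sin; ring.
Qed.

Lemma one_minus_cos_bounds (a : R) :
  0 <= 1 - cos a <= a ^ 2 / 2 /\ 1 - cos a <= Rabs a.
Proof.
  pose proof (one_minus_cos_half a) as E.
  pose proof (pow2_ge_0 (sin (a / 2))) as H0.
  assert (H1 : (sin (a / 2)) ^ 2 <= (a / 2) ^ 2)
    by (rewrite <- !Rsqr_pow2; apply Rsqr_le_abs_1, sin_abs_le).
  assert (H2 : 1 - cos a <= a ^ 2 / 2) by (rewrite E; lra).
  split; [rewrite E in *; lra|].
  pose proof (COS_bound a).
  destruct (Rle_dec (Rabs a) 2).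
  - rewrite <- (pow2_abs a) in H2; pose proof (Rabs_pos a); nra.
  - lra.
Qed.

Lemma sin_cubic (a : R) : Rabs (a - sin a) <= Rabs a ^ 3 / 6.
Proof.
  assert (P : forall x, 0 <= x -> 0 <= x - sin x <= x ^ 3 / 6).
  { intros x Hx; split.
    - pose proof (sin_abs_le x) as H; rewrite (Rabs_pos_eq x) in H by exact Hx.
      apply Rabs_le_between in H; lra.
    - pose proof (nonneg_of_deriv (fun x => x ^ 3 / 6 - (x - sin x))
        (fun x => x ^ 2 / 2 - (1 - cos x)) x Hx) as H.
      cbv beta in H; rewrite sin_0 in H; assert (0 ^ 3 / 6 - (0 - 0) <= x ^ 3 / 6 - (x - sin x)); [|lra].
      apply H; [intros; auto_derive; [trivial|field]|].
      intros y _; pose proof (one_minus_cos_bounds y); lra. }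
  destruct (Rle_dec 0 a) as [H|H].
  - rewrite (Rabs_pos_eq a) by exact H; specialize (P a H); rewrite Rabs_pos_eq; lra.
  - specialize (P (- a) ltac:(lra)); rewrite sin_neg in P.
    rewrite <- (Rabs_Ropp a), (Rabs_pos_eq (- a)) by lra.
    rewrite Rabs_left1; lra.
Qed.

(** The error is of fourth order for small [a] and only quadratic for large [a]. The cube dominates
    both, holds for all [a], and fits the third moments of the Lindeberg comparison. *)
Lemma cos_cubic (a : R) : Rabs (cos a - 1 + a ^ 2 / 2) <= Rabs a ^ 3 / 2.
Proof.
  pose proof (one_minus_cos_bounds a) as [H _]; rewrite Rabs_pos_eq by lra.
  rewrite <- (pow2_abs a) in *; pose proof (Rabs_pos a).
  destruct (Rle_dec 1 (Rabs a)).
  - assert (Rabs a ^ 2 <= Rabs a ^ 3) by (apply Rle_pow; [lra|lia]). lra.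
  - assert (E : 1 - cos a = 2 * (sin (Rabs a / 2)) ^ 2).
    { replace (cos a) with (cos (Rabs a))
        by (unfold Rabs; destruct Rcase_abs; [apply cos_neg|reflexivity]).
      apply one_minus_cos_half. }
    set (x := Rabs a) in *.
    pose proof (sin_cubic (x / 2)) as S; rewrite (Rabs_pos_eq (x / 2)) in S by lra.
    apply Rabs_le_between in S.
    assert (x ^ 3 <= x) by nra.
    assert (B : x / 2 - (x / 2) ^ 3 / 6 <= sin (x / 2)) by lra.
    assert (B0 : 0 <= x / 2 - (x / 2) ^ 3 / 6) by (simpl in *; lra).
    assert ((x / 2 - (x / 2) ^ 3 / 6) ^ 2 <= sin (x / 2) ^ 2) by (apply pow_incr; lra).
    assert (x ^ 2 / 2 - x ^ 4 / 24 <= 2 * (x / 2 - (x / 2) ^ 3 / 6) ^ 2).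
    { assert (0 <= x ^ 6) by (apply pow_le; lra). nra. }
    assert (x ^ 4 <= x ^ 3) by (replace (x ^ 4) with (x * x ^ 3) by ring;
      assert (0 <= x ^ 3) by (apply pow_le; lra); nra).
    assert (0 <= x ^ 3) by (apply pow_le; lra).
    lra.
Qed.

Lemma exp_neg_taylor2 (y : R) : 0 <= y -> exp (- y) <= 1 - y + y ^ 2 / 2.
Proof.
  intros Hy.
  pose proof (nonneg_of_deriv (fun x => 1 - x + x ^ 2 / 2 - exp (- x))
    (fun x => exp (- x) - 1 + x) y Hy) as H.
  cbv beta in H; rewrite Ropp_0, exp_0 in H.
  assert (1 - 0 + 0 ^ 2 / 2 - 1 <= 1 - y + y ^ 2 / 2 - exp (- y)); [|lra].
  apply H; [intros; auto_derive; [trivial|field]|].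
  intros x _; pose proof (exp_ge_1_plus (- x)); lra.
Qed.

(** The exponent is written as w^2 / 2 so that this error, too, is a cube valid on the whole
    range. *)
Lemma exp_neg_quadratic (w : R) :
  0 <= w -> 0 <= exp (- (w ^ 2 / 2)) - 1 + w ^ 2 / 2 <= w ^ 3 / 2.
Proof.
  intros Hw; set (y := w ^ 2 / 2).
  assert (Hy : 0 <= y) by (unfold y; pose proof (pow2_ge_0 w); lra).
  pose proof (exp_ge_1_plus (- y)).
  assert (E1 : exp (- y) <= 1) by (rewrite <- exp_0; apply exp_le_compat; lra).
  pose proof (exp_neg_taylor2 y Hy) as E2.
  split; [lra|]; unfold y in *.
  destruct (Rle_dec 1 w).
  - assert (w ^ 2 <= w ^ 3) by (apply Rle_pow; [lra|lia]). lra.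
  - assert (0 <= w ^ 3) by (apply pow_le; lra).
    assert (w ^ 4 <= w ^ 3) by (replace (w ^ 4) with (w * w ^ 3) by ring; nra).
    replace ((w ^ 2 / 2) ^ 2) with (w ^ 4 / 4) in E2 by field. lra.
Qed.

(** * Lindeberg comparison for the partition product *)

Definition cis (x : R) : C := (cos x, sin x).

Lemma cis_add (x y : R) : cis (x + y) = (cis x * cis y)%C.
Proof. unfold cis, Cmult; simpl; rewrite cos_plus, sin_plus; f_equal; ring. Qed.

Lemma Cmod_cis (x : R) : Cmod (cis x) = 1.
Proof.
  unfold Cmod, cis; simpl; rewrite !Rmult_1_r.
  pose proof (sin2_cos2 x) as E; unfold Rsqr in E.
  rewrite Rplus_comm, E; apply sqrt_1.
Qed.

Lemma Cmod_le_sum (z : C) : Cmod z <= Rabs (fst z) + Rabs (snd z).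
Proof.
  unfold Cmod; pose proof (Rabs_pos (fst z)); pose proof (Rabs_pos (snd z)).
  rewrite <- (sqrt_pow2 (Rabs (fst z) + Rabs (snd z))) by lra.
  apply sqrt_le_1_alt; rewrite <- (pow2_abs (fst z)), <- (pow2_abs (snd z)); nra.
Qed.

Lemma Cmod_cis_sub_1 (x : R) : Cmod (cis x - 1)%C <= 2 * Rabs x.
Proof.
  eapply Rle_trans; [apply Cmod_le_sum|]; simpl.
  pose proof (sin_abs_le x); pose proof (one_minus_cos_bounds x) as [[H1 _] H2].
  rewrite Ropp_0, Rplus_0_r.
  replace (cos x + Ropp 1) with (- (1 - cos x)) by ring.
  rewrite Rabs_Ropp, Rabs_pos_eq by exact H1; lra.
Qed.

Lemma qpw_cis (r th : R) (k : nat) : qpw r th k = (RtoC (r ^ k) * cis (INR k * th))%C.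
Proof. unfold qpw, cis, RtoC, Cmult; simpl; f_equal; ring. Qed.

Lemma Cmod_qpw (r th : R) (k : nat) : 0 <= r -> Cmod (qpw r th k) = r ^ k.
Proof.
  intros Hr; rewrite qpw_cis, Cmod_mult, Cmod_cis, Rmult_1_r, Cmod_R.
  apply Rabs_pos_eq, pow_le, Hr.
Qed.

Lemma Cmod_one_minus_ge (z : C) : 1 - Cmod z <= Cmod (1 - z)%C.
Proof.
  pose proof (Cmod_triangle (1 - z)%C z) as H.
  replace (1 - z + z)%C with (RtoC 1) in H by ring.
  rewrite Cmod_1 in H; lra.
Qed.

(* Lindeberg's replacement step for a single part size: its multiplicity is
   geometric under the tilted distribution. *)
Lemma geometric_char_gaussian (p x : R) :
  0 < p < 1 ->
  Cmod (RtoC (1 - p) / (1 - RtoC p * cis x) * cis (- (p / (1 - p) * x))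
        - RtoC (exp (- (p / (1 - p) ^ 2 * x ^ 2 / 2))))%C
  <= 3 * (p / (1 - p) ^ 3) * Rabs x ^ 3.
Proof.
  intros Hp; set (m := p / (1 - p)); set (y := p / (1 - p) ^ 2 * x ^ 2 / 2).
  (* Extracting 1 - p from the denominator leaves [D], whose real part is at least 1; the error may
     therefore be multiplied by [D], which removes the quotient. *)
  set (D := (1 + RtoC m * (1 - cis x))%C).
  assert (Hm : 0 < m) by (apply Rdiv_lt_0_compat; lra).
  assert (ED : (1 - RtoC p * cis x)%C = (RtoC (1 - p) * D)%C).
  { unfold D, m, cis; unfold Cmult, Cminus, Cplus, Copp, RtoC; simpl.
    f_equal; field; lra. }
  assert (HD : 1 <= Cmod D).
  { eapply Rle_trans; [|apply re_le_Cmod]; unfold D, Re; simpl.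
    pose proof (one_minus_cos_bounds x) as [[H _] _].
    rewrite Rabs_pos_eq; nra. }
  assert (D0 : D <> 0) by (intros E; rewrite E, Cmod_0 in HD; lra).
  assert (Ep : RtoC (1 - p) <> 0) by (intros E; injection E; lra).
  assert (E : (RtoC (1 - p) / (1 - RtoC p * cis x) * cis (- (m * x)) - RtoC (exp (- y)))%C
     = ((cis (- (m * x)) - RtoC (exp (- y)) * D) / D)%C).
  { rewrite ED; field; split; assumption. }
  rewrite E, Cmod_div by exact D0.
  apply Rle_trans with (Cmod (cis (- (m * x)) - RtoC (exp (- y)) * D)%C).
  { unfold Rdiv; rewrite <- (Rmult_1_r (Cmod _)) at 2.
    apply Rmult_le_compat_l; [apply Cmod_ge_0|].
    rewrite <- Rinv_1; apply Rinv_le_contravar; lra. }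
  eapply Rle_trans; [apply Cmod_le_sum|].
  (* [B] has the size of the third cumulant p (1 + p) / (1 - p)^3 of the geometric law, and it
     dominates [m], [m ^ 3] and the mixed term in [y] and [m]. *)
  set (B := p / (1 - p) ^ 3); set (X := Rabs x).
  assert (HX : 0 <= X) by apply Rabs_pos.
  assert (HX3 : 0 <= X ^ 3) by (apply pow_le, HX).
  assert (Hi : 0 < / (1 - p)) by (apply Rinv_0_lt_compat; lra).
  assert (Hi1 : 1 < / (1 - p)) by (rewrite <- Rinv_1; apply Rinv_lt_contravar; lra).
  set (g := / (1 - p)) in *.
  assert (Bg : B = p * g ^ 3) by (unfold B, g; field; lra).
  assert (mg : m = p * g) by reflexivity.
  assert (Hg2 : 1 <= g ^ 2) by nra.
  assert (mB : m <= B) by (rewrite mg, Bg; assert (0 < p * g) by (apply Rmult_lt_0_compat; lra); nra).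
  assert (m3B : m ^ 3 <= B).
  { rewrite mg, Bg, Rpow_mult_distr; apply Rmult_le_compat_r; [apply pow_le; lra|].
    assert (p ^ 2 <= 1) by nra; simpl; nra. }
  assert (Hx2 : x ^ 2 = X ^ 2) by (unfold X; symmetry; apply pow2_abs).
  assert (yE : y = p * g ^ 2 * X ^ 2 / 2) by (unfold y, g; rewrite Hx2; field; lra).
  assert (Hy0 : 0 <= y).
  { rewrite yE; assert (0 <= p * g ^ 2 * X ^ 2); [|lra].
    apply Rmult_le_pos; [apply Rmult_le_pos; [lra|apply pow2_ge_0]|apply pow2_ge_0]. }
  assert (ymB : y * m * X <= B / 2 * X ^ 3).
  { rewrite yE, mg, Bg.
    replace (p * g ^ 2 * X ^ 2 / 2 * (p * g) * X) with (p * (p * g ^ 3 / 2 * X ^ 3)) by field.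
    assert (0 <= p * g ^ 3 / 2 * X ^ 3).
    { apply Rmult_le_pos; [|exact HX3].
      assert (0 <= p * g ^ 3) by (apply Rmult_le_pos; [lra|apply pow_le; lra]). lra. }
    replace (p * g ^ 3 / 2 * X ^ 3) with (1 * (p * g ^ 3 / 2 * X ^ 3)) at 2 by ring.
    apply Rmult_le_compat_r; lra. }
  assert (Q : 0 <= exp (- y) - 1 + y <= B / 2 * X ^ 3).
  (* The square root makes y = (s g X)^2 / 2, as the cubic bound requires; the surplus factor s <= 1
     is dropped. *)
  { set (s := sqrt p); assert (Hs : 0 <= s) by apply sqrt_pos.
    assert (s2 : s ^ 2 = p) by (apply pow2_sqrt; lra).
    assert (s1 : s <= 1) by (rewrite <- sqrt_1; apply sqrt_le_1_alt; lra).
    pose proof (exp_neg_quadratic (s * g * X)) as H.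
    replace ((s * g * X) ^ 2 / 2) with y in H by (rewrite yE, <- s2; field).
    specialize (H ltac:(apply Rmult_le_pos; [apply Rmult_le_pos; lra|lra])).
    split; [lra|]; eapply Rle_trans; [apply H|].
    rewrite Bg, <- s2.
    replace ((s * g * X) ^ 3 / 2) with (s * (s ^ 2 * g ^ 3 / 2 * X ^ 3)) by field.
    assert (0 <= s ^ 2 * g ^ 3 / 2 * X ^ 3).
    { apply Rmult_le_pos; [|exact HX3].
      assert (0 <= s ^ 2 * g ^ 3) by (apply Rmult_le_pos; [apply pow2_ge_0|apply pow_le; lra]). lra. }
    replace (s ^ 2 * g ^ 3 / 2 * X ^ 3) with (1 * (s ^ 2 * g ^ 3 / 2 * X ^ 3)) at 2 by ring.
    apply Rmult_le_compat_r; lra. }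
  pose proof (exp_ge_1_plus (- y)) as Ey.
  assert (Ey1 : exp (- y) <= 1) by (rewrite <- exp_0; apply exp_le_compat; lra).
  pose proof (cos_cubic (m * x)) as C1; pose proof (sin_cubic (m * x)) as S1.
  rewrite Rabs_mult, (Rabs_pos_eq m), Rpow_mult_distr in C1, S1 by lra.
  pose proof (cos_cubic x) as C2; pose proof (sin_cubic x) as S2.
  fold X in C1, S1, C2, S2.
  assert (m3X : m ^ 3 * X ^ 3 <= B * X ^ 3) by (apply Rmult_le_compat_r; assumption).
  assert (mX : m * X ^ 3 <= B * X ^ 3) by (apply Rmult_le_compat_r; assumption).
  (* The quadratic terms cancel because the variance p / (1 - p)^2 equals m + m^2; every remaining
     group is cubic. *)
  assert (R1 : Rabs (cos (m * x) - exp (- y) * (1 + m * (1 - cos x))) <= 2 * B * X ^ 3).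
  { replace (cos (m * x) - exp (- y) * (1 + m * (1 - cos x))) with
      ((cos (m * x) - 1 + (m * x) ^ 2 / 2) + - (exp (- y) - 1 + y)
       + (1 - exp (- y)) * (m * (1 - cos x)) + m * (cos x - 1 + x ^ 2 / 2)).
    2:{ replace y with ((m + m ^ 2) * x ^ 2 / 2) at 2
          by (unfold y, m; field; lra). field. }
    pose proof (one_minus_cos_bounds x) as [[H1 _] H2]; fold X in H2.
    assert (T3 : 0 <= (1 - exp (- y)) * (m * (1 - cos x)) <= B / 2 * X ^ 3).
    { split; [apply Rmult_le_pos; [lra|apply Rmult_le_pos; lra]|].
      eapply Rle_trans; [|exact ymB]; rewrite Rmult_assoc.
      apply Rmult_le_compat; [lra|apply Rmult_le_pos; lra|lra|].
      apply Rmult_le_compat_l; lra. }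
    assert (T4 : Rabs (m * (cos x - 1 + x ^ 2 / 2)) <= B / 2 * X ^ 3).
    { rewrite Rabs_mult, (Rabs_pos_eq m) by lra.
      apply Rle_trans with (m * (X ^ 3 / 2)); [apply Rmult_le_compat_l; lra|lra]. }
    apply Rabs_le_between in C1, T4; apply Rabs_le; lra. }
  assert (R2 : Rabs (- sin (m * x) + exp (- y) * (m * sin x)) <= B * X ^ 3).
  { replace (- sin (m * x) + exp (- y) * (m * sin x)) with
      ((m * x - sin (m * x)) + - (m * (x - sin x)) + - ((1 - exp (- y)) * (m * sin x))) by ring.
    pose proof (sin_abs_le x) as H2; fold X in H2.
    assert (T3 : Rabs ((1 - exp (- y)) * (m * sin x)) <= B / 2 * X ^ 3).
    { rewrite !Rabs_mult, (Rabs_pos_eq m), (Rabs_pos_eq (1 - exp (- y))) by lra.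
      eapply Rle_trans; [|exact ymB]; rewrite Rmult_assoc.
      pose proof (Rabs_pos (sin x)).
      apply Rmult_le_compat; [lra|apply Rmult_le_pos; lra|lra|].
      apply Rmult_le_compat_l; lra. }
    assert (T4 : Rabs (m * (x - sin x)) <= B / 6 * X ^ 3).
    { rewrite Rabs_mult, (Rabs_pos_eq m) by lra.
      apply Rle_trans with (m * (X ^ 3 / 6)); [apply Rmult_le_compat_l; lra|lra]. }
    apply Rabs_le_between in S1, T3, T4; apply Rabs_le; lra. }
  assert (F : fst (cis (- (m * x)) - RtoC (exp (- y)) * D)%C
              = cos (m * x) - exp (- y) * (1 + m * (1 - cos x))).
  { unfold D, cis, RtoC; simpl; rewrite cos_neg; ring. }
  assert (S : snd (cis (- (m * x)) - RtoC (exp (- y)) * D)%C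
              = - sin (m * x) + exp (- y) * (m * sin x)).
  { unfold D, cis, RtoC; simpl; rewrite sin_neg; ring. }
  rewrite F, S; lra.
Qed.

(** Factors are exchanged one at a time; as all lie in the unit disc, the errors of the exchanges
    add up without amplification. *)
Lemma cprod_diff (a b : nat -> C) (n : nat) :
  (forall k, (k < n)%nat -> Cmod (a k) <= 1) ->
  (forall k, (k < n)%nat -> Cmod (b k) <= 1) ->
  Cmod (cprod a n) <= 1 /\ Cmod (cprod b n) <= 1 /\
  Cmod (cprod a n - cprod b n)%C <= rsum (fun k => Cmod (a k - b k)%C) n.
Proof.
  induction n as [|n IH]; intros Ha Hb.
  - simpl; rewrite Cmod_1; repeat split; try lra.
    replace (1 - 1)%C with (RtoC 0) by ring; rewrite Cmod_0; lra.
  - destruct IH as [A [B D]]; [intros; apply Ha; lia|intros; apply Hb; lia|].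
    specialize (Ha n ltac:(lia)); specialize (Hb n ltac:(lia)).
    pose proof (Cmod_ge_0 (a n)); pose proof (Cmod_ge_0 (b n)).
    pose proof (Cmod_ge_0 (cprod a n)); pose proof (Cmod_ge_0 (cprod b n)).
    cbn [cprod rsum]; rewrite !Cmod_mult; repeat split; [nra|nra|].
    replace (cprod a n * a n - cprod b n * b n)%C
      with ((cprod a n - cprod b n) * a n + cprod b n * (a n - b n))%C by ring.
    eapply Rle_trans; [apply Cmod_triangle|]; rewrite !Cmod_mult.
    pose proof (Cmod_ge_0 (cprod a n - cprod b n)%C); pose proof (Cmod_ge_0 (a n - b n)%C).
    nra.
Qed.

Lemma cprod_mult (a b : nat -> C) (n : nat) :
  cprod (fun k => a k * b k)%C n = (cprod a n * cprod b n)%C.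
Proof. induction n as [|n IH]; simpl; [ring|rewrite IH; ring]. Qed.

Lemma cprod_RtoC (f : nat -> R) (n : nat) : cprod (fun k => RtoC (f k)) n = RtoC (rprod f n).
Proof. induction n as [|n IH]; simpl; [reflexivity|rewrite IH, RtoC_mult; reflexivity]. Qed.

Lemma cprod_cis (f : nat -> R) (n : nat) : cprod (fun k => cis (f k)) n = cis (rsum f n).
Proof.
  induction n as [|n IH]; simpl; [unfold cis; rewrite cos_0, sin_0; reflexivity|].
  rewrite IH, cis_add; reflexivity.
Qed.

Lemma rprod_exp (f : nat -> R) (n : nat) : rprod (fun k => exp (f k)) n = exp (rsum f n).
Proof. induction n as [|n IH]; simpl; [symmetry; apply exp_0|rewrite IH, exp_plus; reflexivity]. Qed.

Lemma cprod_ext (a b : nat -> C) (n : nat) :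
  (forall k, (k < n)%nat -> a k = b k) -> cprod a n = cprod b n.
Proof.
  induction n as [|n IH]; intros H; [reflexivity|].
  simpl; rewrite IH by (intros; apply H; lia); rewrite H by lia; reflexivity.
Qed.

Lemma cprod_neq_0 (a : nat -> C) (n : nat) :
  (forall k, (k < n)%nat -> a k <> 0) -> cprod a n <> 0.
Proof.
  induction n as [|n IH]; intros H; simpl; [intros E; injection E; lra|].
  apply Cmult_neq_0; [apply IH; intros; apply H|apply H]; lia.
Qed.

Lemma cprod_div (a b : nat -> C) (n : nat) :
  (forall k, (k < n)%nat -> b k <> 0) ->
  cprod (fun k => a k / b k)%C n = (cprod a n / cprod b n)%C.
Proof.
  induction n as [|n IH]; intros H; simpl; [field; intros E; injection E; lra|].
  rewrite IH by (intros; apply H; lia); field; split; [apply H; lia|].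
  apply cprod_neq_0; intros; apply H; lia.
Qed.

Lemma Cmod_cprod (a : nat -> C) (n : nat) : Cmod (cprod a n) = rprod (fun k => Cmod (a k)) n.
Proof. induction n as [|n IH]; simpl; [apply Cmod_1|rewrite Cmod_mult, IH; reflexivity]. Qed.

Lemma one_minus_qpw_bounds (t th : R) (k : nat) :
  0 < t -> (1 <= k)%nat ->
  0 < 1 - exp (- t) ^ k <= Cmod (1 - qpw (exp (- t)) th k)%C /\ (1 - qpw (exp (- t)) th k)%C <> 0.
Proof.
  intros Ht Hk; pose proof (exp_pos (- t)).
  pose proof (Cmod_one_minus_ge (qpw (exp (- t)) th k)) as H0.
  rewrite Cmod_qpw in H0 by lra.
  assert (H1 : exp (- t) ^ k < 1).
  { rewrite exp_neg_pow; apply exp_neg_lt_1, Rmult_lt_0_compat; [apply lt_0_INR; lia|exact Ht]. }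
  split; [lra|]; intros E; rewrite E, Cmod_0 in H0; lra.
Qed.

(** P(q) / P(|q|) cut at the part [n]: the characteristic function of the size of a random partition
    with parts at most [n], under weights e^(-t size). *)
Definition part_ratio (n : nat) (t th : R) : C :=
  (RtoC (rprod (fun k => (1 - exp (- t) ^ S k)%R) n) /
   cprod (fun k => 1 - qpw (exp (- t)) th (S k)) n)%C.

(** Mean and variance of the multiplicity of the part [S k]. The sums below are the mean and
    variance of the partition size, and the error total of the Lindeberg comparison. *)
Definition geo_mean (t : R) (k : nat) : R := exp (- t) ^ S k / (1 - exp (- t) ^ S k).
Definition geo_var (t : R) (k : nat) : R := exp (- t) ^ S k / (1 - exp (- t) ^ S k) ^ 2.

Definition part_mean (n : nat) (t : R) : R := rsum (fun k => INR (S k) * geo_mean t k) n.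
Definition part_var (n : nat) (t : R) : R := rsum (fun k => INR (S k) ^ 2 * geo_var t k) n.
Definition part_third (n : nat) (t : R) : R :=
  rsum (fun k => INR (S k) ^ 3 * (exp (- t) ^ S k / (1 - exp (- t) ^ S k) ^ 3)) n.

Lemma exp_lipschitz (a b : R) : 0 <= a -> 0 <= b -> Rabs (exp (- a) - exp (- b)) <= Rabs (a - b).
Proof.
  assert (P : forall a b, 0 <= a <= b -> Rabs (exp (- a) - exp (- b)) <= b - a).
  { intros x y H; assert (exp (- y) <= exp (- x)) by (apply exp_le_compat; lra).
    rewrite Rabs_pos_eq by lra.
    replace (exp (- y)) with (exp (- x) * exp (- (y - x)))
      by (rewrite <- exp_plus; f_equal; ring).
    pose proof (exp_ge_1_plus (- (y - x))); pose proof (exp_pos (- x)).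
    assert (exp (- x) <= 1) by (rewrite <- exp_0; apply exp_le_compat; lra).
    nra. }
  intros Ha Hb; destruct (Rle_dec a b).
  - rewrite (Rabs_minus_sym a b), (Rabs_pos_eq (b - a)) by lra; apply P; lra.
  - rewrite Rabs_minus_sym, (Rabs_pos_eq (a - b)) by lra; apply P; lra.
Qed.

Lemma part_ratio_le_1 (n : nat) (t th : R) : 0 < t -> Cmod (part_ratio n t th) <= 1.
Proof.
  intros Ht; unfold part_ratio.
  rewrite <- cprod_RtoC, <- cprod_div
    by (intros; apply one_minus_qpw_bounds; [exact Ht|lia]).
  rewrite Cmod_cprod.
  induction n as [|n IH]; cbn [rprod]; [lra|].
  destruct (one_minus_qpw_bounds t th (S n) Ht ltac:(lia)) as [[B1 B2] B3].
  rewrite Cmod_div by exact B3; rewrite Cmod_R, Rabs_pos_eq by lra.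
  assert (0 <= rprod (fun k => Cmod (RtoC (1 - exp (- t) ^ S k) / (1 - qpw (exp (- t)) th (S k)))) n)
    by (rewrite <- Cmod_cprod; apply Cmod_ge_0).
  assert (0 <= (1 - exp (- t) ^ S n) / Cmod (1 - qpw (exp (- t)) th (S n)) <= 1).
  { split; [apply Rdiv_le_0_compat; lra|].
    apply Rmult_le_reg_r with (Cmod (1 - qpw (exp (- t)) th (S n))); [lra|].
    unfold Rdiv; rewrite Rmult_assoc, Rinv_l; lra. }
  nra.
Qed.

(** Three errors are added: replacing each factor by a Gaussian, centring at [n] instead of the true
    mean, and using the target variance [V] instead of the true one. *)
Lemma part_ratio_center (n : nat) (t th V : R) :
  0 < t -> 0 <= th -> 0 <= V ->
  Cmod (part_ratio n t th * cis (- (INR n * th)) - RtoC (exp (- (V * th ^ 2 / 2))))%C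
  <= 3 * part_third n t * th ^ 3 + 2 * th * Rabs (INR n - part_mean n t)
     + th ^ 2 / 2 * Rabs (part_var n t - V).
Proof.
  intros Ht Hth HV.
  set (a := fun k => (RtoC (1 - exp (- t) ^ S k) / (1 - qpw (exp (- t)) th (S k)) *
                      cis (- (geo_mean t k * (INR (S k) * th))))%C).
  set (b := fun k => RtoC (exp (- (geo_var t k * (INR (S k) * th) ^ 2 / 2)))).
  assert (Hne : forall k, (1 - qpw (exp (- t)) th (S k))%C <> 0)
    by (intros; apply one_minus_qpw_bounds; [exact Ht|lia]).
  assert (Hx : forall k, 0 < exp (- t) ^ S k < 1).
  { intros k; split; [apply pow_lt, exp_pos|].
    destruct (one_minus_qpw_bounds t th (S k) Ht ltac:(lia)) as [[B1 _] _]; lra. }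
  assert (Hv : forall k, 0 <= geo_var t k).
  { intros k; specialize (Hx k); unfold geo_var.
    apply Rdiv_le_0_compat; [lra|apply pow_lt; lra]. }
  assert (Ea : cprod a n = (part_ratio n t th * cis (- (part_mean n t * th)))%C).
  { unfold a; rewrite cprod_mult, cprod_div by (intros; apply Hne).
    rewrite cprod_RtoC, cprod_cis; unfold part_ratio; do 2 f_equal.
    unfold part_mean; rewrite Rmult_comm, Ropp_mult_distr_l, <- rsum_scal.
    apply rsum_ext; intros; ring. }
  assert (Eb : cprod b n = RtoC (exp (- (part_var n t * th ^ 2 / 2)))).
  { unfold b; rewrite cprod_RtoC, rprod_exp; do 2 f_equal; unfold part_var.
    replace (- (rsum (fun k => INR (S k) ^ 2 * geo_var t k) n * th ^ 2 / 2))
      with ((- th ^ 2 / 2) * rsum (fun k => INR (S k) ^ 2 * geo_var t k) n) by field.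
    rewrite <- rsum_scal; apply rsum_ext; intros; field. }
  assert (D : Cmod (cprod a n - cprod b n)%C <= 3 * part_third n t * th ^ 3).
  { eapply Rle_trans; [apply cprod_diff|].
    - intros k _; unfold a; rewrite Cmod_mult, Cmod_cis, Rmult_1_r, Cmod_div by apply Hne.
      destruct (one_minus_qpw_bounds t th (S k) Ht ltac:(lia)) as [[B1 B2] _].
      rewrite Cmod_R, Rabs_pos_eq by lra.
      apply Rmult_le_reg_r with (Cmod (1 - qpw (exp (- t)) th (S k))); [lra|].
      unfold Rdiv; rewrite Rmult_assoc, Rinv_l; lra.
    - intros k _; unfold b; rewrite Cmod_R, Rabs_pos_eq by (left; apply exp_pos).
      rewrite <- exp_0; apply exp_le_compat.
      pose proof (Hv k); pose proof (pow2_ge_0 (INR (S k) * th)); nra.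
    - unfold part_third.
      replace (3 * rsum (fun k => INR (S k) ^ 3 * (exp (- t) ^ S k / (1 - exp (- t) ^ S k) ^ 3)) n * th ^ 3)
        with ((3 * th ^ 3) * rsum (fun k => INR (S k) ^ 3 * (exp (- t) ^ S k / (1 - exp (- t) ^ S k) ^ 3)) n)
        by ring.
      rewrite <- rsum_scal; apply rsum_le; intros k _.
      pose proof (geometric_char_gaussian (exp (- t) ^ S k) (INR (S k) * th) (Hx k)) as G.
      unfold a, b; rewrite qpw_cis; eapply Rle_trans; [exact G|].
      rewrite Rabs_pos_eq by (apply Rmult_le_pos; [apply pos_INR|exact Hth]).
      right; rewrite Rpow_mult_distr; field; specialize (Hx k); lra. }
  assert (Vn : 0 <= part_var n t).
  { apply rsum_nonneg; intros; apply Rmult_le_pos; [apply pow2_ge_0|apply Hv]. }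
  replace (part_ratio n t th * cis (- (INR n * th)) - RtoC (exp (- (V * th ^ 2 / 2))))%C with
    ((cprod a n - cprod b n) + (cprod a n * (cis (- ((INR n - part_mean n t) * th)) - 1)
      + RtoC (exp (- (part_var n t * th ^ 2 / 2)) - exp (- (V * th ^ 2 / 2)))))%C.
  2:{ rewrite Ea, Eb, RtoC_minus.
      replace (- (INR n * th)) with (- (part_mean n t * th) + - ((INR n - part_mean n t) * th)) by ring.
      rewrite cis_add; ring. }
  eapply Rle_trans; [apply Cmod_triangle|].
  rewrite Rplus_assoc; apply Rplus_le_compat; [exact D|].
  eapply Rle_trans; [apply Cmod_triangle|]; apply Rplus_le_compat.
  - rewrite Cmod_mult, Ea, Cmod_mult, Cmod_cis, Rmult_1_r.
    apply Rle_trans with (1 * (2 * Rabs (- ((INR n - part_mean n t) * th)))).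
    + apply Rmult_le_compat; try apply Cmod_ge_0; [apply part_ratio_le_1, Ht|apply Cmod_cis_sub_1].
    + rewrite Rabs_Ropp, Rabs_mult, (Rabs_pos_eq th) by exact Hth; right; ring.
  - rewrite Cmod_R; pose proof (pow2_ge_0 th).
    eapply Rle_trans; [apply exp_lipschitz; nra|].
    replace (part_var n t * th ^ 2 / 2 - V * th ^ 2 / 2) with (th ^ 2 / 2 * (part_var n t - V)) by field.
    rewrite Rabs_mult, (Rabs_pos_eq (th ^ 2 / 2)) by lra; lra.
Qed.

(** * Moments of the partition distribution *)

Lemma exp_neg_le_inv (x : R) : 0 <= x -> exp (- x) <= / (1 + x).
Proof.
  intros Hx; rewrite exp_Ropp; apply Rinv_le_contravar; [lra|apply exp_ge_1_plus].
Qed.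

Lemma exp_neg_le_pow4 (x : R) : 0 < x -> exp (- x) <= 256 / x ^ 4.
Proof.
  intros Hx; assert (E : exp (- x) = exp (- (x / 4)) ^ 4)
    by (rewrite exp_neg_pow; f_equal; simpl; field).
  rewrite E; pose proof (exp_neg_le_inv (x / 4) ltac:(lra)) as H.
  assert (H2 : / (1 + x / 4) <= / (x / 4)) by (apply Rinv_le_contravar; lra).
  replace (256 / x ^ 4) with ((/ (x / 4)) ^ 4) by (field; lra).
  apply pow_incr; pose proof (exp_pos (- (x / 4))); lra.
Qed.

Lemma exp_neg_pow_S (t : R) (k : nat) : exp (- t) ^ S k = exp (- ((INR k + 1) * t)).
Proof. rewrite exp_neg_pow, S_INR; reflexivity. Qed.

Lemma ratio_le_1_plus (x : R) : 0 < x -> x / (1 - exp (- x)) <= 1 + x.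
Proof.
  intros Hx; pose proof (exp_neg_le_inv x ltac:(lra)) as H.
  pose proof (exp_neg_lt_1 x Hx).
  assert (E : x / (1 + x) <= 1 - exp (- x)).
  { replace (x / (1 + x)) with (1 - / (1 + x)) by (field; lra). lra. }
  apply Rmult_le_reg_r with (1 - exp (- x)); [lra|].
  unfold Rdiv; rewrite Rmult_assoc, Rinv_l, Rmult_1_r by lra.
  apply Rle_trans with ((1 + x) * (x / (1 + x))); [right; field; lra|].
  apply Rmult_le_compat_l; lra.
Qed.

(** With x = (k + 1) t, (x / (1 - e^(-x)))^3 <= (1 + x)^3 <= 216 e^(x/2) leaves a geometric series
    in e^(-t/2) of sum at most 2 / t; thus 432 = 2 * 216. *)
Lemma part_third_le (n : nat) (t : R) : 0 < t -> part_third n t <= 432 / t ^ 4.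
Proof.
  intros Ht; unfold part_third; set (y := exp (- (t / 2))).
  assert (Hy : 0 < y < 1) by (apply exp_neg_lt_1; lra).
  apply Rle_trans with (rsum (fun k => (216 / t ^ 3 * y) * y ^ k) n).
  - apply rsum_le; intros k _; rewrite exp_neg_pow_S, S_INR.
    pose proof (INR1_pos k) as Hk; set (x := (INR k + 1) * t).
    assert (Hx : 0 < x) by (apply Rmult_lt_0_compat; lra).
    pose proof (exp_neg_lt_1 x Hx) as Hp.
    assert (E : (INR k + 1) ^ 3 * (exp (- x) / (1 - exp (- x)) ^ 3)
                = / t ^ 3 * ((x / (1 - exp (- x))) ^ 3 * exp (- x)))
      by (unfold x at 3; field; split; lra).
    rewrite E.
    assert (E2 : 216 / t ^ 3 * y * y ^ k = / t ^ 3 * (216 * exp (- (x / 2)))).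
    { unfold y; rewrite exp_neg_pow; unfold Rdiv.
      rewrite !Rmult_assoc, <- exp_plus.
      replace (- (t * / 2) + - (INR k * (t * / 2))) with (- (x * / 2)) by (unfold x; field).
      ring. }
    rewrite E2; apply Rmult_le_compat_l; [left; apply Rinv_0_lt_compat, pow_lt; lra|].
    assert (B : (x / (1 - exp (- x))) ^ 3 <= (1 + x) ^ 3).
    { apply pow_incr; split; [apply Rdiv_le_0_compat; lra|apply ratio_le_1_plus, Hx]. }
    assert (B2 : (1 + x) ^ 3 <= 216 * exp (x / 2)).
    { replace (216 * exp (x / 2)) with ((6 * exp (x / 6)) ^ 3).
      - apply pow_incr; pose proof (exp_ge_1_plus (x / 6)); lra.
      - replace (x / 2) with (x / 6 + x / 6 + x / 6) by field; rewrite !exp_plus; ring. }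
    apply Rle_trans with (216 * exp (x / 2) * exp (- x)); [apply Rmult_le_compat_r; lra|].
    rewrite Rmult_assoc, <- exp_plus; right; do 2 f_equal; field.
  - rewrite rsum_scal.
    assert (S : rsum (fun k => y ^ k) n <= / (1 - y)).
    { apply Rmult_le_reg_l with (1 - y); [lra|]; rewrite rsum_geom, Rinv_r by lra.
      pose proof (pow_le y n ltac:(lra)); lra. }
    assert (Y : y * / (1 - y) <= 2 / t).
    { destruct (inv_exp_minus_1_bounds (t / 2)) as [[_ B] _]; [lra|].
      replace (y * / (1 - y)) with (/ (exp (t / 2) - 1)).
      - replace (2 / t) with (/ (t / 2)) by (field; lra); exact B.
      - assert (Ey : y = / exp (t / 2)) by (unfold y; apply exp_Ropp).
        pose proof (exp_ge_1_plus (t / 2)) as HE; rewrite Ey.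
        set (E := exp (t / 2)) in *; field; lra. }
    assert (H3 : 0 < 216 / t ^ 3) by (apply Rdiv_lt_0_compat; [lra|apply pow_lt; lra]).
    apply Rle_trans with (216 / t ^ 3 * (y * / (1 - y))).
    + rewrite Rmult_assoc; apply Rmult_le_compat_l; [lra|].
      apply Rmult_le_compat_l; [lra|exact S].
    + apply Rle_trans with (216 / t ^ 3 * (2 / t)); [apply Rmult_le_compat_l; lra|].
      right; field; lra.
Qed.

(** The function is 1 / (4 sinh^2 (y/2)). The upper bound is sinh (y/2) >= y/2; the lower one is
    tanh (y/2) <= y/2 together with 1 / sinh^2 = coth^2 - 1. *)
Lemma sinh_bounds (y : R) :
  0 < y -> / y ^ 2 - 1 / 4 <= exp (- y) / (1 - exp (- y)) ^ 2 <= / y ^ 2.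
Proof.
  intros Hy; pose proof (exp_neg_lt_1 y Hy) as He; split.
  - assert (H : y * (exp (- y) + 1) >= 2 * (1 - exp (- y))).
    { pose proof (nonneg_of_deriv (fun y => y * (exp (- y) + 1) - 2 * (1 - exp (- y)))
        (fun y => 1 - exp (- y) * (1 + y)) y ltac:(lra)) as H.
      cbv beta in H; rewrite Ropp_0, exp_0 in H.
      assert (0 * (1 + 1) - 2 * (1 - 1) <= y * (exp (- y) + 1) - 2 * (1 - exp (- y))); [|lra].
      apply H; [intros; auto_derive; [trivial|ring]|].
      intros x Hx; pose proof (exp_neg_le_inv x ltac:(lra)) as B.
      apply (Rmult_le_compat_r (1 + x)) in B; [|lra]; rewrite Rinv_l in B; lra. }
    set (x := exp (- y)) in *.
    assert (Hz : / y <= (1 + x) / (2 * (1 - x))).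
    { apply Rmult_le_reg_r with (y * (2 * (1 - x))); [apply Rmult_lt_0_compat; lra|].
      field_simplify; lra. }
    assert (Hy' : 0 < / y) by (apply Rinv_0_lt_compat; lra).
    replace (x / (1 - x) ^ 2) with (((1 + x) / (2 * (1 - x))) ^ 2 - 1 / 4) by (field; lra).
    rewrite <- pow_inv; apply Rplus_le_compat_r, pow_incr; lra.
  - assert (H : y * exp (- (y / 2)) <= 1 - exp (- y)).
    { pose proof (nonneg_of_deriv (fun y => 1 - exp (- y) - y * exp (- (y / 2)))
        (fun y => exp (- (y / 2)) * (exp (- (y / 2)) - 1 + y / 2)) y ltac:(lra)) as H.
      cbv beta in H; replace (- (0 / 2)) with 0 in H by field; rewrite Ropp_0, exp_0 in H.
      assert (1 - 1 - 0 * 1 <= 1 - exp (- y) - y * exp (- (y / 2))); [|lra].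
      apply H.
      - intros x; auto_derive; [trivial|].
        unfold Rdiv; replace (exp (- x)) with (exp (- (x * / 2)) * exp (- (x * / 2)))
          by (rewrite <- exp_plus; f_equal; field).
        field.
      - intros x Hx; pose proof (exp_ge_1_plus (- (x / 2))).
        apply Rmult_le_pos; [left; apply exp_pos|lra]. }
    assert (E : exp (- y) = exp (- (y / 2)) ^ 2)
      by (rewrite exp_neg_pow; f_equal; simpl; field).
    pose proof (exp_pos (- (y / 2))) as Hp.
    apply Rmult_le_reg_r with (y ^ 2 * (1 - exp (- y)) ^ 2);
      [apply Rmult_lt_0_compat; apply pow_lt; lra|].
    replace (exp (- y) / (1 - exp (- y)) ^ 2 * (y ^ 2 * (1 - exp (- y)) ^ 2))
      with ((y * exp (- (y / 2))) ^ 2) by (rewrite Rpow_mult_distr, <- E; field; lra).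
    replace (/ y ^ 2 * (y ^ 2 * (1 - exp (- y)) ^ 2)) with ((1 - exp (- y)) ^ 2) by (field; lra).
    apply pow_incr; split; [apply Rmult_le_pos; lra|exact H].
Qed.

Lemma rsum_arith_geom (x : R) (n : nat) :
  (1 - x) ^ 2 * rsum (fun k => (INR k + 1) * x ^ S k) n
  = x * (1 - (INR n + 1) * x ^ n + INR n * x ^ S n).
Proof.
  induction n as [|n IH]; [simpl; ring|].
  cbn [rsum]; rewrite Rmult_plus_distr_l, IH, !S_INR; simpl; ring.
Qed.

(** Expanding each p / (1 - p) and summing over the parts first leaves sums of m x^m with a closed
    form, which makes zeta(2) / t^2 visible. *)
Lemma part_mean_series (n : nat) (t : R) :
  0 < t ->
  is_series (fun j => rsum (fun k => (INR k + 1) * exp (- ((INR j + 1) * t)) ^ S k) n)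
    (part_mean n t).
Proof.
  intros Ht; apply is_series_rsum_fam; intros k _.
  pose proof (INR1_pos k) as Hk; set (p := exp (- t) ^ S k).
  assert (Hp : 0 < p < 1)
    by (unfold p; rewrite exp_neg_pow_S; apply exp_neg_lt_1, Rmult_lt_0_compat; lra).
  assert (G : is_series (fun j => p ^ j) (/ (1 - p)))
    by (apply is_series_geom; rewrite Rabs_pos_eq; lra).
  apply (is_series_scal ((INR k + 1) * p)) in G.
  eapply is_series_eq; [| |exact G].
  - intros j; change ((INR k + 1) * p * p ^ j = (INR k + 1) * exp (- ((INR j + 1) * t)) ^ S k).
    unfold p; rewrite <- exp_neg_pow_S, <- !pow_mult, Rmult_assoc, <- pow_add.
    do 2 f_equal; lia.
  - change ((INR k + 1) * p * / (1 - p) = INR (S k) * geo_mean t k).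
    unfold geo_mean; fold p; rewrite S_INR; unfold Rdiv; ring.
Qed.

Lemma zsum2_lower (J : nat) : (1 <= J)%nat -> PI ^ 2 / 6 - / INR J <= zsum 2 J.
Proof.
  intros HJ; pose proof zeta2 as Z; apply (is_lim_seq_incr_n _ J) in Z.
  assert (PI ^ 2 / 6 <= zsum 2 J + / INR J); [|lra].
  apply (is_lim_seq_le_const_l _ _ _ Z); intros m.
  unfold zsum; rewrite Nat.add_comm, rsum_add.
  pose proof (rsum_inv_sq_tail J m HJ); lra.
Qed.

Lemma zeta2_le : PI ^ 2 / 6 <= 2.
Proof. apply (is_lim_seq_le_const_l _ _ _ zeta2), zsum2_le. Qed.

Lemma ceil_inv (t : R) : 0 < t -> exists K, (1 <= K)%nat /\ / t <= INR K <= / t + 1.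
Proof.
  intros Ht; pose proof (Rinv_0_lt_compat t Ht).
  destruct (nfloor_ex (/ t)) as [N HN]; [lra|].
  exists (S N); rewrite S_INR; split; [lia|lra].
Qed.

(** For full sums over the parts, the j-th term would be 1 / (4 sinh^2 (j s / 2)). The range for n
    s^2 leaves room to vary [s] around the saddle point with [n] fixed, as the variance estimate
    requires. *)
Lemma part_mean_bounds (n : nat) (s : R) :
  0 < s <= 1 -> 1 / 2 <= INR n * s ^ 2 <= 4 ->
  PI ^ 2 / (6 * s ^ 2) - 50000 / s <= part_mean n s <= PI ^ 2 / (6 * s ^ 2).
Proof.
  intros Hs Hn; pose proof (part_mean_series n s ltac:(lra)) as S.
  assert (T : forall j, let y := (INR j + 1) * s in
     / y ^ 2 - 1 / 4 - 20480 * / (INR j + 1) ^ 2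
     <= rsum (fun k => (INR k + 1) * exp (- y) ^ Datatypes.S k) n <= / y ^ 2).
  { intros j y; pose proof (INR1_pos j) as Hj; pose proof (pos_INR j).
    assert (Hy : 0 < y) by (apply Rmult_lt_0_compat; lra).
    assert (Hi : 0 < / y ^ 2) by (apply Rinv_0_lt_compat, pow_lt, Hy).
    pose proof (exp_neg_lt_1 y Hy) as Hx.
    destruct (sinh_bounds y Hy) as [B1 B2].
    pose proof (rsum_arith_geom (exp (- y)) n) as E; set (x := exp (- y)) in *.
    set (F := rsum (fun k => (INR k + 1) * x ^ Datatypes.S k) n) in *.
    assert (E' : F = x / (1 - x) ^ 2 * (1 - (INR n + 1) * x ^ n + INR n * x ^ Datatypes.S n)).
    { apply Rmult_eq_reg_l with ((1 - x) ^ 2); [rewrite E; field; lra|].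
      apply pow_nonzero; lra. }
    set (a := x / (1 - x) ^ 2) in *.
    assert (Ha : 0 <= a) by (apply Rdiv_le_0_compat; [lra|apply pow_lt; lra]).
    pose proof (pow_le x n ltac:(lra)) as Px; pose proof (pos_INR n).
    assert (Px' : x ^ Datatypes.S n <= x ^ n) by (simpl; nra).
    assert (Px0 : 0 <= x ^ Datatypes.S n) by (apply pow_le; lra).
    split.
    (* Cost of cutting at the part [n]: since n s >= 1 / (2 s), the fourth power bound for the
       exponential gives 256 * 16 s^4, and (n + 1) s^2 <= 5. *)
    - assert (W : (INR n + 1) * x ^ n <= 20480 * s ^ 2).
      { assert (Hxn : x ^ n <= exp (- (INR n * s))).
        { unfold x; rewrite exp_neg_pow; apply exp_le_compat, Ropp_le_contravar.
          apply Rmult_le_compat_l; [lra|]; unfold y; nra. }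
        assert (Hns : / (2 * s) <= INR n * s).
        { apply Rmult_le_reg_r with (2 * s); [lra|]; rewrite Rinv_l by lra; simpl in Hn; nra. }
        assert (Hi2 : 0 < / (2 * s)) by (apply Rinv_0_lt_compat; lra).
        assert (Hb : exp (- (INR n * s)) <= 4096 * s ^ 4).
        { apply Rle_trans with (exp (- / (2 * s))); [apply exp_le_compat; lra|].
          eapply Rle_trans; [apply exp_neg_le_pow4; lra|]; right; field; lra. }
        assert (Hn1 : (INR n + 1) * s ^ 2 <= 5) by (assert (s ^ 2 <= 1) by (simpl; nra); lra).
        assert (0 <= s ^ 2) by apply pow2_ge_0.
        apply Rle_trans with ((INR n + 1) * (4096 * s ^ 4)); [apply Rmult_le_compat_l; lra|].
        replace ((INR n + 1) * (4096 * s ^ 4)) with (4096 * s ^ 2 * ((INR n + 1) * s ^ 2)) by ring.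
        apply Rle_trans with (4096 * s ^ 2 * 5); [apply Rmult_le_compat_l; lra|lra]. }
      assert (A2 : a * (20480 * s ^ 2) <= 20480 * / (INR j + 1) ^ 2).
      { apply Rle_trans with (/ y ^ 2 * (20480 * s ^ 2)).
        - apply Rmult_le_compat_r; [pose proof (pow2_ge_0 s); lra|exact B2].
        - right; unfold y; field; lra. }
      rewrite E'; assert (0 <= INR n * x ^ Datatypes.S n) by (apply Rmult_le_pos; lra).
      assert (a * (1 - 20480 * s ^ 2) <= a * (1 - (INR n + 1) * x ^ n + INR n * x ^ Datatypes.S n))
        by (apply Rmult_le_compat_l; lra).
      lra.
    - rewrite E'; apply Rle_trans with (a * 1); [|lra].
      apply Rmult_le_compat_l; [exact Ha|]; nra. }
  split.
  (* About 1/s terms balance the loss of 1/4 per term against the omitted tail of zeta(2), which is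
     at most 1 / (J s^2); both are O(1/s). *)
  - destruct (ceil_inv s ltac:(lra)) as [J [HJ1 HJ]].
    pose proof (zsum2_lower J HJ1) as Z; pose proof (zsum2_le J) as Z2.
    assert (Hs2 : 0 < / s) by (apply Rinv_0_lt_compat; lra).
    assert (Hs1 : 1 <= / s) by (rewrite <- Rinv_1; apply Rinv_le_contravar; lra).
    assert (L : / s ^ 2 * zsum 2 J - INR J * (1 / 4) - 20480 * zsum 2 J <= part_mean n s).
    { eapply Rle_trans; [|apply (rsum_le_series _ _ J) with (2 := S)].
      - unfold zsum; rewrite <- !rsum_scal, <- rsum_const, <- !rsum_minus.
        apply rsum_le; intros j _; destruct (T j) as [B _].
        eapply Rle_trans; [|exact B]; right.
        pose proof (INR1_pos j); rewrite Rpow_mult_distr, Rinv_mult; ring.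
      - intros j; apply rsum_nonneg; intros k _; apply Rmult_le_pos;
          [left; apply INR1_pos|apply pow_le; left; apply exp_pos]. }
    assert (HJs : / INR J <= s).
    { rewrite <- (Rinv_inv s); apply Rinv_le_contravar; lra. }
    assert (/ s ^ 2 * (PI ^ 2 / 6 - s) <= / s ^ 2 * zsum 2 J).
    { apply Rmult_le_compat_l; [left; apply Rinv_0_lt_compat, pow_lt; lra|lra]. }
    replace (PI ^ 2 / (6 * s ^ 2)) with (/ s ^ 2 * (PI ^ 2 / 6 - s) + / s) by (field; lra).
    unfold Rdiv at 1; lra.
  - replace (PI ^ 2 / (6 * s ^ 2)) with (/ s ^ 2 * (PI ^ 2 / 6)) by (field; lra).
    refine (is_series_le _ _ _ _ _ S (is_series_scal (V := R_NormedModule) (/ s ^ 2) _ _ zeta2_series)).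
    intros j; destruct (T j) as [_ B]; eapply Rle_trans; [exact B|]; right.
    change (/ ((INR j + 1) * s) ^ 2 = / s ^ 2 * / (INR j + 1) ^ 2).
    rewrite Rpow_mult_distr, Rinv_mult; ring.
Qed.

(* The summand m/(e^(m t) - 1) of the mean is convex in [t] with derivative minus the
   summand of the variance, so difference quotients of the mean enclose the variance. *)
Lemma part_mean_tangent (n : nat) (t s : R) :
  0 < t -> 0 < s -> part_var n t * (t - s) <= part_mean n s - part_mean n t.
Proof.
  intros Ht Hs; unfold part_var, part_mean.
  rewrite <- rsum_minus, Rmult_comm, <- rsum_scal; apply rsum_le; intros k _.
  unfold geo_var, geo_mean; rewrite !exp_neg_pow_S, S_INR.
  pose proof (INR1_pos k) as Hk; set (m := INR k + 1) in *.
  assert (Hy : 0 < m * t) by (apply Rmult_lt_0_compat; lra).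
  assert (Hz : 0 < m * s) by (apply Rmult_lt_0_compat; lra).
  pose proof (exp_neg_lt_1 _ Hy) as HE; pose proof (exp_neg_lt_1 _ Hz) as HF.
  set (d := m * s - m * t).
  assert (EF : exp (- (m * t)) = exp (- (m * s)) * exp d)
    by (rewrite <- exp_plus; f_equal; unfold d; ring).
  pose proof (exp_ge_1_plus d) as D1; pose proof (exp_ge_1_plus (- d)) as D2.
  rewrite exp_Ropp in D2; pose proof (exp_pos d) as Dp.
  apply (Rmult_le_compat_r (exp d)) in D2; [|lra]; rewrite Rinv_l in D2 by lra.
  replace (t - s) with (- d / m) by (unfold d; field; lra).
  set (y := exp (- (m * t))) in *; set (z := exp (- (m * s))) in *.
  apply Rmult_le_reg_r with ((1 - y) ^ 2 * (1 - z));
    [apply Rmult_lt_0_compat; [apply pow_lt; lra|lra]|].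
  replace (- d / m * (m ^ 2 * (y / (1 - y) ^ 2)) * ((1 - y) ^ 2 * (1 - z)))
    with (m * (- d * y * (1 - z))) by (field; lra).
  replace ((m * (z / (1 - z)) - m * (y / (1 - y))) * ((1 - y) ^ 2 * (1 - z)))
    with (m * ((z - y) * (1 - y))) by (field; lra).
  apply Rmult_le_compat_l; [lra|].
  rewrite EF in *.
  (* Substituting y = z e^d writes the difference of the two sides as the sum of this quantity and
     the next one. *)
  assert (0 <= z * (1 - exp d + d * exp d)) by (apply Rmult_le_pos; lra).
  assert (0 <= z ^ 2 * exp d * (exp d - 1 - d)).
  { apply Rmult_le_pos; [apply Rmult_le_pos; [apply pow2_ge_0|lra]|lra]. }
  nra.
Qed.

(** Difference quotients of the mean with relative step h = sqrt t. The mean is known up to O(1/t),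
    which contributes t^(-2) / h, and the curvature of 1/s^2 contributes h t^(-3); this choice of h
    makes both sqrt t / t^3. *)
Lemma part_var_bound (n : nat) (t : R) :
  0 < t <= 1 / 16 -> 1 <= INR n * t ^ 2 <= 2 ->
  Rabs (part_var n t - PI ^ 2 / 3 / t ^ 3) <= 400000 * sqrt t / t ^ 3.
Proof.
  intros Ht Hn; set (h := sqrt t).
  assert (h2 : h ^ 2 = t) by (apply pow2_sqrt; lra).
  assert (h0 : 0 < h) by (apply sqrt_lt_R0; lra).
  assert (h4 : h <= 1 / 4).
  { apply Rsqr_incr_0_var; [unfold Rsqr; simpl in h2; lra|lra]. }
  assert (M : forall s, t * (3 / 4) <= s <= t * (5 / 4) ->
     PI ^ 2 / (6 * s ^ 2) - 100000 / t <= part_mean n s <= PI ^ 2 / (6 * s ^ 2)).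
  { intros s Hs; destruct (part_mean_bounds n s) as [B1 B2]; [lra| |].
    - assert (t ^ 2 * (9 / 16) <= s ^ 2 <= t ^ 2 * (25 / 16)) by (simpl; nra).
      pose proof (pos_INR n); split; nra.
    - split; [|exact B2]; eapply Rle_trans; [|exact B1].
      assert (50000 / s <= 100000 / t); [|lra].
      apply Rmult_le_reg_r with (s * t); [apply Rmult_lt_0_compat; lra|].
      field_simplify; lra. }
  pose proof zeta2_le as Z; assert (Hp : 0 <= PI ^ 2) by apply pow2_ge_0.
  assert (Hth : 0 < t * h) by (apply Rmult_lt_0_compat; lra).
  pose proof (part_mean_tangent n t (t * (1 - h)) ltac:(lra) ltac:(nra)) as U.
  pose proof (part_mean_tangent n t (t * (1 + h)) ltac:(lra) ltac:(nra)) as L.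
  replace (t - t * (1 - h)) with (t * h) in U by ring.
  replace (t - t * (1 + h)) with (- (t * h)) in L by ring.
  destruct (M t ltac:(lra)) as [M1 M2].
  destruct (M (t * (1 - h)) ltac:(nra)) as [M3 M4].
  destruct (M (t * (1 + h)) ltac:(nra)) as [M5 M6].
  assert (Q1 : / (1 - h) ^ 2 <= 1 + h * (2 + 8 * h)).
  { apply Rmult_le_reg_r with ((1 - h) ^ 2); [apply pow_lt; lra|].
    rewrite Rinv_l by (apply pow_nonzero; lra).
    assert (0 <= h ^ 2 * (5 - 14 * h + 8 * h ^ 2)).
    { apply Rmult_le_pos; [apply pow2_ge_0|nra]. }
    nra. }
  assert (Q2 : / (1 + h) ^ 2 <= 1 - h * (2 - 8 * h)).
  { apply Rmult_le_reg_r with ((1 + h) ^ 2); [apply pow_lt; lra|].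
    rewrite Rinv_l by (apply pow_nonzero; lra).
    assert (0 <= h ^ 2 * (5 + 14 * h + 8 * h ^ 2)).
    { apply Rmult_le_pos; [apply pow2_ge_0|nra]. }
    nra. }
  assert (t3 : 0 < t ^ 3) by (apply pow_lt; lra).
  assert (ti : 0 < / t) by (apply Rinv_0_lt_compat; lra).
  assert (ti2 : 0 < / t ^ 2) by (apply Rinv_0_lt_compat, pow_lt; lra).
  set (c := PI ^ 2 / 6) in *.
  assert (E0 : PI ^ 2 / (6 * t ^ 2) = c * / t ^ 2) by (unfold c; field; lra).
  assert (E1 : PI ^ 2 / (6 * (t * (1 - h)) ^ 2) = c * / t ^ 2 * / (1 - h) ^ 2)
    by (unfold c; field; lra).
  assert (E2 : PI ^ 2 / (6 * (t * (1 + h)) ^ 2) = c * / t ^ 2 * / (1 + h) ^ 2)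
    by (unfold c; field; lra).
  rewrite E0 in *; rewrite E1 in *; rewrite E2 in *.
  assert (c0 : 0 <= c) by (unfold c; lra).
  assert (ct : 0 <= c * / t ^ 2) by (apply Rmult_le_pos; lra).
  assert (U' : part_var n t * (t * h) <= c * / t ^ 2 * (h * (2 + 8 * h)) + 100000 * / t).
  { apply (Rmult_le_compat_l (c * / t ^ 2)) in Q1; [|exact ct]. unfold Rdiv in *; lra. }
  assert (L' : c * / t ^ 2 * (h * (2 - 8 * h)) - 100000 * / t <= part_var n t * (t * h)).
  { apply (Rmult_le_compat_l (c * / t ^ 2)) in Q2; [|exact ct]. unfold Rdiv in *; lra. }
  assert (Eh : / t = h * h * / t ^ 2) by (replace (h * h) with t by (rewrite <- h2; ring); field; lra).
  set (V := part_var n t) in *.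
  replace (PI ^ 2 / 3 / t ^ 3) with (2 * c / t ^ 3) by (unfold c; field; lra).
  assert (Vt : V * (t * h) = (V * t ^ 3) * (h * / t ^ 2)) by (field; lra).
  rewrite Vt, Eh in U', L'.
  assert (hp : 0 < h * / t ^ 2) by (apply Rmult_lt_0_compat; lra).
  assert (U2 : V * t ^ 3 <= c * (2 + 8 * h) + 100000 * h).
  { apply Rmult_le_reg_r with (h * / t ^ 2); [exact hp|]. lra. }
  assert (L2 : c * (2 - 8 * h) - 100000 * h <= V * t ^ 3).
  { apply Rmult_le_reg_r with (h * / t ^ 2); [exact hp|]. lra. }
  replace (V - 2 * c / t ^ 3) with ((V * t ^ 3 - 2 * c) * / t ^ 3) by (field; lra).
  rewrite Rabs_mult, (Rabs_pos_eq (/ t ^ 3)) by (left; apply Rinv_0_lt_compat; lra).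
  unfold Rdiv; apply Rmult_le_compat_r; [left; apply Rinv_0_lt_compat; lra|].
  assert (c * h <= 2 * h) by (apply Rmult_le_compat_r; lra).
  apply Rabs_le; lra.
Qed.

(** * Bounds away from the positive real axis *)

Lemma rprod_add (f : nat -> R) (m n : nat) :
  rprod f (m + n) = rprod f m * rprod (fun k => f (m + k)%nat) n.
Proof.
  induction n as [|n IH]; [rewrite Nat.add_0_r; simpl; ring|].
  rewrite Nat.add_succ_r; simpl; rewrite IH; ring.
Qed.

Lemma rprod_ext (f g : nat -> R) (n : nat) :
  (forall k, (k < n)%nat -> f k = g k) -> rprod f n = rprod g n.
Proof.
  induction n as [|n IH]; intros H; [reflexivity|].
  simpl; rewrite IH by (intros; apply H; lia); rewrite H by lia; reflexivity.
Qed.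

Lemma rprod_mult (f g : nat -> R) (n : nat) :
  rprod (fun k => f k * g k) n = rprod f n * rprod g n.
Proof. induction n as [|n IH]; simpl; [ring|rewrite IH; ring]. Qed.

Lemma rprod_le (f g : nat -> R) (n : nat) :
  (forall k, (k < n)%nat -> 0 <= f k <= g k) -> 0 <= rprod f n <= rprod g n.
Proof.
  induction n as [|n IH]; intros H; simpl; [lra|].
  specialize (H n ltac:(lia)) as Hn; destruct IH as [A B]; [intros; apply H; lia|].
  split; [apply Rmult_le_pos; lra|apply Rmult_le_compat; lra].
Qed.

Lemma rprod_pos (f : nat -> R) (n : nat) :
  (forall k, (k < n)%nat -> 0 < f k) -> 0 < rprod f n.
Proof.
  induction n as [|n IH]; intros H; simpl; [lra|].
  apply Rmult_lt_0_compat; [apply IH; intros; apply H; lia|apply H; lia].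
Qed.

Lemma rprod_le_1 (f : nat -> R) (n : nat) :
  (forall k, (k < n)%nat -> 0 <= f k <= 1) -> 0 <= rprod f n <= 1.
Proof.
  intros H; pose proof (rprod_le f (fun _ => 1) n H) as B.
  replace (rprod (fun _ => 1) n) with 1 in B; [exact B|].
  clear; induction n as [|n IH]; simpl; [reflexivity|rewrite <- IH; ring].
Qed.

(** * Damping by a window of consecutive factors *)

Definition seg_prod (f : nat -> R) (a b : nat) : R := rprod (fun k => f (a + k)%nat) (b - a).

Lemma seg_prod_split (f : nat -> R) (a b c : nat) :
  (a <= b <= c)%nat -> seg_prod f a c = seg_prod f a b * seg_prod f b c.
Proof.
  intros H; unfold seg_prod; replace (c - a)%nat with ((b - a) + (c - b))%nat by lia.
  rewrite rprod_add; f_equal; apply rprod_ext; intros k _; f_equal; lia.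
Qed.

Lemma seg_prod_le_1 (f : nat -> R) (a b : nat) :
  (forall m, (a <= m)%nat -> 0 <= f m <= 1) -> 0 <= seg_prod f a b <= 1.
Proof. intros H; apply rprod_le_1; intros k _; apply H; lia. Qed.

Lemma seg_prod_sub (f : nat -> R) (a a' b' b : nat) :
  (forall m, (a <= m)%nat -> 0 <= f m <= 1) -> (a <= a')%nat -> (a' <= b')%nat -> (b' <= b)%nat ->
  seg_prod f a b <= seg_prod f a' b'.
Proof.
  intros H H1 H2 H3.
  rewrite (seg_prod_split f a a' b), (seg_prod_split f a' b' b) by lia.
  pose proof (seg_prod_le_1 f a a' H).
  pose proof (seg_prod_le_1 f a' b' ltac:(intros; apply H; lia)).
  pose proof (seg_prod_le_1 f b' b ltac:(intros; apply H; lia)).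
  assert (seg_prod f a' b' * seg_prod f b' b <= seg_prod f a' b') by nra.
  assert (0 <= seg_prod f a' b' * seg_prod f b' b) by (apply Rmult_le_pos; lra).
  nra.
Qed.

(** The modulus of one factor of P(q) / P(|q|): what 1 / (1 - q^m) loses when q leaves the positive
    axis. *)
Definition damping (t th : R) (m : nat) : R :=
  (1 - exp (- t) ^ m) / Cmod (1 - qpw (exp (- t)) th m)%C.

Lemma damping_bounds (t th : R) (m : nat) :
  0 < t -> (1 <= m)%nat -> 0 <= damping t th m <= 1.
Proof.
  intros Ht Hm; destruct (one_minus_qpw_bounds t th m Ht Hm) as [[B1 B2] _].
  unfold damping; split; [apply Rdiv_le_0_compat; lra|].
  apply Rmult_le_reg_r with (Cmod (1 - qpw (exp (- t)) th m)%C); [lra|].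
  unfold Rdiv; rewrite Rmult_assoc, Rinv_l; lra.
Qed.

Lemma Cmod_one_minus_qpw_sq (r th : R) (m : nat) :
  Cmod (1 - qpw r th m)%C ^ 2 = (1 - r ^ m) ^ 2 + 2 * r ^ m * (1 - cos (INR m * th)).
Proof.
  rewrite Cmod2_alt; unfold qpw; simpl Re; simpl Im.
  pose proof (sin2_cos2 (INR m * th)) as E; unfold Rsqr in E.
  set (c := cos (INR m * th)) in *; set (s := sin (INR m * th)) in *.
  replace ((1 + - (r ^ m * c)) ^ 2 + (0 + - (r ^ m * s)) ^ 2)
    with (1 - 2 * r ^ m * c + r ^ m * r ^ m * (s * s + c * c)) by ring.
  rewrite E; ring.
Qed.

Lemma exp_minus_6 : 0 < exp (- 6) <= 1 / 7.
Proof.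
  split; [apply exp_pos|]; replace (1 / 7) with (/ (1 + 6)) by field.
  apply (exp_neg_le_inv 6); lra.
Qed.

(** With s = e^(-m t) and u = 1 - cos (m th), the inverse square of the damping is 1 + 2 s u / (1 -
    s)^2, at least 1 + 2 e^(-6) u, which exceeds exp (e^(-6) u) because u <= 2. The bound 6 is what
    m < 3 K and K <= 1/t + 1 yield for t <= 1. *)
Lemma damping_exp (t th : R) (m : nat) :
  0 < t -> (1 <= m)%nat -> INR m * t <= 6 ->
  damping t th m <= exp (- (exp (- 6) / 2 * (1 - cos (INR m * th)))).
Proof.
  intros Ht Hm H6.
  destruct (one_minus_qpw_bounds t th m Ht Hm) as [[B1 B2] _].
  pose proof (one_minus_cos_bounds (INR m * th)) as [[C0 _] _].
  pose proof (COS_bound (INR m * th)) as CB.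
  pose proof (Cmod_one_minus_qpw_sq (exp (- t)) th m) as E.
  set (u := 1 - cos (INR m * th)) in *.
  assert (Hs : exp (- 6) <= exp (- t) ^ m)
    by (rewrite exp_neg_pow; apply exp_le_compat; lra).
  pose proof exp_minus_6 as [P6 H64].
  set (s := exp (- t) ^ m) in *; set (D := Cmod (1 - qpw (exp (- t)) th m)%C) in *.
  set (k := exp (- 6)) in *.
  assert (Hw : 1 + 2 * k * u <= D ^ 2 / (1 - s) ^ 2).
  { rewrite E; apply Rmult_le_reg_r with ((1 - s) ^ 2); [apply pow_lt, B1|].
    replace (((1 - s) ^ 2 + 2 * s * u) / (1 - s) ^ 2 * (1 - s) ^ 2)
      with ((1 - s) ^ 2 + 2 * s * u) by (field; lra).
    assert ((1 - s) ^ 2 <= 1) by (simpl; nra).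
    assert (k * u <= s * u) by (apply Rmult_le_compat_r; lra).
    assert (0 <= k * u) by (apply Rmult_le_pos; lra).
    nra. }
  assert (Hu : u <= 2) by (unfold u; lra).
  assert (Hku : 0 <= k * u <= 2 / 7) by (split; [apply Rmult_le_pos; lra|nra]).
  assert (He : exp (k * u) <= 1 + 2 * k * u).
  { pose proof (exp_ge_1_plus (- (k * u))) as H; rewrite exp_Ropp in H.
    pose proof (exp_pos (k * u)) as He; apply (Rmult_le_compat_r (exp (k * u))) in H; [|lra].
    rewrite Rinv_l in H by lra; nra. }
  assert (Hd : damping t th m ^ 2 <= exp (- (k * u))).
  { unfold damping; fold s D; rewrite exp_Ropp.
    replace (((1 - s) / D) ^ 2) with (/ (D ^ 2 / (1 - s) ^ 2)) by (field; lra).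
    apply Rinv_le_contravar; [apply exp_pos|lra]. }
  pose proof (damping_bounds t th m Ht Hm) as [Db _].
  apply Rsqr_incr_0_var; [|left; apply exp_pos].
  rewrite !Rsqr_pow2, exp_neg_pow; eapply Rle_trans; [exact Hd|].
  right; do 2 f_equal; simpl; field.
Qed.

(** As 1 - cos is half the squared chord to 1, this is the triangle inequality on the circle,
    squared. It forbids that two angles whose difference is far from 0 are both close to 0. *)
Lemma cos_diff_ineq (x y : R) : 1 - cos (x - y) <= 2 * (1 - cos x) + 2 * (1 - cos y).
Proof.
  rewrite !one_minus_cos_half; replace ((x - y) / 2) with (x / 2 - y / 2) by field; rewrite sin_minus.
  pose proof (sin2_cos2 (x / 2)) as E1; pose proof (sin2_cos2 (y / 2)) as E2.
  unfold Rsqr in *.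
  set (a := sin (x / 2)) in *; set (b := cos (x / 2)) in *.
  set (c := sin (y / 2)) in *; set (d := cos (y / 2)) in *.
  assert ((a * d - b * c) ^ 2 <= 2 * (a * d) ^ 2 + 2 * (b * c) ^ 2)
    by (pose proof (pow2_ge_0 (a * d + b * c)); nra).
  assert ((a * d) ^ 2 <= a ^ 2).
  { rewrite Rpow_mult_distr; pose proof (pow2_ge_0 a); assert (d ^ 2 <= 1) by nra; nra. }
  assert ((b * c) ^ 2 <= c ^ 2).
  { rewrite Rpow_mult_distr; pose proof (pow2_ge_0 c); assert (b ^ 2 <= 1) by nra; nra. }
  lra.
Qed.

Lemma one_minus_cos_lower (x : R) : 0 <= x <= 2 -> x ^ 2 / 3 <= 1 - cos x.
Proof.
  intros Hx; rewrite one_minus_cos_half.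
  pose proof (sin_cubic (x / 2)) as S; rewrite (Rabs_pos_eq (x / 2)) in S by lra.
  apply Rabs_le_between in S.
  assert ((x / 2) ^ 3 <= x / 2) by (set (z := x / 2); assert (0 <= z <= 1) by (unfold z; lra); simpl; nra).
  assert (5 / 6 * (x / 2) <= sin (x / 2)) by lra.
  assert ((5 / 6 * (x / 2)) ^ 2 <= sin (x / 2) ^ 2) by (apply pow_incr; lra).
  pose proof (pow2_ge_0 x); nra.
Qed.

(** Cosine decreases on [1, PI], and reflection at PI maps the rest of the interval into [1, PI]
    because PI - 1 >= 1. *)
Lemma one_minus_cos_mid (x : R) : 1 <= x <= 1 + PI -> 1 / 3 <= 1 - cos x.
Proof.
  intros Hx; pose proof PI2_3_2 as HP; pose proof PI_4 as HP4; unfold PI2 in HP.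
  pose proof (one_minus_cos_lower 1 ltac:(lra)).
  assert (P : forall y, 1 <= y <= PI -> cos y <= cos 1).
  { intros y Hy; destruct (Req_dec y 1) as [->|]; [lra|].
    left; apply cos_decreasing_1; lra. }
  destruct (Rle_dec x PI).
  - specialize (P x ltac:(lra)); lra.
  - replace (cos x) with (cos (2 * PI - x)).
    + specialize (P (2 * PI - x) ltac:(lra)); lra.
    + rewrite cos_minus, cos_2PI, sin_2PI; ring.
Qed.

(** If K th <= 1, the first K angles stay in [0, 2], where 1 - cos is quadratic. Otherwise some
    shift d <= K has d th in [1, 1 + PI], and of two terms at distance d one is bounded below; K
    such pairs fit in the window. *)
Lemma cos_window_sum (K : nat) (th : R) :
  (1 <= K)%nat -> 0 <= th <= PI ->
  let S := rsum (fun k => 1 - cos (INR (K + k) * th)) (2 * K) in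
  INR K / 12 <= S \/ INR K ^ 3 * th ^ 2 / 12 <= S.
Proof.
  intros HK Hth S.
  assert (HK1 : 1 <= INR K) by (apply (le_INR 1); exact HK).
  assert (Hp : forall m, 0 <= 1 - cos (INR m * th))
    by (intros m; apply (proj1 (one_minus_cos_bounds (INR m * th)))).
  destruct (Rle_dec (INR K * th) 1) as [H|H].
  - right; apply Rle_trans with (rsum (fun k => 1 - cos (INR (K + k) * th)) K).
    + apply Rle_trans with (rsum (fun _ => (INR K * th) ^ 2 / 3) K).
      * rewrite rsum_const; pose proof (pow2_ge_0 th).
        assert (0 <= INR K ^ 3 * th ^ 2) by (apply Rmult_le_pos; [apply pow_le; lra|lra]).
        replace (INR K * ((INR K * th) ^ 2 / 3)) with (INR K ^ 3 * th ^ 2 / 3) by field. lra.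
      * apply rsum_le; intros k Hk.
        assert (B : INR K * th <= INR (K + k) * th)
          by (apply Rmult_le_compat_r; [lra|apply le_INR; lia]).
        assert (B2 : INR (K + k) * th <= 2 * INR K * th).
        { apply Rmult_le_compat_r; [lra|]; rewrite plus_INR.
          assert (INR k <= INR K) by (apply le_INR; lia). lra. }
        assert (0 <= INR K * th) by (apply Rmult_le_pos; lra).
        eapply Rle_trans; [|apply one_minus_cos_lower; lra].
        assert ((INR K * th) ^ 2 <= (INR (K + k) * th) ^ 2) by (apply pow_incr; lra). lra.
    + apply rsum_mono; [intros; apply Hp|lia].
  - (* Pair [k] with [k + d], where [d] is the least integer above [1 / th]. *)
    left.
    assert (Hth0 : 0 < th) by (destruct (Req_dec th 0) as [E|]; [rewrite E in H; lra|lra]).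
    assert (Hi : 0 < / th) by (apply Rinv_0_lt_compat, Hth0).
    destruct (nfloor_ex (/ th)) as [d0 Hd0]; [lra|].
    assert (HiK : / th < INR K).
    { apply Rmult_lt_reg_r with th; [exact Hth0|]; rewrite Rinv_l; lra. }
    assert (Hd : (Datatypes.S d0 <= K)%nat) by (apply INR_lt; lra).
    set (d := Datatypes.S d0) in *.
    assert (Hd1 : 1 <= INR d * th <= 1 + PI).
    { unfold d; rewrite S_INR; split.
      - apply Rle_trans with (/ th * th); [rewrite Rinv_l; lra|apply Rmult_le_compat_r; lra].
      - apply Rle_trans with ((/ th + 1) * th); [apply Rmult_le_compat_r; lra|].
        rewrite Rmult_plus_distr_r, Rinv_l; lra. }
    pose proof (one_minus_cos_mid _ Hd1) as Hc.
    assert (S1 : rsum (fun k => 1 - cos (INR (K + k) * th)) K <= S)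
      by (apply rsum_mono; [intros; apply Hp|lia]).
    assert (S2 : rsum (fun k => 1 - cos (INR (K + (d + k)) * th)) K <= S).
    { apply Rle_trans with (rsum (fun k => 1 - cos (INR (K + k) * th)) (d + K)).
      - rewrite rsum_add.
        pose proof (rsum_nonneg (fun k => 1 - cos (INR (K + k) * th)) d ltac:(intros; apply Hp)). lra.
      - apply rsum_mono; [intros; apply Hp|lia]. }
    assert (S3 : INR K * (1 / 3) <= 2 * rsum (fun k => 1 - cos (INR (K + (d + k)) * th)) K
                 + 2 * rsum (fun k => 1 - cos (INR (K + k) * th)) K).
    { rewrite <- !rsum_scal, <- rsum_plus, <- rsum_const; apply rsum_le; intros k _.
      eapply Rle_trans; [exact Hc|].
      replace (INR d * th) with (INR (K + (d + k)) * th - INR (K + k) * th)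
        by (rewrite !plus_INR; ring).
      apply cos_diff_ineq. }
    lra.
Qed.

(** The product of the rate e^(-6) / 2 for a single factor and the constant 1/12 of the cosine
    sum. *)
Definition minor_rate : R := exp (- 6) / 24.

Lemma minor_rate_bounds : 0 < minor_rate <= 1 / 16.
Proof.
  unfold minor_rate; pose proof exp_minus_6; lra.
Qed.

(** One bound for all cases: the first summand covers large angles and terms with both indices at
    least [K], the second is the Gaussian decay at small angles. *)
Definition minor_factor (t th : R) (K : nat) : R :=
  3 * exp (- (minor_rate * INR K)) + exp (- (minor_rate * (th ^ 2 / t ^ 3))).

Lemma damping_window (t th : R) (K : nat) :
  0 < t <= 1 -> (1 <= K)%nat -> / t <= INR K <= / t + 1 -> 0 <= th <= PI ->
  seg_prod (damping t th) K (3 * K) <= minor_factor t th K.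
Proof.
  intros Ht HK HKt Hth; unfold seg_prod; replace (3 * K - K)%nat with (2 * K)%nat by lia.
  eapply Rle_trans; [apply rprod_le with (g := fun k =>
    exp (- (exp (- 6) / 2 * (1 - cos (INR (K + k) * th)))))|].
  - intros k Hk; split; [apply damping_bounds; [lra|lia]|].
    apply damping_exp; [lra|lia|].
    apply Rle_trans with (3 * (/ t + 1) * t).
    + apply Rmult_le_compat_r; [lra|].
      apply Rle_trans with (INR (3 * K)); [apply le_INR; lia|].
      rewrite mult_INR; change (INR 3) with (1 + 1 + 1); lra.
    + rewrite Rmult_assoc, Rmult_plus_distr_r, Rinv_l by lra; lra.
  - rewrite rprod_exp.
    set (W := rsum (fun k => 1 - cos (INR (K + k) * th)) (2 * K)).
    replace (rsum _ (2 * K)) with (- (exp (- 6) / 2 * W)).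
    2:{ unfold W; rewrite Ropp_mult_distr_l, <- rsum_scal; apply rsum_ext; intros; ring. }
    unfold minor_factor; pose proof (exp_pos (- 6)).
    pose proof (exp_pos (- (minor_rate * INR K))).
    pose proof (exp_pos (- (minor_rate * (th ^ 2 / t ^ 3)))).
    destruct (cos_window_sum K th HK Hth) as [C|C]; fold W in C.
    + assert (exp (- (exp (- 6) / 2 * W)) <= exp (- (minor_rate * INR K))); [|lra].
      apply exp_le_compat, Ropp_le_contravar; unfold minor_rate; nra.
    + assert (exp (- (exp (- 6) / 2 * W)) <= exp (- (minor_rate * (th ^ 2 / t ^ 3)))); [|lra].
      apply exp_le_compat, Ropp_le_contravar.
      assert (th ^ 2 / t ^ 3 <= INR K ^ 3 * th ^ 2).
      { unfold Rdiv; rewrite Rmult_comm; apply Rmult_le_compat_r; [apply pow2_ge_0|].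
        rewrite <- pow_inv; apply pow_incr; split; [left; apply Rinv_0_lt_compat|]; lra. }
      unfold minor_rate; nra.
Qed.

(** The outer product covers the parts from i + 1 to n, the inner one those from j + 1 to j + i. If
    i < K the first contains the window; if j < K <= i, the second reaches from below K up to i, and
    together they contain it. *)
Lemma damping_two_ranges (t th : R) (n i j K : nat) :
  0 < t -> (1 <= K)%nat -> (i <= n)%nat -> (3 * K <= n + 1)%nat -> (i < K \/ j < K)%nat ->
  seg_prod (damping t th) (i + 1) (n + 1) * seg_prod (damping t th) (j + 1) (j + 1 + i)
  <= seg_prod (damping t th) K (3 * K).
Proof.
  intros Ht HK Hi Hn Hij.
  assert (D : forall a m, (1 <= a)%nat -> (a <= m)%nat -> 0 <= damping t th m <= 1)
    by (intros; apply damping_bounds; [exact Ht|lia]).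
  pose proof (seg_prod_le_1 (damping t th) (i + 1) (n + 1) ltac:(intros; apply (D (i + 1)%nat); lia)) as A1.
  pose proof (seg_prod_le_1 (damping t th) (j + 1) (j + 1 + i) ltac:(intros; apply (D (j + 1)%nat); lia)) as A2.
  destruct (Nat.lt_ge_cases i K) as [H|H].
  - pose proof (seg_prod_sub (damping t th) (i + 1) K (3 * K) (n + 1)
      ltac:(intros; apply (D (i + 1)%nat); lia) ltac:(lia) ltac:(lia) ltac:(lia)).
    nra.
  - pose proof (seg_prod_sub (damping t th) (j + 1) K (i + 1) (j + 1 + i)
      ltac:(intros; apply (D (j + 1)%nat); lia) ltac:(lia) ltac:(lia) ltac:(lia)) as B.
    apply Rle_trans with (seg_prod (damping t th) K (n + 1)).
    + rewrite (seg_prod_split _ K (i + 1) (n + 1)) by lia; nra.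
    + apply seg_prod_sub; [intros; apply (D K); lia|lia|lia|lia].
Qed.

(** The reciprocal of the Gaussian binomial of i + j over i at q = e^(-t), the q-analogue of
    [inv_binom]. *)
Definition q_inv_binom (t : R) (i j : nat) : R :=
  rprod (fun k => (1 - exp (- t) ^ S k) / (1 - exp (- t) ^ (j + 1 + k))) i.

Lemma one_minus_pow_pos (t : R) (m : nat) : 0 < t -> (1 <= m)%nat -> 0 < 1 - exp (- t) ^ m.
Proof. intros; apply (one_minus_qpw_bounds t 0 m); assumption. Qed.

Lemma q_inv_binom_factor (t : R) (j k : nat) :
  0 < t -> 0 <= (1 - exp (- t) ^ S k) / (1 - exp (- t) ^ (j + 1 + k)) <= 1.
Proof.
  intros Ht; pose proof (one_minus_pow_pos t (S k) Ht ltac:(lia)).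
  pose proof (one_minus_pow_pos t (j + 1 + k) Ht ltac:(lia)).
  split; [apply Rdiv_le_0_compat; lra|].
  apply Rmult_le_reg_r with (1 - exp (- t) ^ (j + 1 + k)); [lra|].
  unfold Rdiv; rewrite Rmult_assoc, Rinv_l, Rmult_1_r, Rmult_1_l by lra.
  assert (exp (- t) ^ (j + 1 + k) <= exp (- t) ^ S k); [|lra].
  rewrite !exp_neg_pow; apply exp_le_compat, Ropp_le_contravar, Rmult_le_compat_r; [lra|].
  apply le_INR; lia.
Qed.

(** Among the first K / 8 factors the numerators are at most 1/4, since the exponent is at most 1/4,
    and the denominators at least 1/2, since j t >= 1. Each factor is thus at most 1/2 <= e^(-1/2);
    rounding K / 8 down costs e^(1/2) <= 2. *)
Lemma q_inv_binom_small (t : R) (i j K : nat) :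
  0 < t <= 1 -> / t <= INR K <= / t + 1 -> (K <= i)%nat -> (K <= j)%nat ->
  q_inv_binom t i j <= 2 * exp (- (INR K / 16)).
Proof.
  intros Ht HK Hi Hj; set (h := (K / 8)%nat).
  pose proof (Nat.div_mod_eq K 8) as E; pose proof (Nat.mod_upper_bound K 8 ltac:(lia)) as E2.
  fold h in E.
  unfold q_inv_binom; replace i with (h + (i - h))%nat by lia; rewrite rprod_add.
  assert (F : forall k, 0 <= (1 - exp (- t) ^ S k) / (1 - exp (- t) ^ (j + 1 + k)) <= 1)
    by (intros; apply q_inv_binom_factor; lra).
  pose proof (rprod_le_1 (fun k => (1 - exp (- t) ^ S (h + k)) / (1 - exp (- t) ^ (j + 1 + (h + k)))) (i - h)
    ltac:(intros; apply F)) as B2.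
  assert (B1 : 0 <= rprod (fun k => (1 - exp (- t) ^ S k) / (1 - exp (- t) ^ (j + 1 + k))) h
               <= rprod (fun _ => exp (- / 2)) h).
  { apply rprod_le; intros k Hk; split; [apply F|].
    apply Rle_trans with (1 / 2).
    - pose proof (one_minus_pow_pos t (j + 1 + k) ltac:(lra) ltac:(lia)) as P.
      apply Rmult_le_reg_r with (1 - exp (- t) ^ (j + 1 + k)); [lra|].
      unfold Rdiv at 1; rewrite Rmult_assoc, Rinv_l, Rmult_1_r by lra.
      assert (U : 1 - exp (- t) ^ S k <= 1 / 4).
      { rewrite exp_neg_pow; pose proof (exp_ge_1_plus (- (INR (S k) * t))).
        assert (INR (S k) * t <= 1 / 4); [|lra].
        assert (H8 : 8 * INR (S k) <= INR K).
        { replace 8 with (INR 8) by (simpl; ring).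
          rewrite <- mult_INR; apply le_INR; lia. }
        apply Rle_trans with ((/ t + 1) / 8 * t); [apply Rmult_le_compat_r; lra|].
        replace ((/ t + 1) / 8 * t) with ((1 + t) / 8) by (field; lra). lra. }
      assert (L : exp (- t) ^ (j + 1 + k) <= 1 / 2).
      { rewrite exp_neg_pow; apply Rle_trans with (exp (Ropp 1)).
        - apply exp_le_compat, Ropp_le_contravar.
          apply Rle_trans with (/ t * t); [rewrite Rinv_l; lra|].
          apply Rmult_le_compat_r; [lra|]; apply Rle_trans with (INR K); [lra|apply le_INR; lia].
        - replace (1 / 2) with (/ (1 + 1)) by field; apply (exp_neg_le_inv 1); lra. }
      lra.
    - pose proof (exp_ge_1_plus (- / 2)); lra. }
  assert (E3 : rprod (fun _ => exp (- / 2)) h <= 2 * exp (- (INR K / 16))).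
  { rewrite (rprod_exp (fun _ => - / 2)), rsum_const.
    apply Rle_trans with (exp (1 / 2) * exp (- (INR K / 16))).
    - rewrite <- exp_plus; apply exp_le_compat.
      assert (INR K <= 8 * INR h + 8).
      { replace 8 with (INR 8) by (simpl; ring).
        rewrite <- mult_INR, <- plus_INR; apply le_INR; lia. }
      lra.
    - apply Rmult_le_compat_r; [left; apply exp_pos|].
      pose proof (exp_ge_1_plus (- (1 / 2))) as Y; rewrite exp_Ropp in Y.
      pose proof (exp_pos (1 / 2)).
      apply (Rmult_le_compat_r (exp (1 / 2))) in Y; [|lra]; rewrite Rinv_l in Y; lra. }
  cbv beta in *; nra.
Qed.

Lemma Cmod_seg (t th : R) (a N : nat) :
  0 < t -> (1 <= a)%nat ->
  / rprod (fun k => Cmod (1 - qpw (exp (- t)) th (a + k))%C) N =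
  rprod (fun k => damping t th (a + k)) N / rprod (fun k => 1 - exp (- t) ^ (a + k)) N.
Proof.
  intros Ht Ha; induction N as [|N IH]; cbn [rprod]; [field|].
  destruct (one_minus_qpw_bounds t th (a + N) Ht ltac:(lia)) as [[B1 B2] _].
  assert (0 < rprod (fun k => 1 - exp (- t) ^ (a + k)) N)
    by (apply rprod_pos; intros; apply one_minus_pow_pos; [exact Ht|lia]).
  rewrite Rinv_mult, IH.
  change (damping t th (a + N))
    with ((1 - exp (- t) ^ (a + N)) / Cmod (1 - qpw (exp (- t)) th (a + N))%C).
  field; repeat split; lra.
Qed.

Lemma exp_log_partition (n : nat) (t : R) :
  0 < t -> exp (log_partition n t) = / rprod (fun k => 1 - exp (- t) ^ S k) n.
Proof.
  intros Ht; unfold log_partition; induction n as [|n IH]; simpl rsum; cbn [rprod].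
  - rewrite exp_0; field.
  - pose proof (one_minus_pow_pos t (S n) Ht ltac:(lia)) as P.
    rewrite exp_plus, IH, Rinv_mult; f_equal; rewrite exp_Ropp; f_equal.
    rewrite exp_neg_pow_S in *; apply exp_ln, P.
Qed.

(** The modulus of a term is P cut at [n] on the real axis, times the inverse Gaussian binomial, two
    damping products and the two squared denominators. Either the binomial or the damping is small,
    depending on min(i, j). *)
Lemma spt_value_bound (e : nat -> nat -> nat) (n i j K : nat) (t th : R) :
  0 < t <= 1 -> (1 <= i <= n)%nat -> (1 <= j)%nat -> (j <= e i j)%nat ->
  (1 <= K)%nat -> / t <= INR K <= / t + 1 -> (3 * K <= n + 1)%nat -> 0 <= th <= PI ->
  Cmod (spt_value e n i j (exp (- t)) th)
  <= exp (log_partition n t) / t ^ 4 * (/ INR i ^ 2 * / INR j ^ 2) * minor_factor t th K.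
Proof.
  intros Ht Hi Hj He HK HKt Hn Hth; pose proof (exp_pos (- t)) as Hr.
  set (X := fun m => (1 - qpw (exp (- t)) th m)%C).
  assert (X0 : forall m, (1 <= m)%nat -> X m <> 0) by (intros; apply one_minus_qpw_bounds; [lra|lia]).
  assert (XB : forall m, (1 <= m)%nat -> 0 < 1 - exp (- t) ^ m <= Cmod (X m))
    by (intros; apply one_minus_qpw_bounds; [lra|lia]).
  assert (xp : forall m, (1 <= m)%nat -> 0 < 1 - exp (- t) ^ m) by (intros; apply XB; assumption).
  unfold spt_value; fold (X i) (X j).
  assert (P1 : cprod (fun k => X (i + 1 + k)%nat) (n - i) <> 0)
    by (apply cprod_neq_0; intros; apply X0; lia).
  assert (P2 : cprod (fun k => X (j + 1 + k)%nat) i <> 0)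
    by (apply cprod_neq_0; intros; apply X0; lia).
  rewrite !Cmod_mult, !Cmod_inv, !Cmod_mult, !Cmod_qpw
    by (try (left; exact Hr); repeat apply Cmult_neq_0; try apply X0; lia || assumption).
  rewrite !Cmod_cprod, !Rinv_mult.
  change (rprod (fun k => Cmod (X (i + 1 + k)%nat)) (n - i)) with
    (rprod (fun k => Cmod (1 - qpw (exp (- t)) th (i + 1 + k))%C) (n - i)).
  change (rprod (fun k => Cmod (X (j + 1 + k)%nat)) i) with
    (rprod (fun k => Cmod (1 - qpw (exp (- t)) th (j + 1 + k))%C) i).
  rewrite !Cmod_seg by (lra || lia).
  set (D1 := rprod (fun k => damping t th (i + 1 + k)) (n - i)).
  set (D2 := rprod (fun k => damping t th (j + 1 + k)) i).
  set (A1 := rprod (fun k => 1 - exp (- t) ^ (i + 1 + k)) (n - i)).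
  set (A2 := rprod (fun k => 1 - exp (- t) ^ (j + 1 + k)) i).
  assert (A1p : 0 < A1) by (apply rprod_pos; intros; apply xp; lia).
  assert (A2p : 0 < A2) by (apply rprod_pos; intros; apply xp; lia).
  assert (D1b : 0 <= D1 <= 1) by (apply rprod_le_1; intros; apply damping_bounds; [lra|lia]).
  assert (D2b : 0 <= D2 <= 1) by (apply rprod_le_1; intros; apply damping_bounds; [lra|lia]).
  assert (Main : D1 / A1 * (D2 / A2) <= exp (log_partition n t) * minor_factor t th K).
  { assert (EA : / A1 * / A2 = exp (log_partition n t) * q_inv_binom t i j).
    { rewrite exp_log_partition by lra.
      replace n with (i + (n - i))%nat at 1 by lia; rewrite rprod_add.
      replace (rprod (fun k => 1 - exp (- t) ^ S (i + k)) (n - i)) with A1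
        by (apply rprod_ext; intros; do 2 f_equal; lia).
      assert (Bp : 0 < rprod (fun k => 1 - exp (- t) ^ S k) i)
        by (apply rprod_pos; intros; apply xp; lia).
      assert (EB : rprod (fun k => 1 - exp (- t) ^ S k) i = q_inv_binom t i j * A2).
      { unfold q_inv_binom, A2; rewrite <- rprod_mult; apply rprod_ext; intros k _.
        pose proof (xp (j + 1 + k)%nat ltac:(lia)); field; lra. }
      rewrite EB in *; assert (q_inv_binom t i j <> 0) by (intros Z; rewrite Z in Bp; lra).
      field; repeat split; lra. }
    replace (D1 / A1 * (D2 / A2)) with (/ A1 * / A2 * (D1 * D2)) by (unfold Rdiv; ring).
    rewrite EA, Rmult_assoc; apply Rmult_le_compat_l; [left; apply exp_pos|].
    assert (Q1 : 0 <= q_inv_binom t i j <= 1)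
      by (apply rprod_le_1; intros; apply q_inv_binom_factor; lra).
    assert (D12 : 0 <= D1 * D2 <= 1) by (split; [apply Rmult_le_pos; lra|nra]).
    destruct (Nat.le_gt_cases K i) as [Ki|Ki]; [destruct (Nat.le_gt_cases K j) as [Kj|Kj]|].
    - pose proof (q_inv_binom_small t i j K Ht HKt Ki Kj) as B.
      apply Rle_trans with (q_inv_binom t i j); [nra|].
      eapply Rle_trans; [exact B|]; unfold minor_factor.
      pose proof (exp_pos (- (minor_rate * (th ^ 2 / t ^ 3)))).
      pose proof minor_rate_bounds as MR; pose proof (pos_INR K).
      assert (exp (- (INR K / 16)) <= exp (- (minor_rate * INR K)))
        by (apply exp_le_compat; nra).
      pose proof (exp_pos (- (minor_rate * INR K))); lra.
    - eapply Rle_trans; [|apply (damping_window t th K Ht HK HKt Hth)].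
      pose proof (damping_two_ranges t th n i j K ltac:(lra) HK ltac:(lia) Hn ltac:(lia)) as B.
      unfold seg_prod in B at 1 2.
      replace (n + 1 - (i + 1))%nat with (n - i)%nat in B by lia.
      replace (j + 1 + i - (j + 1))%nat with i in B by lia.
      fold D1 D2 in B; nra.
    - eapply Rle_trans; [|apply (damping_window t th K Ht HK HKt Hth)].
      pose proof (damping_two_ranges t th n i j K ltac:(lra) HK ltac:(lia) Hn ltac:(lia)) as B.
      unfold seg_prod in B at 1 2.
      replace (n + 1 - (i + 1))%nat with (n - i)%nat in B by lia.
      replace (j + 1 + i - (j + 1))%nat with i in B by lia.
      fold D1 D2 in B; nra. }
  (* A numerator q^l with l >= m compensates the squared denominator up to 1 / (m t)^2; this is
     where [j <= e i j] enters. *)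
  assert (G : forall m l, (1 <= m)%nat -> (m <= l)%nat ->
     0 <= exp (- t) ^ l * (/ Cmod (X m) * / Cmod (X m)) <= / t ^ 2 * / INR m ^ 2).
  { intros m l Hm Hl; destruct (XB m Hm) as [B1 B2].
    assert (Hm0 : 0 < INR m) by (apply lt_0_INR; lia).
    pose proof (sinh_bounds (INR m * t) ltac:(apply Rmult_lt_0_compat; lra)) as [_ SB].
    rewrite <- exp_neg_pow in SB.
    assert (I1 : 0 < / Cmod (X m) <= / (1 - exp (- t) ^ m))
      by (split; [apply Rinv_0_lt_compat; lra|apply Rinv_le_contravar; lra]).
    assert (L1 : 0 < exp (- t) ^ l <= exp (- t) ^ m).
    { split; [apply pow_lt; lra|]; rewrite !exp_neg_pow; apply exp_le_compat.
      apply Ropp_le_contravar, Rmult_le_compat_r; [lra|apply le_INR, Hl]. }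
    split; [apply Rmult_le_pos; [lra|apply Rmult_le_pos; lra]|].
    apply Rle_trans with (exp (- t) ^ m * (/ (1 - exp (- t) ^ m) * / (1 - exp (- t) ^ m))).
    - apply Rmult_le_compat; [lra|apply Rmult_le_pos; lra|lra|apply Rmult_le_compat; lra].
    - replace (/ t ^ 2 * / INR m ^ 2) with (/ (INR m * t) ^ 2) by (field; lra).
      eapply Rle_trans; [|exact SB]; right; field; lra. }
  pose proof (G i i ltac:(lia) (le_n i)) as Gi; pose proof (G j (e i j) Hj He) as Gj.
  set (gi := exp (- t) ^ i * (/ Cmod (X i) * / Cmod (X i))) in *.
  set (gj := exp (- t) ^ e i j * (/ Cmod (X j) * / Cmod (X j))) in *.
  replace (exp (- t) ^ i * (/ Cmod (X i) * / Cmod (X i) * (D1 / A1)) *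
     (exp (- t) ^ e i j * (/ Cmod (X j) * / Cmod (X j) * (D2 / A2))))
    with (gi * gj * (D1 / A1 * (D2 / A2))) by (unfold gi, gj; ring).
  replace (exp (log_partition n t) / t ^ 4 * (/ INR i ^ 2 * / INR j ^ 2) * minor_factor t th K)
    with ((/ t ^ 2 * / INR i ^ 2) * (/ t ^ 2 * / INR j ^ 2)
          * (exp (log_partition n t) * minor_factor t th K)).
  2:{ field; repeat split; try lra; apply Rgt_not_eq, lt_0_INR; lia. }
  apply Rmult_le_compat; [apply Rmult_le_pos; lra| |apply Rmult_le_compat; lra|exact Main].
  apply Rmult_le_pos; apply Rdiv_le_0_compat; lra.
Qed.

(** * The rational factors near q = 1 *)

(** What remains of a term after removing the partition product: a rational function of q that no
    longer depends on the cutoff [n]. *)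
Definition spt_rat (e : nat -> nat -> nat) (i j : nat) (r th : R) : C :=
  let Q := qpw r th in
  (Q i * Q (e i j) / ((1 - Q i) * (1 - Q i) * ((1 - Q j) * (1 - Q j)))
   * cprod (fun k => (1 - Q (S k)) / (1 - Q (j + 1 + k)%nat)) i)%C.

Lemma cprod_add (f : nat -> C) (m n : nat) :
  cprod f (m + n) = (cprod f m * cprod (fun k => f (m + k)%nat) n)%C.
Proof.
  induction n as [|n IH]; [rewrite Nat.add_0_r; simpl; ring|].
  rewrite Nat.add_succ_r; simpl; rewrite IH; ring.
Qed.

Lemma spt_value_factor (e : nat -> nat -> nat) (n i j : nat) (t th : R) :
  0 < t -> (1 <= i <= n)%nat -> (1 <= j)%nat ->
  spt_value e n i j (exp (- t)) th =
  (RtoC (exp (log_partition n t)) * part_ratio n t th * spt_rat e i j (exp (- t)) th)%C.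
Proof.
  intros Ht Hi Hj.
  set (X := fun m => (1 - qpw (exp (- t)) th m)%C).
  assert (X0 : forall m, (1 <= m)%nat -> X m <> 0) by (intros; apply one_minus_qpw_bounds; [lra|lia]).
  unfold spt_value, part_ratio, spt_rat; fold (X i) (X j).
  change (fun k => (1 - qpw (exp (- t)) th (S k))%C) with (fun k => X (S k)).
  rewrite exp_log_partition by exact Ht.
  set (R0 := rprod (fun k => (1 - exp (- t) ^ S k)%R) n).
  assert (HR : R0 <> 0).
  { apply Rgt_not_eq, rprod_pos; intros; apply one_minus_pow_pos; [exact Ht|lia]. }
  rewrite cprod_div by (intros; apply X0; lia).
  change (fun k => (1 - qpw (exp (- t)) th (S k))%C) with (fun k => X (S k)).
  change (fun k => (1 - qpw (exp (- t)) th (i + 1 + k))%C) with (fun k => X (i + 1 + k)%nat).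
  change (fun k => (1 - qpw (exp (- t)) th (j + 1 + k))%C) with (fun k => X (j + 1 + k)%nat).
  assert (E : cprod (fun k => X (S k)) n =
     (cprod (fun k => X (S k)) i * cprod (fun k => X (i + 1 + k)%nat) (n - i))%C).
  { replace n with (i + (n - i))%nat at 1 by lia; rewrite cprod_add; f_equal.
    apply cprod_ext; intros k _; f_equal; lia. }
  rewrite E.
  assert (P1 : cprod (fun k => X (i + 1 + k)%nat) (n - i) <> 0)
    by (apply cprod_neq_0; intros; apply X0; lia).
  assert (P2 : cprod (fun k => X (j + 1 + k)%nat) i <> 0)
    by (apply cprod_neq_0; intros; apply X0; lia).
  assert (P3 : cprod (fun k => X (S k)) i <> 0)
    by (apply cprod_neq_0; intros; apply X0; lia).
  pose proof (X0 i ltac:(lia)); pose proof (X0 j ltac:(lia)).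
  rewrite RtoC_inv by exact HR.
  assert (HRC : RtoC R0 <> 0) by (intros Z; injection Z; exact HR).
  field; repeat split; assumption.
Qed.

(* Convergence uniform in the window [0 <= th <= A t^(3/2)], as [n] grows. *)
Definition ulim (tt : nat -> R) (A : R) (f : nat -> R -> C) (l : C) : Prop :=
  forall eps, 0 < eps -> exists N, forall n, (N <= n)%nat ->
    forall th, 0 <= th <= A * (tt n * sqrt (tt n)) -> Cmod (f n th - l)%C < eps.

Section ULim.
Context (tt : nat -> R) (A : R).

Lemma ulim_const (l : C) : ulim tt A (fun _ _ => l) l.
Proof.
  intros eps He; exists O; intros n _ th _.
  replace (l - l)%C with (RtoC 0) by ring; rewrite Cmod_0; exact He.
Qed.

Lemma ulim_plus (f g : nat -> R -> C) (l m : C) :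
  ulim tt A f l -> ulim tt A g m -> ulim tt A (fun n th => f n th + g n th)%C (l + m)%C.
Proof.
  intros Hf Hg eps He.
  destruct (Hf (eps / 2) ltac:(lra)) as [N1 H1]; destruct (Hg (eps / 2) ltac:(lra)) as [N2 H2].
  exists (Nat.max N1 N2); intros n Hn th Hth.
  specialize (H1 n ltac:(lia) th Hth); specialize (H2 n ltac:(lia) th Hth).
  replace (f n th + g n th - (l + m))%C with ((f n th - l) + (g n th - m))%C by ring.
  eapply Rle_lt_trans; [apply Cmod_triangle|lra].
Qed.

Lemma ulim_csum (f : nat -> nat -> R -> C) (l : nat -> C) (m : nat) :
  (forall k, ulim tt A (f k) (l k)) ->
  ulim tt A (fun n th => csum (fun k => f k n th) m) (csum l m).
Proof.
  intros H; induction m as [|m IH]; simpl; [apply ulim_const|].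
  apply ulim_plus; [exact IH|apply H].
Qed.

Lemma ulim_mult (f g : nat -> R -> C) (l m : C) :
  ulim tt A f l -> ulim tt A g m -> ulim tt A (fun n th => f n th * g n th)%C (l * m)%C.
Proof.
  intros Hf Hg eps He.
  set (M := 1 + Cmod l + Cmod m).
  assert (HM : 1 <= M) by (unfold M; pose proof (Cmod_ge_0 l); pose proof (Cmod_ge_0 m); lra).
  set (d := Rmin 1 (eps / (2 * M))).
  assert (Hd : 0 < d) by (apply Rmin_pos; [lra|apply Rdiv_lt_0_compat; lra]).
  assert (Hd1 : d <= 1) by apply Rmin_l.
  assert (Hd2 : d * M <= eps / 2).
  { apply Rle_trans with (eps / (2 * M) * M); [apply Rmult_le_compat_r; [lra|apply Rmin_r]|].
    right; field; lra. }
  destruct (Hf d Hd) as [N1 H1]; destruct (Hg d Hd) as [N2 H2].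
  exists (Nat.max N1 N2); intros n Hn th Hth.
  specialize (H1 n ltac:(lia) th Hth); specialize (H2 n ltac:(lia) th Hth).
  replace (f n th * g n th - l * m)%C with
    ((f n th - l) * (g n th - m) + (l * (g n th - m) + (f n th - l) * m))%C by ring.
  eapply Rle_lt_trans; [apply Cmod_triangle|].
  eapply Rle_lt_trans; [apply Rplus_le_compat_l, Cmod_triangle|].
  rewrite !Cmod_mult.
  pose proof (Cmod_ge_0 l); pose proof (Cmod_ge_0 m).
  pose proof (Cmod_ge_0 (f n th - l)%C); pose proof (Cmod_ge_0 (g n th - m)%C).
  set (u := Cmod (f n th - l)%C) in *; set (v := Cmod (g n th - m)%C) in *.
  assert (u * v <= d * 1) by (apply Rmult_le_compat; lra).
  assert (Cmod l * v <= Cmod l * d) by (apply Rmult_le_compat_l; lra).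
  assert (u * Cmod m <= d * Cmod m) by (apply Rmult_le_compat_r; lra).
  unfold M in Hd2; lra.
Qed.

Lemma ulim_inv (f : nat -> R -> C) (l : C) :
  l <> 0 -> ulim tt A f l -> ulim tt A (fun n th => / f n th)%C (/ l)%C.
Proof.
  intros Hl Hf eps He; assert (L : 0 < Cmod l) by (apply Cmod_gt_0, Hl).
  set (d := Rmin (Cmod l / 2) (eps * (Cmod l ^ 2 / 2) / 2)).
  assert (L2 : 0 < Cmod l ^ 2) by (apply pow_lt, L).
  assert (Hd : 0 < d).
  { apply Rmin_pos; [lra|]. assert (0 < eps * (Cmod l ^ 2 / 2)) by (apply Rmult_lt_0_compat; lra). lra. }
  destruct (Hf d Hd) as [N HN]; exists N; intros n Hn th Hth.
  specialize (HN n Hn th Hth).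
  pose proof (Rmin_l (Cmod l / 2) (eps * (Cmod l ^ 2 / 2) / 2)) as D1.
  pose proof (Rmin_r (Cmod l / 2) (eps * (Cmod l ^ 2 / 2) / 2)) as D2; fold d in D1, D2.
  assert (Fl : Cmod l / 2 <= Cmod (f n th)).
  { pose proof (Cmod_triangle (f n th) (- (f n th - l))%C) as T.
    replace (f n th + - (f n th - l))%C with l in T by ring.
    rewrite Cmod_opp in T; lra. }
  assert (F0 : f n th <> 0) by (apply Cmod_gt_0; lra).
  replace (/ f n th - / l)%C with (- (f n th - l) / (f n th * l))%C by (field; split; assumption).
  rewrite Cmod_div, Cmod_opp, Cmod_mult by (apply Cmult_neq_0; assumption).
  apply Rmult_lt_reg_r with (Cmod (f n th) * Cmod l); [apply Rmult_lt_0_compat; lra|].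
  unfold Rdiv; rewrite Rmult_assoc, Rinv_l, Rmult_1_r
    by (apply Rgt_not_eq, Rmult_lt_0_compat; lra).
  assert (Cmod l ^ 2 / 2 <= Cmod (f n th) * Cmod l) by (simpl; nra).
  assert (eps * (Cmod l ^ 2 / 2) <= eps * (Cmod (f n th) * Cmod l)) by (apply Rmult_le_compat_l; lra).
  assert (0 < eps * (Cmod l ^ 2 / 2)) by (apply Rmult_lt_0_compat; lra).
  lra.
Qed.

Lemma ulim_ext (f g : nat -> R -> C) (l : C) :
  (forall n th, f n th = g n th) -> ulim tt A f l -> ulim tt A g l.
Proof.
  intros E H eps He; destruct (H eps He) as [N HN]; exists N; intros n Hn th Hth.
  rewrite <- E; apply HN; assumption.
Qed.

Lemma ulim_cprod (f : nat -> nat -> R -> C) (l : nat -> C) (m : nat) :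
  (forall k, ulim tt A (f k) (l k)) ->
  ulim tt A (fun n th => cprod (fun k => f k n th) m) (cprod l m).
Proof.
  intros H; induction m as [|m IH]; simpl; [apply ulim_const|].
  apply ulim_mult; [exact IH|apply H].
Qed.

Context (A_pos : 0 <= A).
Context (tt_pos : forall n, 0 < tt n).
Context (tt_lim : is_lim_seq tt 0).

(** In the window th / t is at most A sqrt t, so sqrt t is the natural size of every error there. *)
Lemma ulim_of_sqrt_bound (f : nat -> R -> C) (l : C) (c : R) :
  0 <= c ->
  (forall n th, tt n <= 1 -> 0 <= th <= A * (tt n * sqrt (tt n)) ->
     Cmod (f n th - l)%C <= c * sqrt (tt n)) ->
  ulim tt A f l.
Proof.
  intros Hc H eps He; set (d := eps / (c + 1)).
  assert (Hd : 0 < d) by (apply Rdiv_lt_0_compat; lra).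
  assert (Hd2 : 0 < Rmin 1 (d ^ 2)) by (apply Rmin_pos; [lra|apply pow_lt, Hd]).
  apply is_lim_seq_spec in tt_lim; destruct (tt_lim (mkposreal _ Hd2)) as [N HN].
  exists N; intros n Hn th Hth; specialize (HN n Hn); simpl in HN.
  rewrite Rminus_0_r, Rabs_pos_eq in HN by (left; apply tt_pos).
  pose proof (Rmin_l 1 (d * (d * 1))); pose proof (Rmin_r 1 (d * (d * 1))).
  eapply Rle_lt_trans; [apply H; [lra|exact Hth]|].
  assert (Sd : sqrt (tt n) < d).
  { rewrite <- (sqrt_pow2 d) by lra; apply sqrt_lt_1; [left; apply tt_pos|apply pow2_ge_0|].
    simpl; lra. }
  apply Rle_lt_trans with (c * d); [apply Rmult_le_compat_l; lra|].
  replace eps with (c * d + d) by (unfold d; field; lra). lra.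
Qed.

Lemma one_minus_qpw_expand (t th : R) (m : nat) :
  0 < t -> 0 <= th ->
  Cmod (1 - qpw (exp (- t)) th m - RtoC (INR m * t))%C <= (INR m * t) ^ 2 / 2 + 2 * (INR m * th).
Proof.
  intros Ht Hth; rewrite qpw_cis, exp_neg_pow.
  pose proof (pos_INR m); set (y := INR m * t); assert (Hy : 0 <= y) by (apply Rmult_le_pos; lra).
  replace (1 - RtoC (exp (- y)) * cis (INR m * th) - RtoC y)%C
    with (RtoC (1 - exp (- y) - y) + - (RtoC (exp (- y)) * (cis (INR m * th) - 1)))%C
    by (rewrite !RtoC_minus; ring).
  eapply Rle_trans; [apply Cmod_triangle|]; apply Rplus_le_compat.
  - rewrite Cmod_R.
    pose proof (exp_ge_1_plus (- y)) as E1.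
    pose proof (exp_neg_taylor2 y Hy) as E2.
    rewrite Rabs_left1; lra.
  - rewrite Cmod_opp, Cmod_mult, Cmod_R, Rabs_pos_eq by (left; apply exp_pos).
    pose proof (Cmod_cis_sub_1 (INR m * th)) as B.
    rewrite (Rabs_pos_eq (INR m * th)) in B by (apply Rmult_le_pos; lra).
    assert (exp (- y) <= 1) by (rewrite <- exp_0; apply exp_le_compat; lra).
    pose proof (Cmod_ge_0 (cis (INR m * th) - 1)%C); pose proof (exp_pos (- y)); nra.
Qed.

Lemma ulim_one_minus_qpw (m : nat) :
  ulim tt A (fun n th => (1 - qpw (exp (- tt n)) th m) / RtoC (tt n))%C (RtoC (INR m)).
Proof.
  pose proof (pos_INR m).
  apply ulim_of_sqrt_bound with (INR m ^ 2 + 2 * INR m * A).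
  - pose proof (pow2_ge_0 (INR m)); assert (0 <= INR m * A) by (apply Rmult_le_pos; lra); lra.
  - intros n th Hn Hth; specialize (tt_pos n); set (t := tt n) in *.
    assert (Ht : RtoC t <> 0) by (intros E; injection E; lra).
    replace ((1 - qpw (exp (- t)) th m) / RtoC t - RtoC (INR m))%C
      with ((1 - qpw (exp (- t)) th m - RtoC (INR m * t)) / RtoC t)%C
      by (rewrite RtoC_mult; field; exact Ht).
    rewrite Cmod_div, (Cmod_R t), (Rabs_pos_eq t) by (exact Ht || lra).
    pose proof (one_minus_qpw_expand t th m tt_pos ltac:(lra)) as B.
    apply Rmult_le_reg_r with t; [exact tt_pos|].
    unfold Rdiv; rewrite Rmult_assoc, Rinv_l, Rmult_1_r by lra.
    eapply Rle_trans; [exact B|].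
    pose proof (sqrt_pos t) as S0; assert (S2 : sqrt t * sqrt t = t) by (apply sqrt_sqrt; lra).
    assert (S1 : sqrt t <= 1) by (rewrite <- sqrt_1; apply sqrt_le_1_alt; lra).
    assert (INR m * th <= INR m * (A * (t * sqrt t))) by (apply Rmult_le_compat_l; lra).
    assert (T : t * t <= t * sqrt t) by (apply Rmult_le_compat_l; nra).
    pose proof (pow2_ge_0 (INR m)).
    assert (INR m ^ 2 * (t * t) <= INR m ^ 2 * (t * sqrt t)) by (apply Rmult_le_compat_l; lra).
    assert (0 <= INR m ^ 2 * (t * t)) by (apply Rmult_le_pos; nra).
    replace ((INR m * t) ^ 2) with (INR m ^ 2 * (t * t)) by ring.
    lra.
Qed.

Lemma ulim_qpw (m : nat) : ulim tt A (fun n th => qpw (exp (- tt n)) th m) 1.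
Proof.
  pose proof (pos_INR m).
  apply ulim_of_sqrt_bound with (INR m ^ 2 + INR m + 2 * INR m * A).
  - pose proof (pow2_ge_0 (INR m)); assert (0 <= INR m * A) by (apply Rmult_le_pos; lra); lra.
  - intros n th Hn Hth; specialize (tt_pos n); set (t := tt n) in *.
    pose proof (one_minus_qpw_expand t th m tt_pos ltac:(lra)) as B.
    replace (qpw (exp (- t)) th m - 1)%C with
      (- ((1 - qpw (exp (- t)) th m - RtoC (INR m * t)) + RtoC (INR m * t)))%C by ring.
    rewrite Cmod_opp; eapply Rle_trans; [apply Cmod_triangle|].
    rewrite (Cmod_R (INR m * t)), (Rabs_pos_eq (INR m * t)) by (apply Rmult_le_pos; lra).
    pose proof (sqrt_pos t) as S0; assert (S2 : sqrt t * sqrt t = t) by (apply sqrt_sqrt; lra).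
    assert (S1 : sqrt t <= 1) by (rewrite <- sqrt_1; apply sqrt_le_1_alt; lra).
    assert (T1 : t <= sqrt t) by nra.
    assert (T2 : t * sqrt t <= sqrt t) by nra.
    assert (T3 : t * t <= sqrt t) by nra.
    assert (INR m * th <= INR m * (A * (t * sqrt t))) by (apply Rmult_le_compat_l; lra).
    assert (INR m * A * (t * sqrt t) <= INR m * A * sqrt t)
      by (apply Rmult_le_compat_l; [apply Rmult_le_pos; lra|lra]).
    assert (INR m * t <= INR m * sqrt t) by (apply Rmult_le_compat_l; lra).
    pose proof (pow2_ge_0 (INR m)).
    assert (INR m ^ 2 * (t * t) <= INR m ^ 2 * sqrt t) by (apply Rmult_le_compat_l; lra).
    assert (0 <= INR m ^ 2 * (t * t)) by (apply Rmult_le_pos; nra).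
    replace ((INR m * t) ^ 2) with (INR m ^ 2 * (t * t)) in B by ring.
    lra.
Qed.

(** Each 1 - q^m is asymptotic to m t, uniformly in the window. Four unmatched factors in the
    denominator account for t^4, while the Gaussian binomial is homogeneous of degree 0 and the
    numerators tend to 1. *)
Lemma ulim_spt_rat (e : nat -> nat -> nat) (a b : nat) :
  ulim tt A (fun n th => RtoC (tt n ^ 4) * spt_rat e (S a) (S b) (exp (- tt n)) th)%C
    (RtoC (spt_coef a b)).
Proof.
  set (i := S a); set (j := S b).
  set (g := fun m n th => ((1 - qpw (exp (- tt n)) th m) / RtoC (tt n))%C).
  assert (Lg : forall m, ulim tt A (g m) (RtoC (INR m))) by apply ulim_one_minus_qpw.
  assert (Nz : forall m, (1 <= m)%nat -> RtoC (INR m) <> 0).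
  { intros m Hm E; injection E; apply Rgt_not_eq, lt_0_INR; lia. }
  apply ulim_ext with (fun n th =>
    (qpw (exp (- tt n)) th i * qpw (exp (- tt n)) th (e i j)
     * / (g i n th * g i n th * (g j n th * g j n th))
     * cprod (fun k => g (S k) n th * / g (j + 1 + k)%nat n th) i)%C).
  - intros n th; specialize (tt_pos n).
    assert (Ht : RtoC (tt n) <> 0) by (intros E; injection E; lra).
    assert (X0 : forall m, (1 <= m)%nat -> (1 - qpw (exp (- tt n)) th m)%C <> 0)
      by (intros; apply one_minus_qpw_bounds; [lra|lia]).
    unfold spt_rat.
    rewrite (cprod_ext (fun k => g (S k) n th * / g (j + 1 + k)%nat n th)%C
      (fun k => (1 - qpw (exp (- tt n)) th (S k)) / (1 - qpw (exp (- tt n)) th (j + 1 + k)))%C).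
    + pose proof (X0 i ltac:(unfold i; lia)); pose proof (X0 j ltac:(unfold j; lia)).
      rewrite RtoC_pow; unfold g; field; repeat split; assumption.
    + intros k _; unfold g; field; repeat split; try exact Ht; apply X0; lia.
  - replace (RtoC (spt_coef a b)) with
      (1 * 1 * / (RtoC (INR i) * RtoC (INR i) * (RtoC (INR j) * RtoC (INR j)))
       * cprod (fun k => RtoC (INR (S k)) * / RtoC (INR (j + 1 + k))) i)%C.
    + apply ulim_mult; [apply ulim_mult; [apply ulim_mult; apply ulim_qpw|]|].
      * apply ulim_inv; [repeat apply Cmult_neq_0; apply Nz; unfold i, j; lia|].
        repeat apply ulim_mult; apply Lg.
      * apply ulim_cprod; intros k; apply ulim_mult; [apply Lg|].
        apply ulim_inv; [apply Nz; lia|apply Lg].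
    + pose proof (Nz i ltac:(unfold i; lia)) as Hi; pose proof (Nz j ltac:(unfold j; lia)) as Hj.
      unfold spt_coef; fold i j; rewrite <- !S_INR; fold i j.
      rewrite !RtoC_mult; unfold inv_binom; rewrite <- cprod_RtoC.
      rewrite (cprod_ext (fun k => RtoC (INR (S k)) * / RtoC (INR (j + 1 + k)))%C
        (fun k => RtoC ((INR k + 1) / (INR j + INR k + 1)))).
      * rewrite !RtoC_inv, !RtoC_pow by (apply pow_nonzero, Rgt_not_eq, lt_0_INR; unfold i, j; lia).
        field; split; assumption.
      * intros k _; pose proof (pos_INR k); pose proof (pos_INR j).
        unfold Rdiv; rewrite RtoC_mult, RtoC_inv by lra.
        rewrite S_INR, !plus_INR; simpl (INR 1).
        replace (INR j + 1 + INR k) with (INR j + INR k + 1) by ring; reflexivity.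
Qed.

End ULim.

(** * The saddle point estimate *)

(** Chosen so that n t^2 = PI^2 / 6, the leading term of the mean; the maximum keeps the value
    positive at n = 0. *)
Definition saddle (n : nat) : R := PI / sqrt (6 * INR (Nat.max 1 n)).

Definition saddle_width (n : nat) : R := saddle n * sqrt (saddle n).

Lemma PI_sq_bounds : 9 < PI ^ 2 <= 12.
Proof.
  pose proof zeta2_le; pose proof PI2_3_2 as HP; unfold PI2 in HP.
  split; [simpl; nra|lra].
Qed.

Lemma saddle_pos (n : nat) : 0 < saddle n.
Proof.
  apply Rdiv_lt_0_compat; [apply PI_RGT_0|apply sqrt_lt_R0].
  pose proof (lt_0_INR (Nat.max 1 n) ltac:(lia)); lra.
Qed.

Lemma saddle_sq (n : nat) : INR (Nat.max 1 n) * saddle n ^ 2 = PI ^ 2 / 6.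
Proof.
  pose proof (lt_0_INR (Nat.max 1 n) ltac:(lia)) as H; unfold saddle.
  set (x := INR (Nat.max 1 n)) in *.
  unfold Rdiv; rewrite Rpow_mult_distr, pow_inv, pow2_sqrt by lra; field; lra.
Qed.

Lemma saddle_lim : is_lim_seq saddle 0.
Proof.
  apply is_lim_seq_spec; intros eps; pose proof (cond_pos eps) as He.
  destruct (nfloor_ex (2 / eps ^ 2)) as [N HN].
  { apply Rdiv_le_0_compat; [lra|apply pow_lt, He]. }
  exists (S N); intros n Hn; rewrite Rminus_0_r, Rabs_pos_eq by (left; apply saddle_pos).
  pose proof (saddle_pos n) as Sp; pose proof (saddle_sq n) as E; pose proof zeta2_le.
  assert (Hm : INR N + 1 <= INR (Nat.max 1 n)) by (rewrite <- S_INR; apply le_INR; lia).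
  apply Rnot_le_lt; intros C.
  assert (eps ^ 2 <= saddle n ^ 2) by (apply pow_incr; lra).
  assert (Hx : 2 / eps ^ 2 * eps ^ 2 = 2) by (field; lra).
  assert (0 < eps ^ 2) by (apply pow_lt, He).
  assert (2 / eps ^ 2 < INR (Nat.max 1 n)) by lra.
  assert (2 / eps ^ 2 * eps ^ 2 < INR (Nat.max 1 n) * eps ^ 2) by (apply Rmult_lt_compat_r; lra).
  assert (INR (Nat.max 1 n) * eps ^ 2 <= INR (Nat.max 1 n) * saddle n ^ 2)
    by (apply Rmult_le_compat_l; [apply pos_INR|lra]).
  lra.
Qed.

(** The artificial value at n = 0 is PI / sqrt 6 > 1, so smallness of the saddle point excludes that
    case. *)
Lemma saddle_le_1 (n : nat) : saddle n <= 1 -> (1 <= n)%nat /\ INR n * saddle n ^ 2 = PI ^ 2 / 6.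
Proof.
  intros H; pose proof (saddle_sq n) as E; destruct n as [|n].
  - exfalso; simpl (Nat.max 1 0) in E; simpl INR in E; pose proof PI_sq_bounds.
    pose proof (saddle_pos 0); assert (saddle 0 ^ 2 <= 1) by (simpl; nra). lra.
  - replace (Nat.max 1 (S n)) with (S n) in E by lia; split; [lia|exact E].
Qed.

Lemma saddle_width_sq (n : nat) : saddle_width n ^ 2 = saddle n ^ 3.
Proof.
  unfold saddle_width; pose proof (saddle_pos n).
  rewrite Rpow_mult_distr, pow2_sqrt by lra; ring.
Qed.

Lemma saddle_width_pos (n : nat) : 0 < saddle_width n.
Proof. apply Rmult_lt_0_compat; [|apply sqrt_lt_R0]; apply saddle_pos. Qed.

(** For th of order t^(3/2), the errors from the third moment, the mean and the variance are t^(-4)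
    t^(9/2), t^(-1) t^(3/2) and t^(-5/2) t^3, each of order sqrt t. *)
Lemma part_ratio_ulim (A : R) :
  0 <= A ->
  ulim saddle A (fun n th => part_ratio n (saddle n) th * cis (- (INR n * th))
                 - RtoC (gaussian (th / saddle_width n)))%C 0.
Proof.
  intros HA.
  apply (ulim_of_sqrt_bound saddle A saddle_pos saddle_lim) with
    (c := 1296 * A ^ 3 + 100000 * A + 200000 * A ^ 2 + 8).
  { assert (0 <= A ^ 3) by (apply pow_le, HA); pose proof (pow2_ge_0 A); lra. }
  intros n th Hn Hth; destruct (saddle_le_1 n Hn) as [Hn1 E].
  pose proof (saddle_pos n) as Ht; pose proof PI_sq_bounds as HP.
  pose proof (saddle_width_sq n) as W2; pose proof (saddle_width_pos n) as Wp.
  fold (saddle_width n) in Hth.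
  set (t := saddle n) in *; set (d := saddle_width n) in *.
  set (h := sqrt t); assert (h0 : 0 < h) by (apply sqrt_lt_R0, Ht).
  assert (h2 : h * h = t) by (apply sqrt_sqrt; lra).
  assert (Ed : d = t * h) by reflexivity.
  assert (A3 : 0 <= A ^ 3) by (apply pow_le, HA).
  assert (A2 : 0 <= A ^ 2) by apply pow2_ge_0.
  replace (part_ratio n t th * cis (- (INR n * th)) - RtoC (gaussian (th / d)) - 0)%C
    with (part_ratio n t th * cis (- (INR n * th)) - RtoC (gaussian (th / d)))%C by ring.
  destruct (Rle_dec t (1 / 16)) as [T|T].
  - pose proof (part_ratio_center n t th (PI ^ 2 / 3 / t ^ 3) Ht (proj1 Hth)) as B.
    assert (V0 : 0 <= PI ^ 2 / 3 / t ^ 3)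
      by (repeat apply Rdiv_le_0_compat; try lra; apply pow_lt, Ht).
    specialize (B V0).
    replace (gaussian (th / d)) with (exp (- (PI ^ 2 / 3 / t ^ 3 * th ^ 2 / 2))).
    2:{ unfold gaussian; rewrite gauss_sigma_sq, <- W2; do 2 f_equal; field; lra. }
    eapply Rle_trans; [exact B|].
    pose proof (part_third_le n t Ht) as P3.
    destruct (part_mean_bounds n t) as [M1 M2]; [lra|lra|].
    pose proof (part_var_bound n t ltac:(lra) ltac:(lra)) as PV; fold h in PV.
    assert (EN : PI ^ 2 / (6 * t ^ 2) = INR n).
    { replace (PI ^ 2 / (6 * t ^ 2)) with (PI ^ 2 / 6 / t ^ 2) by (field; lra).
      rewrite <- E; field; lra. }
    rewrite EN in M1, M2.
    assert (PM : Rabs (INR n - part_mean n t) <= 50000 / t) by (rewrite Rabs_pos_eq; lra).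
    assert (T3 : 3 * part_third n t * th ^ 3 <= 1296 * A ^ 3 * h).
    { apply Rle_trans with (3 * (432 / t ^ 4) * (A * d) ^ 3).
      - apply Rmult_le_compat; [|apply pow_le; lra|lra|apply pow_incr; lra].
        apply Rmult_le_pos; [lra|]; apply rsum_nonneg; intros k _.
        apply Rmult_le_pos; [apply pow_le, pos_INR|].
        apply Rdiv_le_0_compat; [apply pow_le; left; apply exp_pos|].
        apply pow_lt, one_minus_pow_pos; [exact Ht|lia].
      - right; rewrite Ed.
        replace ((A * (t * h)) ^ 3) with (A ^ 3 * t ^ 3 * (h * h) * h) by ring.
        rewrite h2; field; lra. }
    assert (T1 : 2 * th * Rabs (INR n - part_mean n t) <= 100000 * A * h).
    { apply Rle_trans with (2 * (A * d) * (50000 / t)).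
      - apply Rmult_le_compat; [lra|apply Rabs_pos|lra|exact PM].
      - right; rewrite Ed; field; lra. }
    assert (T2 : th ^ 2 / 2 * Rabs (part_var n t - PI ^ 2 / 3 / t ^ 3) <= 200000 * A ^ 2 * h).
    { assert (th ^ 2 <= (A * d) ^ 2) by (apply pow_incr; lra).
      apply Rle_trans with ((A * d) ^ 2 / 2 * (400000 * h / t ^ 3)).
      - apply Rmult_le_compat; [pose proof (pow2_ge_0 th); lra|apply Rabs_pos|lra|exact PV].
      - right; rewrite Rpow_mult_distr, W2; field; lra. }
    lra.
  (* For t > 1/16 the trivial bound 2 is absorbed by the summand 8 sqrt t. *)
  - assert (1 / 4 <= h).
    { apply Rsqr_incr_0_var; [unfold Rsqr; lra|lra]. }
    assert (C2 : Cmod (part_ratio n t th * cis (- (INR n * th)) - RtoC (gaussian (th / d)))%C <= 2).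
    { replace (part_ratio n t th * cis (- (INR n * th)) - RtoC (gaussian (th / d)))%C
        with (part_ratio n t th * cis (- (INR n * th)) + - RtoC (gaussian (th / d)))%C by ring.
      eapply Rle_trans; [apply Cmod_triangle|].
      rewrite Cmod_mult, Cmod_cis, Cmod_opp, Cmod_R.
      pose proof (gaussian_bounds (th / d)); rewrite Rabs_pos_eq by lra.
      pose proof (part_ratio_le_1 n t th Ht); lra. }
    assert (0 <= (1296 * A ^ 3 + 100000 * A + 200000 * A ^ 2) * h) by (apply Rmult_le_pos; lra).
    lra.
Qed.

Lemma Cmod_csum (f : nat -> C) (n : nat) : Cmod (csum f n) <= rsum (fun k => Cmod (f k)) n.
Proof.
  induction n as [|n IH]; simpl; [rewrite Cmod_0; lra|].
  eapply Rle_trans; [apply Cmod_triangle|lra].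
Qed.

Lemma csum_add (f : nat -> C) (m n : nat) :
  csum f (m + n) = (csum f m + csum (fun k => f (m + k)%nat) n)%C.
Proof.
  induction n as [|n IH]; [rewrite Nat.add_0_r; simpl; ring|].
  rewrite Nat.add_succ_r; simpl; rewrite IH; ring.
Qed.

Lemma csum_plus (f g : nat -> C) (n : nat) :
  csum (fun k => f k + g k)%C n = (csum f n + csum g n)%C.
Proof. induction n as [|n IH]; simpl; [ring|rewrite IH; ring]. Qed.

Lemma csum_scal (c : C) (f : nat -> C) (n : nat) :
  csum (fun k => c * f k)%C n = (c * csum f n)%C.
Proof. induction n as [|n IH]; simpl; [ring|rewrite IH; ring]. Qed.

Lemma csum_ext (f g : nat -> C) (n : nat) :
  (forall k, (k < n)%nat -> f k = g k) -> csum f n = csum g n.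
Proof.
  induction n as [|n IH]; intros H; [reflexivity|].
  simpl; rewrite IH by (intros; apply H; lia); rewrite H by lia; reflexivity.
Qed.

Lemma csum_RtoC (f : nat -> R) (n : nat) : csum (fun k => RtoC (f k)) n = RtoC (rsum f n).
Proof. induction n as [|n IH]; simpl; [reflexivity|rewrite IH, RtoC_plus; reflexivity]. Qed.

Lemma csum_square_bound (F : nat -> nat -> C) (v w : nat -> R) (m n : nat) :
  (forall a b, (a < m)%nat -> (b < n)%nat -> Cmod (F a b) <= v a * w b) ->
  Cmod (csum (fun a => csum (F a) n) m) <= rsum v m * rsum w n.
Proof.
  intros H; eapply Rle_trans; [apply Cmod_csum|].
  rewrite Rmult_comm, <- rsum_scal; apply rsum_le; intros a Ha.
  eapply Rle_trans; [apply Cmod_csum|].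
  rewrite Rmult_comm, <- rsum_scal; apply rsum_le; intros b Hb; apply H; assumption.
Qed.

(** The difference of the two squares of indices consists of two strips, each with one index at
    least [M]. *)
Lemma csum_square_tail (F : nat -> nat -> C) (w : nat -> R) (M p : nat) :
  (forall a b, (a < M + p)%nat -> (b < M + p)%nat -> Cmod (F a b) <= w a * w b) ->
  Cmod (csum (fun a => csum (F a) (M + p)) (M + p) - csum (fun a => csum (F a) M) M)%C
  <= (rsum w M + rsum w (M + p)) * rsum (fun k => w (M + k)%nat) p.
Proof.
  intros H.
  replace (csum (fun a => csum (F a) (M + p)) (M + p) - csum (fun a => csum (F a) M) M)%C with
    (csum (fun a => csum (fun b => F a (M + b)%nat) p) M
     + csum (fun a => csum (F (M + a)%nat) (M + p)) p)%C.
  - eapply Rle_trans; [apply Cmod_triangle|].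
    rewrite Rmult_plus_distr_r; apply Rplus_le_compat.
    + apply csum_square_bound; intros; apply H; lia.
    + rewrite (Rmult_comm (rsum w (M + p))).
      apply (csum_square_bound (fun a => F (M + a)%nat) (fun k => w (M + k)%nat)).
      intros; apply H; lia.
  - rewrite csum_add.
    rewrite (csum_ext (fun a => csum (F a) (M + p))
      (fun a => csum (F a) M + csum (fun b => F a (M + b)%nat) p)%C M)
      by (intros; apply csum_add).
    rewrite csum_plus; ring.
Qed.

(** * The integrand on the central arc and on the rest of the circle *)

Section Saddle.
Context (e : nat -> nat -> nat) (He : forall i j, (j <= e i j)%nat).

Definition spt_sum (n : nat) (th : R) : C :=
  csum (fun a => csum (fun b => spt_value e n (S a) (S b) (exp (- saddle n)) th) n) n.

Definition spt_scale (n : nat) : R := exp (log_partition n (saddle n)) / saddle n ^ 4.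

Lemma spt_scale_pos (n : nat) : 0 < spt_scale n.
Proof. apply Rdiv_lt_0_compat; [apply exp_pos|apply pow_lt, saddle_pos]. Qed.

Definition spt_integrand (n : nat) (th : R) : R :=
  fst (spt_sum n th) * cos (INR n * th) + snd (spt_sum n th) * sin (INR n * th).

Lemma spt_integrand_RInt (n : nat) :
  is_RInt (spt_integrand n) 0 PI (PI * (spt_gen e n * exp (- saddle n) ^ n)).
Proof.
  pose proof (exp_neg_lt_1 (saddle n) (saddle_pos n)) as Hr.
  rewrite (spt_gen_truncate e n He).
  apply (fourier_coefficient
    (fun k => rsum (fun a => rsum (fun b => spt_term e n (S a) (S b) k) n) n)); [lra|].
  intros th; unfold spt_sum.
  apply (fps_eval_rsum (fun a k => rsum (fun b => spt_term e n (S a) (S b) k) n)); intros a _.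
  apply (fps_eval_rsum (fun b => spt_term e n (S a) (S b))); intros b _.
  apply spt_term_eval; [lia|lia|lra].
Qed.

Lemma spt_integrand_Re (n : nat) (th : R) :
  spt_integrand n th = Re (spt_sum n th * cis (- (INR n * th)))%C.
Proof. unfold spt_integrand, cis, Re, Cmult; simpl; rewrite cos_neg, sin_neg; ring. Qed.

(** One window serves all terms: n >= 1/t^2 >= 8/t, whereas the window ends at 3 K <= 3/t + 3. *)
Lemma spt_value_bound_saddle (n : nat) :
  saddle n <= 1 / 8 -> exists K, / saddle n <= INR K /\
  forall a b th, (a < n)%nat -> 0 <= th <= PI ->
  Cmod (spt_value e n (S a) (S b) (exp (- saddle n)) th)
  <= spt_scale n * minor_factor (saddle n) th K * (/ (INR a + 1) ^ 2 * / (INR b + 1) ^ 2).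
Proof.
  intros Hn; pose proof (saddle_pos n) as Ht.
  destruct (saddle_le_1 n ltac:(lra)) as [Hn1 E].
  destruct (ceil_inv (saddle n) Ht) as [K [HK1 HK]].
  exists K; split; [apply HK|]; intros a b th Ha Hth.
  assert (H3 : (3 * K <= n + 1)%nat).
  { apply INR_le; rewrite mult_INR, plus_INR; change (INR 3) with (1 + 1 + 1); simpl (INR 1).
    pose proof PI_sq_bounds; set (t := saddle n) in *.
    assert (Hti : 8 <= / t).
    { replace 8 with (/ (1 / 8)) by field; apply Rinv_le_contravar; lra. }
    assert (HN : INR n = PI ^ 2 / 6 * (/ t * / t)).
    { rewrite <- E; field; lra. }
    assert (0 <= (PI ^ 2 / 6 - 1) * (/ t * / t)) by (apply Rmult_le_pos; nra).
    assert (8 * / t <= / t * / t) by (apply Rmult_le_compat_r; lra).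
    lra. }
  pose proof (spt_value_bound e n (S a) (S b) K (saddle n) th ltac:(lra) ltac:(lia) ltac:(lia)
    (He _ _) HK1 HK H3 Hth) as B.
  rewrite !S_INR in B; eapply Rle_trans; [exact B|]; right; unfold spt_scale; ring.
Qed.

Lemma minor_factor_le_4 (t th : R) (K : nat) : 0 < t -> 0 < minor_factor t th K <= 4.
Proof.
  intros Ht; unfold minor_factor; pose proof minor_rate_bounds; pose proof (pos_INR K).
  pose proof (pow2_ge_0 th).
  assert (0 <= th ^ 2 / t ^ 3) by (apply Rdiv_le_0_compat; [lra|apply pow_lt, Ht]).
  pose proof (exp_pos (- (minor_rate * INR K))).
  pose proof (exp_pos (- (minor_rate * (th ^ 2 / t ^ 3)))).
  assert (exp (- (minor_rate * INR K)) <= 1)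
    by (rewrite <- exp_0; apply exp_le_compat; nra).
  assert (exp (- (minor_rate * (th ^ 2 / t ^ 3))) <= 1)
    by (rewrite <- exp_0; apply exp_le_compat; nra).
  lra.
Qed.

(** The exponentials are weakened to powers that integrate explicitly: the first becomes O(t^4), the
    second O(t^3 / th^2). Integrated from A t^(3/2) on, the latter gives O(t^(3/2) / A), which is
    small for large A. *)
Lemma spt_integrand_minor (n : nat) (th : R) :
  saddle n <= 1 / 8 -> 0 < th <= PI ->
  Rabs (spt_integrand n th)
  <= spt_scale n * (3072 / minor_rate ^ 4 * saddle n ^ 4 + 4 / minor_rate * saddle n ^ 3 * / th ^ 2).
Proof.
  intros Hn Hth; destruct (spt_value_bound_saddle n Hn) as [K [HK B]].
  pose proof (saddle_pos n) as Ht; set (t := saddle n) in *.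
  rewrite spt_integrand_Re; eapply Rle_trans; [apply re_le_Cmod|].
  rewrite Cmod_mult, Cmod_cis, Rmult_1_r.
  pose proof (minor_factor_le_4 t th K Ht) as [MF0 _].
  pose proof (spt_scale_pos n) as Zp.
  apply Rle_trans with (spt_scale n * minor_factor t th K * zsum 2 n * zsum 2 n).
  - unfold zsum; rewrite <- (rsum_scal (spt_scale n * minor_factor t th K)).
    apply csum_square_bound; intros a b Ha Hb.
    eapply Rle_trans; [apply B; [exact Ha|lra]|]; right; ring.
  - assert (Hz : 0 <= zsum 2 n <= 2).
    { split; [apply rsum_nonneg; intros; left; apply zsum_term_pos|apply zsum2_le]. }
    assert (Hz2 : zsum 2 n * zsum 2 n <= 4) by nra.
    apply Rle_trans with (spt_scale n * (4 * minor_factor t th K)).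
    + rewrite !Rmult_assoc; apply Rmult_le_compat_l; [lra|].
      rewrite (Rmult_comm 4); apply Rmult_le_compat_l; lra.
    + apply Rmult_le_compat_l; [lra|]; unfold minor_factor.
      pose proof minor_rate_bounds as MR; set (c := minor_rate) in *.
      assert (E1 : exp (- (c * INR K)) <= 256 / c ^ 4 * t ^ 4).
      { apply Rle_trans with (exp (- (c * / t))); [apply exp_le_compat; nra|].
        assert (0 < / t) by (apply Rinv_0_lt_compat, Ht).
        eapply Rle_trans; [apply exp_neg_le_pow4, Rmult_lt_0_compat; lra|].
        right; field; lra. }
      assert (E2 : exp (- (c * (th ^ 2 / t ^ 3))) <= / c * t ^ 3 * / th ^ 2).
      { assert (0 < th ^ 2 / t ^ 3) by (apply Rdiv_lt_0_compat; apply pow_lt; lra).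
        assert (0 < c * (th ^ 2 / t ^ 3)) by (apply Rmult_lt_0_compat; lra).
        eapply Rle_trans; [apply exp_neg_le_inv; lra|].
        apply Rle_trans with (/ (c * (th ^ 2 / t ^ 3))); [apply Rinv_le_contravar; lra|].
        right; field; lra. }
      replace (3072 / c ^ 4 * t ^ 4 + 4 / c * t ^ 3 * / th ^ 2)
        with (4 * (3 * (256 / c ^ 4 * t ^ 4) + / c * t ^ 3 * / th ^ 2)) by (field; lra).
      lra.
Qed.

Lemma saddle_eventually (d : R) : 0 < d -> exists N, forall n, (N <= n)%nat -> saddle n <= d.
Proof.
  intros Hd; pose proof saddle_lim as L; apply is_lim_seq_spec in L.
  destruct (L (mkposreal d Hd)) as [N HN]; exists N; intros n Hn; specialize (HN n Hn).
  simpl in HN; rewrite Rminus_0_r in HN; apply Rabs_lt_between in HN; lra.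
Qed.

(** The double sum is first cut at a fixed [M], with a tail small uniformly in [n] and [th]. Each of
    the finitely many remaining terms has a uniform limit as [n] grows. *)
Lemma spt_integrand_center (A eps : R) :
  0 <= A -> 0 < eps -> exists N, forall n, (N <= n)%nat ->
  forall th, 0 <= th <= A * saddle_width n -> th <= PI ->
  Rabs (spt_integrand n th - spt_scale n * (PI ^ 4 / 120 * gaussian (th / saddle_width n)))
  <= spt_scale n * eps.
Proof.
  intros HA Heps.
  pose proof spt_coef_lim as SL; apply is_lim_seq_spec in SL.
  destruct (SL (mkposreal (eps / 4) ltac:(lra))) as [M0 HM0]; simpl in HM0.
  (* The tail is at most 4 (2 + 2) / M relative to the scale, which is at most eps / 4 once M >= 64
     / eps. *)
  destruct (nfloor_ex (64 / eps)) as [M1 HM1]; [apply Rdiv_le_0_compat; lra|].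
  set (M := Nat.max M0 (S M1)).
  specialize (HM0 M ltac:(lia)).
  set (sM := rsum (fun i => rsum (spt_coef i) M) M) in *.
  assert (HM : 16 / INR M <= eps / 4).
  { assert (INR M1 + 1 <= INR M) by (rewrite <- S_INR; apply le_INR; lia).
    assert (0 < 64 / eps) by (apply Rdiv_lt_0_compat; lra).
    assert (64 / eps * eps = 64) by (field; lra).
    apply Rmult_le_reg_r with (INR M); [lra|].
    replace (16 / INR M * INR M) with 16 by (field; lra). nra. }
  set (s1 := Rabs sM + 1); assert (Hs1 : 0 < s1) by (unfold s1; pose proof (Rabs_pos sM); lra).
  assert (LB : ulim saddle A (fun n th => csum (fun a => csum (fun b =>
      (RtoC (saddle n ^ 4) * spt_rat e (S a) (S b) (exp (- saddle n)) th)%C) M) M)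
      (csum (fun a => csum (fun b => RtoC (spt_coef a b)) M) M)).
  { apply (ulim_csum saddle A (fun a n th => csum (fun b =>
      (RtoC (saddle n ^ 4) * spt_rat e (S a) (S b) (exp (- saddle n)) th)%C) M)); intros a.
    apply (ulim_csum saddle A (fun b n th =>
      (RtoC (saddle n ^ 4) * spt_rat e (S a) (S b) (exp (- saddle n)) th)%C)); intros b.
    apply ulim_spt_rat; [exact HA|exact saddle_pos|exact saddle_lim]. }
  replace (csum (fun a => csum (fun b => RtoC (spt_coef a b)) M) M) with (RtoC sM) in LB.
  2:{ unfold sM; rewrite <- csum_RtoC; apply csum_ext; intros a _; symmetry; apply csum_RtoC. }
  destruct (LB (eps / 4) ltac:(lra)) as [N1 HN1].
  destruct (part_ratio_ulim A HA (eps / (4 * s1))) as [N2 HN2]; [apply Rdiv_lt_0_compat; lra|].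
  destruct (saddle_eventually (1 / 8) ltac:(lra)) as [N3 HN3].
  exists (Nat.max (Nat.max N1 N2) (Nat.max N3 M)); intros n Hn th Hth HthP.
  specialize (HN1 n ltac:(lia) th Hth); specialize (HN2 n ltac:(lia) th Hth).
  specialize (HN3 n ltac:(lia)).
  destruct (spt_value_bound_saddle n HN3) as [K [_ VB]].
  pose proof (saddle_pos n) as Ht; pose proof (spt_scale_pos n) as Zp.
  set (t := saddle n) in *; set (Z := spt_scale n) in *.
  set (g := gaussian (th / saddle_width n)) in *.
  assert (Hg : 0 < g <= 1) by apply gaussian_bounds.
  set (Q := (part_ratio n t th * cis (- (INR n * th)))%C) in *.
  set (BM := csum _ M) in HN1.
  assert (HQ : Cmod Q <= 1).
  { unfold Q; rewrite Cmod_mult, Cmod_cis, Rmult_1_r; apply part_ratio_le_1, Ht. }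
  replace (Q - RtoC g - 0)%C with (Q - RtoC g)%C in HN2 by ring.
  set (c := cis (- (INR n * th))) in *.
  set (SM := csum (fun a => csum (fun b => spt_value e n (S a) (S b) (exp (- t)) th) M) M).
  assert (Ht4 : 0 < t ^ 4) by (apply pow_lt, Ht).
  assert (ESM : (SM * c)%C = (RtoC Z * (Q * BM))%C).
  { assert (E : SM = (RtoC Z * part_ratio n t th * BM)%C); [|rewrite E; unfold Q; ring].
    unfold SM, BM; rewrite <- csum_scal; apply csum_ext; intros a Ha.
    rewrite <- csum_scal; apply csum_ext; intros b Hb.
    rewrite spt_value_factor by (exact Ht || lia); unfold Z, spt_scale; fold t.
    replace (exp (log_partition n t)) with (exp (log_partition n t) / t ^ 4 * t ^ 4) at 1
      by (field; lra).
    rewrite RtoC_mult; ring. }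
  assert (Tail : Cmod (spt_sum n th - SM)%C <= Z * (eps / 4)).
  { unfold spt_sum, SM; fold t.
    set (w := fun k => sqrt (4 * Z) * / (INR k + 1) ^ 2).
    assert (Hw : sqrt (4 * Z) * sqrt (4 * Z) = 4 * Z) by (apply sqrt_sqrt; lra).
    pose proof (csum_square_tail
      (fun a b => spt_value e n (S a) (S b) (exp (- t)) th) w M (n - M)) as ST.
    replace (M + (n - M))%nat with n in ST by lia.
    eapply Rle_trans; [apply ST|].
    - intros a b Ha Hb; eapply Rle_trans; [apply VB; [lia|lra]|].
      pose proof (minor_factor_le_4 t th K Ht) as MF.
      replace (w a * w b) with (sqrt (4 * Z) * sqrt (4 * Z) * (/ (INR a + 1) ^ 2 * / (INR b + 1) ^ 2))
        by (unfold w; ring).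
      rewrite Hw; apply Rmult_le_compat_r; [|nra].
      apply Rmult_le_pos; left; apply zsum_term_pos.
    - unfold w; rewrite !rsum_scal; fold (zsum 2 M) (zsum 2 n).
      pose proof (rsum_inv_sq_tail M (n - M) ltac:(unfold M; lia)) as TB.
      set (T := rsum (fun k => / (INR (M + k) + 1) ^ 2) (n - M)) in *.
      pose proof (zsum2_le M); pose proof (zsum2_le n).
      assert (T0 : 0 <= T) by (apply rsum_nonneg; intros; left; apply zsum_term_pos).
      replace ((sqrt (4 * Z) * zsum 2 M + sqrt (4 * Z) * zsum 2 n) * (sqrt (4 * Z) * T))
        with ((sqrt (4 * Z) * sqrt (4 * Z)) * ((zsum 2 M + zsum 2 n) * T)) by ring.
      rewrite Hw.
      assert ((zsum 2 M + zsum 2 n) * T <= 4 * T) by (apply Rmult_le_compat_r; lra).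
      assert (Z * ((zsum 2 M + zsum 2 n) * T) <= Z * (4 * / INR M))
        by (apply Rmult_le_compat_l; lra).
      assert (Z * (16 / INR M) <= Z * (eps / 4)) by (apply Rmult_le_compat_l; lra).
      unfold Rdiv at 1 in H3; lra. }
  assert (Main : Cmod (spt_sum n th * c - RtoC (Z * (PI ^ 4 / 120 * g)))%C <= Z * eps).
  (* Four errors of eps / 4: the tail beyond [M], the rational factors, the partition ratio, and the
     constant cut at [M]. *)
  { replace (spt_sum n th * c - RtoC (Z * (PI ^ 4 / 120 * g)))%C with
      ((spt_sum n th - SM) * c + RtoC Z * ((Q * (BM - RtoC sM) + RtoC sM * (Q - RtoC g))
        + RtoC g * RtoC (sM - PI ^ 4 / 120)))%C.
    2:{ transitivity (spt_sum n th * c - SM * c + RtoC Z * (Q * BM) - RtoC Z * RtoC g * RtoC (PI ^ 4 / 120))%C.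
        - rewrite RtoC_minus; ring.
        - rewrite <- ESM, !RtoC_mult; ring. }
    eapply Rle_trans; [apply Cmod_triangle|].
    rewrite Cmod_mult; unfold c at 1; rewrite Cmod_cis, Rmult_1_r.
    rewrite Cmod_mult, Cmod_R, (Rabs_pos_eq Z) by lra.
    assert (B1 : Cmod (Q * (BM - RtoC sM))%C <= eps / 4).
    { rewrite Cmod_mult; pose proof (Cmod_ge_0 (BM - RtoC sM)%C); pose proof (Cmod_ge_0 Q); nra. }
    assert (B2 : Cmod (RtoC sM * (Q - RtoC g))%C <= eps / 4).
    { rewrite Cmod_mult, Cmod_R.
      apply Rle_trans with (s1 * (eps / (4 * s1))); [|right; field; lra].
      apply Rmult_le_compat; [apply Rabs_pos|apply Cmod_ge_0|unfold s1; lra|lra]. }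
    assert (B3 : Cmod (RtoC g * RtoC (sM - PI ^ 4 / 120))%C <= eps / 4).
    { rewrite Cmod_mult, !Cmod_R, (Rabs_pos_eq g) by lra.
      pose proof (Rabs_pos (sM - PI ^ 4 / 120)); simpl in HM0 |- *; nra. }
    assert (B : Cmod (Q * (BM - RtoC sM) + RtoC sM * (Q - RtoC g)
        + RtoC g * RtoC (sM - PI ^ 4 / 120))%C <= eps / 4 + eps / 4 + eps / 4).
    { eapply Rle_trans; [apply Cmod_triangle|apply Rplus_le_compat; [|exact B3]].
      eapply Rle_trans; [apply Cmod_triangle|apply Rplus_le_compat; assumption]. }
    apply (Rmult_le_compat_l Z) in B; lra. }
  rewrite spt_integrand_Re; fold c.
  eapply Rle_trans; [|exact Main]; eapply Rle_trans; [|apply re_le_Cmod].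
  right; f_equal; unfold Re; simpl; ring.
Qed.

Lemma is_RInt_inv_sq (a b : R) : 0 < a <= b -> is_RInt (fun x => / x ^ 2) a b (/ a - / b).
Proof.
  intros H; refine (is_RInt_eq _ _ _ _ _ _ (is_RInt_derive (fun x => - / x) _ a b _ _)).
  - unfold minus, plus, opp; simpl; ring.
  - intros x Hx; rewrite Rmin_left, Rmax_right in Hx by lra.
    auto_derive; [lra|field; lra].
  - intros x Hx; rewrite Rmin_left, Rmax_right in Hx by lra.
    apply (ex_derive_continuous (V := R_NormedModule)); auto_derive.
    apply Rgt_not_eq, Rmult_lt_0_compat; lra.
Qed.

Lemma is_RInt_gaussian_scaled (A d : R) :
  0 < d -> is_RInt (fun th => gaussian (th / d)) 0 (A * d) (d * gauss_int A).
Proof.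
  intros Hd.
  assert (H0 : is_RInt gaussian (/ d * 0 + 0) (/ d * (A * d) + 0) (gauss_int A)).
  { replace (/ d * 0 + 0) with 0 by ring.
    replace (/ d * (A * d) + 0) with A by (field; lra).
    apply (RInt_correct (V := R_CompleteNormedModule)), gaussian_int_ex. }
  apply (is_RInt_comp_lin (V := R_NormedModule)), (is_RInt_scal (V := R_NormedModule) _ _ _ d) in H0.
  eapply is_RInt_ext; [|exact H0]; intros x _.
  change (d * (/ d * gaussian (/ d * x + 0)) = gaussian (x / d)).
  rewrite <- Rmult_assoc, Rinv_r, Rmult_1_l by lra; f_equal; field; lra.
Qed.

(** The arc up to A t^(3/2) contributes the Gaussian integral up to [A], the rest an amount of order
    1/A plus a term that vanishes as t tends to 0; [A] is fixed before [n] grows. *)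
Lemma spt_normalized_lim (J : R) :
  (forall A, 0 <= A -> gauss_int A <= J) ->
  (forall eps, 0 < eps -> exists A0, 0 <= A0 /\ forall A, A0 <= A -> J - eps < gauss_int A) ->
  is_lim_seq (fun n => PI * (spt_gen e n * exp (- saddle n) ^ n) / (spt_scale n * saddle_width n))
    (PI ^ 4 / 120 * J).
Proof.
  intros HJ HJ'; apply is_lim_seq_spec; intros [eta Heta]; cbn [pos].
  pose proof minor_rate_bounds as MR; set (c := minor_rate) in *.
  set (S0 := PI ^ 4 / 120).
  assert (HS0 : 0 < S0) by (unfold S0; pose proof (pow_lt PI 4 PI_RGT_0); lra).
  destruct (HJ' (eta / (8 * S0))) as [A0 [HA0 HA]]; [apply Rdiv_lt_0_compat; lra|].
  (* [A0] makes the missing part of the Gaussian integral small, the last entry the contribution 4 /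
     (c A) of the outer arc. *)
  set (A := Rmax (Rmax A0 1) (32 / (c * eta))).
  assert (A1 : A0 <= A /\ 1 <= A /\ 32 / (c * eta) <= A).
  { unfold A; pose proof (Rmax_l (Rmax A0 1) (32 / (c * eta))).
    pose proof (Rmax_r (Rmax A0 1) (32 / (c * eta))).
    pose proof (Rmax_l A0 1); pose proof (Rmax_r A0 1); lra. }
  destruct A1 as [A1 [A2 A3]]; specialize (HA A A1); pose proof (HJ A ltac:(lra)) as HJA.
  assert (HcA : 4 / (c * A) <= eta / 8).
  { apply Rmult_le_reg_r with (c * A); [apply Rmult_lt_0_compat; lra|].
    replace (4 / (c * A) * (c * A)) with 4 by (field; lra).
    apply (Rmult_le_compat_l (c * eta)) in A3; [|apply Rmult_le_pos; lra].
    replace (c * eta * (32 / (c * eta))) with 32 in A3 by (field; lra). lra. }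
  destruct (spt_integrand_center A (eta / (8 * A))) as [N1 HN1]; [lra|apply Rdiv_lt_0_compat; lra|].
  set (C4 := 3072 / c ^ 4 * 4).
  assert (HC4 : 0 < C4) by (unfold C4; apply Rmult_lt_0_compat; [apply Rdiv_lt_0_compat; [|apply pow_lt]|]; lra).
  (* 1/8 admits the bound off the centre, / A^2 keeps the central arc within th <= 1, and the last
     entry makes the t^4 part negligible over a length PI < 4. *)
  set (d0 := Rmin (1 / 8) (Rmin (/ A ^ 2) (eta / (8 * C4)))).
  assert (Hd0 : 0 < d0).
  { repeat apply Rmin_pos; [lra|apply Rinv_0_lt_compat, pow_lt; lra|apply Rdiv_lt_0_compat; lra]. }
  destruct (saddle_eventually d0 Hd0) as [N2 HN2].
  exists (Nat.max N1 N2); intros n Hn.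
  specialize (HN1 n ltac:(lia)); specialize (HN2 n ltac:(lia)).
  pose proof (Rmin_l (1 / 8) (Rmin (/ A ^ 2) (eta / (8 * C4)))) as D1.
  pose proof (Rmin_r (1 / 8) (Rmin (/ A ^ 2) (eta / (8 * C4)))) as D2.
  pose proof (Rmin_l (/ A ^ 2) (eta / (8 * C4))) as D3.
  pose proof (Rmin_r (/ A ^ 2) (eta / (8 * C4))) as D4; fold d0 in D1, D2.
  pose proof (saddle_pos n) as Ht; pose proof (spt_scale_pos n) as Zp.
  pose proof (saddle_width_pos n) as Wp; pose proof (saddle_width_sq n) as W2.
  set (Z := spt_scale n) in *; set (d := saddle_width n) in *; set (t := saddle n) in *.
  assert (HPI : 3 < PI < 4).
  { pose proof PI2_3_2 as HP; unfold PI2 in HP; pose proof PI_sq_bounds; split; [lra|nra]. }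
  assert (Had : A * d <= 1).
  { apply Rsqr_incr_0_var; [|lra]; rewrite !Rsqr_pow2, Rpow_mult_distr, W2.
    assert (t ^ 3 <= t) by (simpl; nra).
    assert (A ^ 2 * t <= A ^ 2 * / A ^ 2) by (apply Rmult_le_compat_l; [apply pow2_ge_0|lra]).
    rewrite Rinv_r in H0 by (apply pow_nonzero; lra).
    assert (A ^ 2 * t ^ 3 <= A ^ 2 * t) by (apply Rmult_le_compat_l; [apply pow2_ge_0|lra]).
    lra. }
  assert (Had0 : 0 < A * d) by (apply Rmult_lt_0_compat; lra).
  pose proof (spt_integrand_RInt n) as HI.
  set (I := PI * (spt_gen e n * exp (- t) ^ n)) in *.
  assert (X : ex_RInt (spt_integrand n) 0 PI) by (eexists; exact HI).
  assert (X1 : ex_RInt (spt_integrand n) 0 (A * d))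
    by (apply (ex_RInt_Chasles_1 (V := R_CompleteNormedModule)) with PI; [lra|exact X]).
  assert (X2 : ex_RInt (spt_integrand n) (A * d) PI)
    by (apply (ex_RInt_Chasles_2 (V := R_CompleteNormedModule)) with 0; [lra|exact X]).
  destruct X1 as [I1 HI1]; destruct X2 as [I2 HI2].
  assert (EI : I = I1 + I2).
  { pose proof (is_RInt_Chasles (V := R_NormedModule) _ _ _ _ _ _ HI1 HI2) as HC.
    apply (is_RInt_unique (V := R_CompleteNormedModule)) in HI.
    apply (is_RInt_unique (V := R_CompleteNormedModule)) in HC.
    rewrite HI in HC; exact HC. }
  assert (B1 : Rabs (I1 - Z * (S0 * (d * gauss_int A))) <= A * d * (Z * (eta / (8 * A)))).
  { pose proof (is_RInt_gaussian_scaled A d Wp) as GI.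
    apply (is_RInt_scal (V := R_NormedModule) _ _ _ S0) in GI.
    apply (is_RInt_scal (V := R_NormedModule) _ _ _ Z) in GI.
    pose proof (is_RInt_minus (V := R_NormedModule) _ _ _ _ _ _ HI1 GI) as DI.
    pose proof (is_RInt_const (V := R_NormedModule) 0 (A * d) (Z * (eta / (8 * A)))) as CI.
    replace (A * d * (Z * (eta / (8 * A)))) with (scal (A * d - 0) (Z * (eta / (8 * A))))
      by (unfold scal; simpl; unfold mult; simpl; ring).
    refine (norm_RInt_le (V := R_NormedModule) _ _ _ _ _ _ _ _ DI CI); [lra|].
    intros x Hx; apply HN1; lra. }
  assert (B2 : Rabs I2 <= Z * (d * (eta / 8 + eta / 8))).
  { pose proof (is_RInt_inv_sq (A * d) PI ltac:(lra)) as GI.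
    apply (is_RInt_scal (V := R_NormedModule) _ _ _ (4 / c * t ^ 3)) in GI.
    pose proof (is_RInt_const (V := R_NormedModule) (A * d) PI (3072 / c ^ 4 * t ^ 4)) as CI.
    pose proof (is_RInt_plus (V := R_NormedModule) _ _ _ _ _ _ CI GI) as SI.
    apply (is_RInt_scal (V := R_NormedModule) _ _ _ Z) in SI.
    apply Rle_trans with (Z * ((PI - A * d) * (3072 / c ^ 4 * t ^ 4)
                              + 4 / c * t ^ 3 * (/ (A * d) - / PI))).
    - refine (norm_RInt_le (V := R_NormedModule) _ _ _ _ _ _ _ _ HI2 SI); [lra|].
      intros x Hx; apply spt_integrand_minor; fold t; lra.
    - apply Rmult_le_compat_l; [lra|].
      assert (T1 : (PI - A * d) * (3072 / c ^ 4 * t ^ 4) <= d * (eta / 8)).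
      { assert (Hc4 : 0 < 3072 / c ^ 4) by (apply Rdiv_lt_0_compat; [lra|apply pow_lt; lra]).
        assert (t4 : t ^ 4 <= d * t).
        { assert (t ^ 3 <= d).
          { rewrite <- W2; assert (d <= 1) by nra; simpl; nra. }
          replace (t ^ 4) with (t ^ 3 * t) by ring; apply Rmult_le_compat_r; lra. }
        assert (t40 : 0 < t ^ 4) by (apply pow_lt, Ht).
        apply Rle_trans with (4 * (3072 / c ^ 4 * t ^ 4)).
        - apply Rmult_le_compat_r; [apply Rmult_le_pos; lra|lra].
        - apply Rle_trans with (C4 * (d * t)).
          + unfold C4; rewrite (Rmult_comm (3072 / c ^ 4) 4), <- Rmult_assoc.
            apply Rmult_le_compat_l; [lra|exact t4].
          + replace (C4 * (d * t)) with (d * (C4 * t)) by ring.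
            apply Rmult_le_compat_l; [lra|].
            apply Rle_trans with (C4 * (eta / (8 * C4))); [apply Rmult_le_compat_l; lra|].
            right; field; lra. }
      assert (T2 : 4 / c * t ^ 3 * (/ (A * d) - / PI) <= d * (eta / 8)).
      { assert (0 < / PI) by (apply Rinv_0_lt_compat; lra).
        apply Rle_trans with (4 / c * t ^ 3 * / (A * d)).
        - apply Rmult_le_compat_l; [|lra].
          apply Rmult_le_pos; [apply Rdiv_le_0_compat; lra|apply pow_le; lra].
        - apply Rle_trans with (d * (4 / (c * A))); [|apply Rmult_le_compat_l; lra].
          right; rewrite <- W2; field; repeat split; lra. }
      lra. }
  assert (HZd : 0 < Z * d) by (apply Rmult_lt_0_compat; lra).
  replace (I / (Z * d) - S0 * J) with
    ((I1 - Z * (S0 * (d * gauss_int A)) + I2 + Z * d * (S0 * (gauss_int A - J))) / (Z * d))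
    by (rewrite EI; field; split; lra).
  unfold Rdiv; rewrite Rabs_mult, (Rabs_pos_eq (/ (Z * d))) by (left; apply Rinv_0_lt_compat, HZd).
  apply Rmult_lt_reg_r with (Z * d); [exact HZd|].
  rewrite Rmult_assoc, Rinv_l, Rmult_1_r by lra.
  assert (B3 : Rabs (Z * d * (S0 * (gauss_int A - J))) <= Z * d * (eta / 8)).
  { rewrite Rabs_mult, (Rabs_pos_eq (Z * d)) by lra; apply Rmult_le_compat_l; [lra|].
    rewrite Rabs_mult, (Rabs_pos_eq S0), Rabs_left1 by lra.
    apply Rle_trans with (S0 * (eta / (8 * S0))); [apply Rmult_le_compat_l; lra|].
    right; field; lra. }
  replace (A * d * (Z * (eta / (8 * A)))) with (Z * d * (eta / 8)) in B1 by (field; lra).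
  eapply Rle_lt_trans; [apply Rabs_triang|].
  eapply Rle_lt_trans; [apply Rplus_le_compat_r, Rabs_triang|].
  assert (0 < Z * d * eta) by (apply Rmult_lt_0_compat; lra).
  lra.
Qed.

Definition spt_main (n : nat) : R := sqrt 3 / 40 * INR n * exp (PI * sqrt (2 * INR n / 3)).

(** The scale contributes t^(-4), the arc t^(3/2) and P a further sqrt t, together t^(-2) = 6 n /
    PI^2. The exponents n t and PI^2 / (6 t) coincide at the saddle point and add up to PI sqrt (2 n
    / 3). *)
Lemma spt_gen_asymp : asymp_equiv (spt_gen e) spt_main.
Proof.
  destruct gauss_int_lim as [J [J0 [HJ HJ']]].
  pose proof gauss_sigma_pos as Hs.
  set (D := fun n => log_partition n (saddle n) - PI ^ 2 / (6 * saddle n) - ln (saddle n) / 2).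
  assert (HD : is_lim_seq D (- ln (2 * (gauss_sigma * J)))).
  { pose proof (log_partition_defect_lim J J0 HJ HJ') as R0.
    apply is_lim_seq_spec; intros [eps Heps]; simpl.
    destruct (R0 (eps / 2) ltac:(lra)) as [t0 [Ht0 Hlim]].
    (* Passing from all parts to parts at most [n] changes ln P by at most e^(-x) x with x = PI^2 /
       (6 t) >= 1/t, hence by at most 256 t. *)
    set (d0 := Rmin (1 / 8) (Rmin (t0 / 2) (eps / 1024))).
    assert (Hd0 : 0 < d0) by (repeat apply Rmin_pos; lra).
    destruct (saddle_eventually d0 Hd0) as [N HN]; exists N; intros n Hn; specialize (HN n Hn).
    pose proof (Rmin_l (1 / 8) (Rmin (t0 / 2) (eps / 1024))) as D1.
    pose proof (Rmin_r (1 / 8) (Rmin (t0 / 2) (eps / 1024))) as D2.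
    pose proof (Rmin_l (t0 / 2) (eps / 1024)) as D3.
    pose proof (Rmin_r (t0 / 2) (eps / 1024)) as D4; fold d0 in D1, D2.
    pose proof (saddle_pos n) as Ht.
    destruct (saddle_le_1 n ltac:(lra)) as [Hn1 E].
    unfold D; set (t := saddle n) in *.
    specialize (Hlim t ltac:(lra)).
    destruct (log_partition_bounds n t Ht) as [P1 P2].
    destruct (log_partition_inf_upper t Ht) as [L0 L1].
    pose proof PI_sq_bounds as HP.
    assert (Hx : / t <= PI ^ 2 / (6 * t)).
    { replace (PI ^ 2 / (6 * t)) with (PI ^ 2 / 6 * / t) by (field; lra).
      assert (0 < / t) by (apply Rinv_0_lt_compat, Ht). nra. }
    assert (EN : INR n * t = PI ^ 2 / (6 * t)).
    { replace (PI ^ 2 / (6 * t)) with (PI ^ 2 / 6 / t) by (field; lra).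
      rewrite <- E; field; lra. }
    assert (Small : exp (- (INR n * t)) * log_partition_inf t <= eps / 4).
    { assert (0 < / t) by (apply Rinv_0_lt_compat, Ht).
      assert (Hxp : 0 < PI ^ 2 / (6 * t)) by lra.
      rewrite EN; apply Rle_trans with (256 / (PI ^ 2 / (6 * t)) ^ 4 * (PI ^ 2 / (6 * t))).
      - apply Rmult_le_compat; [left; apply exp_pos|lra|apply exp_neg_le_pow4, Hxp|lra].
      - set (x := PI ^ 2 / (6 * t)) in *.
        replace (256 / x ^ 4 * x) with (256 * (/ x) ^ 3) by (field; lra).
        assert (Hi : 0 < / x <= t).
        { split; [apply Rinv_0_lt_compat, Hxp|].
          rewrite <- (Rinv_inv t); apply Rinv_le_contravar; lra. }
        assert ((/ x) ^ 3 <= t ^ 3) by (apply pow_incr; lra).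
        assert (t ^ 3 <= t) by (simpl; nra). lra. }
    unfold log_partition_defect in Hlim; apply Rabs_lt_between in Hlim.
    apply Rabs_lt_between; lra. }
  assert (HE : is_lim_seq (fun n => exp (D n)) (/ (2 * (gauss_sigma * J)))).
  { replace (/ (2 * (gauss_sigma * J))) with (exp (- ln (2 * (gauss_sigma * J)))).
    - apply (is_lim_seq_continuous exp D (- ln (2 * (gauss_sigma * J)))); [|exact HD].
      apply derivable_continuous_pt, derivable_pt_exp.
    - rewrite exp_Ropp, exp_ln; [reflexivity|].
      assert (0 < gauss_sigma * J) by (apply Rmult_lt_0_compat; lra). lra. }
  pose proof (spt_normalized_lim J HJ HJ') as HX.
  assert (S3 : 0 < sqrt 3) by (apply sqrt_lt_R0; lra).
  unfold asymp_equiv.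
  (* [J] cancels here. The last factor is 6 / PI^3, from t^(-2) and the PI of the coefficient
     integral, divided by sqrt 3 / 40. *)
  replace (Finite 1) with
    (Finite (PI ^ 4 / 120 * J * / (2 * (gauss_sigma * J)) * (240 / (PI ^ 3 * sqrt 3)))).
  2:{ f_equal; unfold gauss_sigma; pose proof PI_RGT_0; field; repeat split; lra. }
  destruct (saddle_eventually 1 ltac:(lra)) as [N HN].
  eapply is_lim_seq_ext_loc; [|apply is_lim_seq_mult';
    [apply is_lim_seq_mult'; [exact HX|exact HE]|apply is_lim_seq_const]].
  exists N; intros n Hn; specialize (HN n Hn); cbv beta.
  destruct (saddle_le_1 n HN) as [Hn1 E]; pose proof (saddle_pos n) as Ht.
  assert (Hn0 : 0 < INR n) by (apply lt_0_INR; lia).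
  assert (Et : saddle n = PI / sqrt (6 * INR n)) by (unfold saddle; do 4 f_equal; lia).
  pose proof PI_RGT_0 as HPI.
  assert (Exp2 : PI * sqrt (2 * INR n / 3) = INR n * saddle n + PI ^ 2 / (6 * saddle n)).
  { assert (S6 : 0 < sqrt (6 * INR n)) by (apply sqrt_lt_R0; lra).
    assert (Q6 : sqrt (6 * INR n) ^ 2 = 6 * INR n) by (apply pow2_sqrt; lra).
    replace (sqrt (2 * INR n / 3)) with (sqrt (6 * INR n) / 3).
    - rewrite Et.
      replace (INR n) with (sqrt (6 * INR n) ^ 2 / 6) at 2 by (rewrite Q6; field).
      field; repeat split; lra.
    - replace (2 * INR n / 3) with ((6 * INR n) * / 9) by field.
      rewrite (sqrt_mult (6 * INR n) (/ 9)) by lra; replace (/ 9) with ((/ 3) ^ 2) by field.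
      rewrite sqrt_pow2 by lra; reflexivity. }
  unfold spt_main; rewrite Exp2, exp_plus.
  unfold D, spt_scale, saddle_width; set (t := saddle n) in *.
  unfold Rminus; rewrite exp_neg_pow, !exp_plus, !exp_Ropp.
  assert (Sq : exp (ln t / 2) = sqrt t).
  { rewrite <- (sqrt_pow2 (exp (ln t / 2))) by (left; apply exp_pos); f_equal.
    replace (exp (ln t / 2) ^ 2) with (exp (ln t / 2) * exp (ln t / 2)) by ring.
    rewrite <- exp_plus; replace (ln t / 2 + ln t / 2) with (ln t) by field.
    apply exp_ln, Ht. }
  rewrite Sq.
  assert (St : 0 < sqrt t) by (apply sqrt_lt_R0, Ht).
  pose proof (exp_pos (log_partition n t)); pose proof (exp_pos (PI ^ 2 / (6 * t))).
  pose proof (exp_pos (INR n * t)).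
  set (h := sqrt t) in *; assert (h2 : t = h * h) by (symmetry; apply sqrt_sqrt; lra).
  assert (HN2 : INR n = PI ^ 2 / 6 / t ^ 2) by (rewrite <- E; field; lra).
  set (a := exp (log_partition n t)) in *; set (b := exp (PI ^ 2 / (6 * t))) in *.
  set (g := exp (INR n * t)) in *; clearbody a b g.
  rewrite HN2; clear HN2 E Exp2 Et Hn0; clearbody h.
  rewrite h2; field; repeat split; lra.
Qed.

End Saddle.

Theorem theorem1p5 :
  asymp_equiv SPT_plus SPT_minus /\
  asymp_equiv SPT_minus
    (fun n : nat => sqrt 3 / 40 * INR n * exp (PI * sqrt (2 * INR n / 3))).
Proof.
  pose proof (spt_gen_asymp (fun _ n2 => n2) (fun _ n2 => le_n n2)) as Hp.
  pose proof (spt_gen_asymp (fun n1 n2 => n1 * n2 + n2)%nat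
    (fun n1 n2 => Nat.le_add_l n2 (n1 * n2))) as Hm.
  change (asymp_equiv SPT_plus spt_main) in Hp; change (asymp_equiv SPT_minus spt_main) in Hm.
  split; [|exact Hm].
  unfold asymp_equiv in *.
  replace (Finite 1) with (Finite (1 / 1)) by (f_equal; field).
  eapply is_lim_seq_ext_loc; [|apply (is_lim_seq_div' _ _ _ _ Hp Hm); lra].
  (* At n = 0 the comparison function vanishes, so the cancellation starts at 1. *)
  exists 1%nat; intros n Hn; cbv beta.
  assert (spt_main n <> 0).
  { unfold spt_main; apply Rgt_not_eq; pose proof (sqrt_lt_R0 3 ltac:(lra)).
    repeat apply Rmult_lt_0_compat; try lra; [apply lt_0_INR; lia|apply exp_pos]. }
  unfold Rdiv; rewrite Rinv_mult, Rinv_inv.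
  replace (SPT_plus n * / spt_main n * (/ SPT_minus n * spt_main n))
    with (SPT_plus n * / SPT_minus n * (/ spt_main n * spt_main n)) by ring.
  rewrite Rinv_l by assumption; ring.
Qed.
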